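(* Let $n=2$ and let $\Omega\subset\mathbb{R}^2$ be a bounded open region with connected boundary. Suppose $u$ and $\tilde u$ are admissible (with the same constants $\sigma_0,\sigma_1,m,M$) with $u|_{\partial\Omega}=\tilde u|_{\partial\Omega}=f$, corresponding conductivities $\sigma,\tilde\sigma$, and current density vector fields $J=-\sigma\nabla u$ and $\tilde J=-\tilde\sigma\nabla\tilde u$, respectively. Suppose $\sigma,\tilde\sigma\in C^2(\overline\Omega)$ and $$\|\sigma\|_{C^2(\Omega)},\ \|\tilde\sigma\|_{C^2(\Omega)}\le\sigma_2$$ for some $\sigma_2\in\mathbb{R}$. If $$\sup_{t\in\mathbb{R}}\int_{\{u=t\}\cap\Omega}1\,dl=L_M<\infty,$$ and the level sets of $u$ are well structured, then $$\|\sigma-\tilde\sigma\|_{L^1(\Omega)}\le C\,\big\||J|-|\tilde J|\big\|_{L^\infty(\Omega)}^{1/4},$$ for some constant $C=C(m,M,\sigma_0,\sigma_1,\sigma_2,\sigma,f,L_M)$ independent of $\tilde\sigma$.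
   Context: Admissible: Fix positive constants $\sigma_0,\sigma_1$ and $0<m\le M$. A function $u\in C^1(\overline\Omega)$ is admissible if it solves the conductivity equation $\nabla\cdot(\sigma\nabla u)=0$ in $\Omega$, $u|_{\partial\Omega}=f$, for some $\sigma\in C(\Omega)$ (the corresponding conductivity) with $0<\sigma_0<\sigma\le\sigma_1$, and $m\le|J|=|\sigma\nabla u|\le M$ in $\Omega$, where $J=-\sigma\nabla u$ is the corresponding current density vector field. Here $dl$ denotes arc length (one-dimensional Hausdorff measure). Well structured level sets ($n=2$): Let $u$ be admissible and $x\in\Omega$. Pick $h\in\mathbb{R}^2$ with $|h|=1$ and $t\in\mathbb{R}$ small enough that $x+th\in\Omega$. Let $\Gamma$ and $\Gamma_t$ be the level sets (curves) of $u$ passing through $x$ and $x+th$, respectively, and let $\gamma$ and $\gamma_t$ be their parametrizations by arc length such that $\gamma(0),\gamma_t(0)\in\partial\Omega$. Let $L$ denote the length of $\Gamma$. The level sets of $u$ are well structured if: (a) There exists $K\ge0$ such that $\left|\frac{\gamma_t'(s)-\gamma'(s)}{t}\right|\le K$ for every $s\in[0,L]$, every $t\in\mathbb{R}$ with $t\neq0$ and small enough that $x+th\in\Omega$, every $x\in\Omega$ and $h\in S^{1}$. In particular $\gamma_t'(s)\to\gamma'(s)$ as $t\to0$. (b) There exists a bounded function $F_{x,h}(s)=F(x,h;s)\in L^\infty(\Omega\times S^{1}\times[0,L_M])$ such that $\lim_{t\to0}\frac{\gamma_t(s)-\gamma(s)}{t}=F_{x,h}(s)$ for every $s\in[0,L]$,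 $x\in\Omega$ and $h\in S^{1}$. *)

(* Defs.v *)
From HB Require Import structures.
From mathcomp Require Import all_boot all_order all_algebra.
From mathcomp Require Import all_classical all_reals all_analysis.
Set Implicit Arguments.
Unset Strict Implicit.
Unset Printing Implicit Defensive.
Import Order.TTheory GRing.Theory Num.Theory.
Import numFieldNormedType.Exports.
Local Open Scope classical_set_scope.
Local Open Scope ring_scope.

(* The plane is R * R. Its library norm is the sup norm, which gives the usual
   topology; lengths are measured with the Euclidean norm below. *)
Definition dot2 {R : realType} (v w : R * R) : R := v.1 * w.1 + v.2 * w.2.

Definition enorm {R : realType} (v : R * R) : R := Num.sqrt (dot2 v v).

Definition boundary {T : topologicalType} (A : set T) : set T :=
  closure A `\` interior A.

Definition lebesgue2 {R : realType} :=
  (@lebesgue_measure R \x @lebesgue_measure R)%E.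

(* diam set0 = 0 *)
Definition ediam {R : realType} (A : set (R * R)) : \bar R :=
  maxe 0%E (ereal_sup [set (enorm (p.1 - p.2))%:E | p in A `*` A]).

(* In dimension one the normalizing constant of the Hausdorff measure is 1. *)
Definition hausdorff1_pre {R : realType} (delta : R) (A : set (R * R)) :
    \bar R :=
  ereal_inf [set (\sum_(0 <= i <oo) ediam (U i))%E | U in
    [set U : nat -> set (R * R) |
      A `<=` \bigcup_i U i /\ forall i, (ediam (U i) <= delta%:E)%E]].

Definition hausdorff1 {R : realType} (A : set (R * R)) : \bar R :=
  ereal_sup [set hausdorff1_pre delta A | delta in [set d : R | 0 < d]].

Definition d1 {R : realType} (f : R * R -> R) (x : R * R) : R :=
  'D_(1, 0) f x.

Definition d2 {R : realType} (f : R * R -> R) (x : R * R) : R :=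
  'D_(0, 1) f x.

Definition grad {R : realType} (f : R * R -> R) (x : R * R) : R * R :=
  (d1 f x, d2 f x).

Definition extends_continuously {R : realType} (Omega : set (R * R))
    (g : R * R -> R) : Prop :=
  exists g' : R * R -> R,
    {within closure Omega, continuous g'} /\ {in Omega, g =1 g'}.

(* C^k of the closure of an open set: all iterated partial derivatives of order
   at most k exist in Omega and extend continuously to the closure. Only the
   values of f in Omega matter. *)
Fixpoint Ck_closure {R : realType} (k : nat) (Omega : set (R * R))
    (f : R * R -> R) : Prop :=
  extends_continuously Omega f /\
  match k with
  | 0 => True
  | k'.+1 =>
      [/\ forall x, Omega x -> derivable f x (1, 0) /\ derivable f x (0, 1),
          Ck_closure k' Omega (d1 f) & Ck_closure k' Omega (d2 f)]
  end.

Definition supnorm {R : realType} (Omega : set (R * R)) (g : R * R -> R) :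
    \bar R :=
  ereal_sup [set `|g x|%:E | x in Omega].

(* Sum of the sup norms of the partial derivatives over all multi-indices of
   order at most 2. *)
Definition C2norm {R : realType} (Omega : set (R * R)) (g : R * R -> R) :
    \bar R :=
  (supnorm Omega g + (supnorm Omega (d1 g) + supnorm Omega (d2 g)) +
   (supnorm Omega (d1 (d1 g)) + supnorm Omega (d1 (d2 g)) +
    supnorm Omega (d2 (d2 g))))%E.

Definition L1norm {R : realType} (Omega : set (R * R)) (g : R * R -> R) :
    \bar R :=
  'N[lebesgue2]_1[EFin \o (g \_ Omega)]%E.

Definition Linftynorm {R : realType} (Omega : set (R * R)) (g : R * R -> R) :
    \bar R :=
  'N[lebesgue2]_+oo[EFin \o (g \_ Omega)]%E.

Definition test_function {R : realType} (Omega : set (R * R))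
    (phi : R * R -> R) : Prop :=
  [/\ forall k, Ck_closure k setT phi,
      compact (closure [set x | phi x != 0]) &
      closure [set x | phi x != 0] `<=` Omega].

(* As sigma is merely continuous and u merely C^1, the equation
   div (sigma grad u) = 0 is understood in the sense of distributions. *)
Definition conductivity_equation {R : realType} (Omega : set (R * R))
    (sigma u : R * R -> R) : Prop :=
  forall phi, test_function Omega phi ->
    (\int[lebesgue2]_(x in Omega)
       (sigma x * dot2 (grad u x) (grad phi x))%:E)%E = 0%E.

Definition current {R : realType} (sigma u : R * R -> R) (x : R * R) : R * R :=
  - (sigma x *: grad u x).

(* u is admissible with corresponding conductivity sigma. *)
Definition admissible {R : realType} (sigma0 sigma1 m M : R)
    (Omega : set (R * R)) (f sigma u : R * R -> R) : Prop :=
  [/\ Ck_closure 1 Omega u /\ {within closure Omega, continuous u},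
      forall x, Omega x -> {for x, continuous sigma},
      conductivity_equation Omega sigma u /\
        (forall x, boundary Omega x -> u x = f x),
      forall x, Omega x -> sigma0 < sigma x <= sigma1 &
      forall x, Omega x -> m <= enorm (current sigma u x) <= M].

(* The level curve of u through x: a level set of u in Omega may consist of
   several curves, of which this is the one containing x. *)
Definition level_curve {R : realType} (Omega : set (R * R)) (u : R * R -> R)
    (x : R * R) : set (R * R) :=
  connected_component [set y | Omega y /\ u y = u x] x.

Definition curve_length {R : realType} (Gamma : set (R * R)) : R :=
  fine (hausdorff1 Gamma).

(* g, with derivative g' (one-sided at 0 and at the length L of Gamma), is a
   parametrization by arc length of Gamma on [0, L] starting on the boundary of
   Omega. As Gamma lies in the open set Omega, it is the image of ]0, L[. *)
Definition arclength_param {R : realType} (Omega Gamma : set (R * R))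
    (g g' : R -> R * R) : Prop :=
  let L := curve_length Gamma in
  [/\ 0 < L,
      boundary Omega (g 0),
      set_inj `]0, L[ g /\ g @` `]0, L[ = Gamma &
      forall s : R, s \in `[0, L] ->
        (fun r => (r - s)^-1 *: (g r - g s)) @ within `[0, L] s^' --> g' s /\
        enorm (g' s) = 1].

(* gamma x is the chosen parametrization (i.e. the choice of starting end) of
   the level curve through x, so that gamma_t is gamma (x + t *: h). Conditions
   relating gamma and gamma_t at s are required whenever s lies in the
   intervals of definition of both. *)
Definition well_structured {R : realType} (Omega : set (R * R))
    (u : R * R -> R) (LM : R) : Prop :=
  let L x := curve_length (level_curve Omega u x) in
  exists gamma gamma' : R * R -> R -> R * R,
  [/\ forall x, Omega x ->
        arclength_param Omega (level_curve Omega u x) (gamma x) (gamma' x),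
      exists K : R, 0 <= K /\
        forall x h (t s : R), Omega x -> enorm h = 1 ->
          t != 0 -> Omega (x + t *: h) ->
          s \in `[0, L x] -> s \in `[0, L (x + t *: h)] ->
          enorm (t^-1 *: (gamma' (x + t *: h) s - gamma' x s)) <= K &
      exists F : R * R -> R * R -> R -> R * R,
        [/\ exists B : R, forall x h (s : R), Omega x -> enorm h = 1 ->
              s \in `[0, LM] -> enorm (F x h s) <= B,
            measurable_fun
              (Omega `*` [set h | enorm h = 1] `*` `[0, LM])
              (fun p : (R * R) * (R * R) * R => F p.1.1 p.1.2 p.2) &
            forall x h (s : R), Omega x -> enorm h = 1 -> s \in `[0, L x] ->
              (fun t => t^-1 *: (gamma (x + t *: h) s - gamma x s)) @
                within [set t | Omega (x + t *: h) /\
                                s \in `[0, L (x + t *: h)]] (0 : R)^'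
              --> F x h s]].

(* Main.v *)
(* Let [w = u - u'], which vanishes on the boundary, let [J], [J'] be the currents, and
   let [e] bound [| |J| - |J'| |]. Testing both equations with truncations of [w] and
   subtracting shows that the integral of [|grad u| |grad u'| - grad u . grad u'],
   hence that of [|J - J'|^2], is [O(e)]. The rotated gradient of [u] is divergence free
   and tangent to the level curves of [u]; as these are well structured, arc length
   along them is a bounded, locally Lipschitz function on [Omega] with derivative
   [+- |grad u|] in the direction of that field. Testing with arc length times the
   square of a truncation of [w] gives a Poincare inequality along level curves:
   the integral of [w^2] is [O(e)], so that of [|w|] is [O(e^(1/2))]. Finally
   [grad w = - p J + (J' - J) / sigma'] with [p = 1/sigma - 1/sigma'], and testing the
   equation of [u] with [p w] bounds the integral of [p^2] by [O(e^(1/2))], because the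
   derivatives of [p] are bounded. All truncations vanish near [w = 0]; on that set
   [grad u = grad u'] almost everywhere, so there [sigma] and [sigma'] are compared
   directly. The test functions are Lipschitz and differentiable only along the field
   in question, which suffices for passing to the limit in a mollification. *)
Require Import Defs.
From HB Require Import structures.
From mathcomp Require Import all_boot all_order all_algebra.
From mathcomp Require Import all_classical all_reals all_analysis.
From mathcomp Require Import measurable_realfun ess_sup_inf lra ring.
Import Order.TTheory GRing.Theory Num.Theory.
Import numFieldNormedType.Exports.
Local Open Scope classical_set_scope.
Local Open Scope ring_scope.
Set Implicit Arguments.
Unset Strict Implicit.
Unset Printing Implicit Defensive.

(** * Calculus in the plane *)

(** The truncations serve to localize: [u - u'] is continuous up to the boundary and zero there, so
    [|u - u'| >= d] cuts out a compact subset of [Omega]; every bound must then be free of [d]. The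
    regularity of arc length has to come from comparing the parametrizations [gamma x] and [gamma y]
    at equal parameters. As 0 is the only parameter known to lie in all the domains, condition (b)
    is used at 0, where it controls the starting points, and condition (a) carries the comparison
    along the curves. The starting end of each level curve is an arbitrary choice. Condition (a)
    forces its orientation relative to the rotated gradient to be locally constant, hence constant
    as [Omega] is connected. With varying orientation the term with [|grad u|] in the Poincare
    identity could change sign and cancel. With [e = t ^ 4] all rates become integer powers of [t].
    Each passage from the integral of a square to that of an absolute value is a Young inequality,
    with weight [t ^ 2] for [u - u'] and [t] for the conductivities; these two losses produce the
    exponent 1/4. *)

Lemma is_derive_epsP (R : realType) (V W : normedModType R) (f : V -> W)
    (x v : V) (d : W) :
  is_derive x v f d <->
  forall e : R, 0 < e -> exists2 r : R, 0 < r &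
    forall t : R, `|t| < r -> `|f (t *: v + x) - f x - t *: d| <= e * `|t|.
Proof.
have norm_quotient (t : R) : t != 0 ->
    `|d - t^-1 *: (f (t *: v + x) - f x)| * `|t| =
    `|f (t *: v + x) - f x - t *: d|.
  move=> t0; rewrite mulrC -normrZ scalerBr scalerA divff// scale1r.
  by rewrite -normrN opprB.
split=> [[df dfE] e e0|H].
  have : (fun h : R => h^-1 *: ((f \o shift x) (h *: v) - f x)) @ 0^' --> d.
    by rewrite -dfE; exact: df.
  move=> /cvgrPdist_le/(_ _ e0)/nbhs_ballP[r /= r0 rP]; exists r => // t tr.
  have [->|t0] := eqVneq t 0.
    by rewrite scale0r add0r subrr scale0r subrr !normr0 mulr0.
  rewrite -norm_quotient// ler_wpM2r//.
  by apply: (rP t _ t0); rewrite /ball /= sub0r normrN.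
have cvgd : (fun h : R => h^-1 *: ((f \o shift x) (h *: v) - f x)) @ 0^' --> d.
  apply/cvgrPdist_le => e e0; have [r r0 rP] := H _ e0.
  apply/nbhs_ballP; exists r => //= t; rewrite /ball /= sub0r normrN => tr t0.
  have tp : 0 < `|t| by rewrite normr_gt0.
  by rewrite -(ler_pM2r tp) norm_quotient//; exact: rP.
split; first by apply/cvg_ex; exists d.
exact: (cvg_lim _ cvgd).
Qed.

(** Both points vary: a bound against [x] alone would not compare a curve through [x] with its
    tangent line. *)
Definition lip_near (R : realType) (V W : normedModType R) (x : V)
    (f : V -> W) (C : R) :=
  exists2 r : R, 0 < r &
    forall y z, `|y - x| < r -> `|z - x| < r -> `|f y - f z| <= C * `|y - z|.

Section lip_curve.
Context (R : realType) (V W : normedModType R).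
Variables (f : V -> W) (x v : V) (C : R) (c : R -> V) (s : R).
Hypotheses (fC : lip_near x f C) (cv : is_derive s 1 c v) (cs : c s = x).

Lemma lip_near_curve_close (e : R) : 0 < e -> exists2 r : R, 0 < r &
  forall t : R, `|t| < r -> `|f (c (t + s)) - f (t *: v + x)| <= e * `|t|.
Proof.
move=> e0; have [r r0 rP] := fC.
pose C' := `|C| + 1; have C'0 : 0 < C' by rewrite /C' ltr_wpDl.
(* [e / C'] gives the final estimate; the bound by 1 keeps [c (t + s)] within [|t| * (1 + |v|)] of
   [x], inside the Lipschitz ball. *)
pose e' := Num.min (e / C') 1.
have e'0 : 0 < e' by rewrite lt_min divr_gt0//= ltr01.
have [q q0 qP] := (is_derive_epsP _ _ _ _).1 cv _ e'0.
pose N := 1 + `|v|; have N0 : 0 < N by rewrite /N ltr_wpDr.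
exists (Num.min q (r / N)); first by rewrite lt_min q0 divr_gt0.
move=> t; rewrite lt_min => /andP[tq]; rewrite ltr_pdivlMr// => tN.
have h1 : `|c (t + s) - (t *: v + x)| <= e' * `|t|.
  have := qP _ tq; rewrite cs.
  have -> : t *: 1 + s = t + s by rewrite /GRing.scale/= mulr1.
  by rewrite opprD addrA [in X in X -> _]addrAC.
have h2 : `|t *: v + x - x| <= `|t| * `|v| by rewrite addrK normrZ.
have e't : e' * `|t| <= `|t| by rewrite ler_piMl// /e' ge_min lexx orbT.
have tNE : `|t| * N = `|t| + `|t| * `|v| by rewrite /N mulrDr mulr1.
apply: (le_trans (rP _ _ _ _)).
- rewrite -(subrK (t *: v + x) (c (t + s))) -addrA.
  apply: le_lt_trans (ler_normD _ _) _; apply: le_lt_trans tN.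
  by rewrite tNE lerD// (le_trans h1).
- by apply: le_lt_trans h2 _; apply: le_lt_trans tN; rewrite tNE ler_wpDl.
- apply: (@le_trans _ _ (C' * (e' * `|t|))).
    apply: le_trans (ler_wpM2l (ltW C'0) h1).
    by rewrite ler_wpM2r// (le_trans (ler_norm _))// lerDl.
  by rewrite mulrA ler_wpM2r// mulrC -ler_pdivlMr// ge_min lexx.
Qed.

(** A curve and its tangent line differ by [o(t)], and a Lipschitz [f] preserves this. The
    equivalence is used both ways: from the straight direction to a level curve for [u], and back
    for arc length. *)
Lemma is_derive_lip_curve (d : W) :
  is_derive x v f d <-> is_derive s 1 (f \o c) d.
Proof.
have shift1 (t : R) : t *: 1 + s = t + s by rewrite /GRing.scale/= mulr1.
split=> /is_derive_epsP dd; apply/is_derive_epsP => e e0.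
- have e20 : 0 < e / 2 by rewrite divr_gt0.
  have [r r0 rP] := dd _ e20; have [q q0 qP] := lip_near_curve_close e20.
  exists (Num.min r q) => [|t]; first by rewrite lt_min r0.
  rewrite lt_min => /andP[/rP rt /qP qt]; rewrite shift1 /= cs.
  have -> : f (c (t + s)) - f x - t *: d =
      (f (c (t + s)) - f (t *: v + x)) + (f (t *: v + x) - f x - t *: d).
    by rewrite !addrA subrK.
  by rewrite (splitr e) mulrDl (le_trans (ler_normD _ _))// lerD.
- have e20 : 0 < e / 2 by rewrite divr_gt0.
  have [r r0 rP] := dd _ e20; have [q q0 qP] := lip_near_curve_close e20.
  exists (Num.min r q) => [|t]; first by rewrite lt_min r0.
  rewrite lt_min => /andP[/rP rt /qP qt]; move: rt; rewrite shift1 /= cs => rt.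
  have -> : f (t *: v + x) - f x - t *: d =
      (f (t *: v + x) - f (c (t + s))) + (f (c (t + s)) - f x - t *: d).
    by rewrite !addrA subrK.
  by rewrite (splitr e) mulrDl (le_trans (ler_normD _ _))// lerD// distrC.
Qed.

End lip_curve.

Section plane.
Context {R : realType}.
Implicit Types (p q v w x y : R * R) (r : R).

Lemma norm_pair_lt p r : `|p| < r = (`|p.1| < r) && (`|p.2| < r).
Proof. by rewrite prod_normE gt_max. Qed.

Lemma norm_pair_le p r : `|p| <= r = (`|p.1| <= r) && (`|p.2| <= r).
Proof. by rewrite prod_normE ge_max. Qed.

Lemma norm_fst p : `|p.1| <= `|p|.
Proof. by rewrite prod_normE le_max lexx. Qed.

Lemma norm_snd p : `|p.2| <= `|p|.
Proof. by rewrite prod_normE le_max lexx orbT. Qed.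

Lemma enorm_ge0 v : 0 <= enorm v.
Proof. exact: sqrtr_ge0. Qed.

Lemma dot2_ge0 v : 0 <= dot2 v v.
Proof. by rewrite /dot2 -!expr2 addr_ge0 ?sqr_ge0. Qed.

Lemma sqr_enorm v : enorm v ^+ 2 = v.1 ^+ 2 + v.2 ^+ 2.
Proof. by rewrite sqr_sqrtr ?dot2_ge0. Qed.

Lemma dot2C v w : dot2 v w = dot2 w v.
Proof. by rewrite /dot2 mulrC [X in _ + X]mulrC. Qed.

Lemma enormZ r v : enorm (r *: v) = `|r| * enorm v.
Proof.
rewrite /enorm -sqrtr_sqr -sqrtrM ?sqr_ge0//; congr Num.sqrt.
by rewrite /dot2 /= /GRing.scale/=; ring.
Qed.

Lemma enormN v : enorm (- v) = enorm v.
Proof. by rewrite -scaleN1r enormZ normrN1 mul1r. Qed.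

Lemma dot2_le v w : dot2 v w <= enorm v * enorm w.
Proof.
have [h|h] := leP (dot2 v w) 0.
  by rewrite (le_trans h)// mulr_ge0 ?enorm_ge0.
rewrite -(@ler_pXn2r _ 2)// ?nnegrE ?(ltW h)// ?mulr_ge0 ?enorm_ge0//.
rewrite exprMn !sqr_enorm /dot2; have := sqr_ge0 (v.1 * w.2 - v.2 * w.1); nra.
Qed.

Lemma normr_dot2_le v w : `|dot2 v w| <= enorm v * enorm w.
Proof.
rewrite ler_norml dot2_le andbT lerNl -[enorm v]enormN.
have -> : - dot2 v w = dot2 (- v) w by rewrite /dot2 /=; ring.
exact: dot2_le.
Qed.

Lemma enorm_fst v : `|v.1| <= enorm v.
Proof.
rewrite -(@ler_pXn2r _ 2)// ?nnegrE ?enorm_ge0// real_normK ?num_real//.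
by rewrite sqr_enorm lerDl sqr_ge0.
Qed.

Lemma enorm_snd v : `|v.2| <= enorm v.
Proof.
rewrite -(@ler_pXn2r _ 2)// ?nnegrE ?enorm_ge0// real_normK ?num_real//.
by rewrite sqr_enorm lerDr sqr_ge0.
Qed.

Lemma norm_le_enorm v : `|v| <= enorm v.
Proof. by rewrite norm_pair_le enorm_fst enorm_snd. Qed.

Lemma enorm_le_norm v : enorm v <= 2 * `|v|.
Proof.
rewrite -(@ler_pXn2r _ 2)// ?nnegrE ?enorm_ge0// ?mulr_ge0//.
rewrite sqr_enorm; have h1 := norm_fst v; have h2 := norm_snd v.
have := normr_ge0 v.1; have := normr_ge0 v.2.
rewrite -(real_normK (num_real v.1)) -(real_normK (num_real v.2)).
by nra.
Qed.

Lemma enorm_eq0 v : enorm v = 0 -> v = 0.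
Proof.
move=> v0; apply/eqP; rewrite -normr_le0; apply: le_trans (norm_le_enorm _) _.
by rewrite v0.
Qed.

Lemma near_ball x (P : set (R * R)) :
  (\forall y \near x, P y) <->
  exists2 r, 0 < r & forall y, `|y - x| < r -> P y.
Proof.
split=> [/nbhs_normP[r /= r0 rP]|[r r0 rP]].
  by exists r => // y yx; apply: rP; rewrite /ball_ /= distrC.
by apply/nbhs_normP; exists r => //= y; rewrite /ball_ /= distrC; exact: rP.
Qed.

Lemma open_ball (A : set (R * R)) x : open A -> A x ->
  exists2 r, 0 < r & forall y, `|y - x| < r -> A y.
Proof. by move=> oA Ax; apply/near_ball; exact: open_nbhs_nbhs. Qed.

Lemma continuous_plane (W : normedModType R) (g : R * R -> W) x :
  {for x, continuous g} <-> forall e, 0 < e ->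
    exists2 r, 0 < r & forall y, `|y - x| < r -> `|g y - g x| < e.
Proof.
split=> [/cvgrPdist_lt gx e /gx/near_ball[r r0 rP]|H].
  by exists r => // y /rP; rewrite distrC.
apply/cvgrPdist_lt => e /H[r r0 rP]; apply/near_ball; exists r => // y /rP.
by rewrite distrC.
Qed.

Lemma is_derive_d1 (g : R * R -> R) x (d : R) :
  is_derive x (1, 0) g d <-> is_derive x.1 1 (fun t => g (t, x.2)) d.
Proof.
have E (t : R) : t *: ((1, 0) : R * R) + x = (t *: 1 + x.1, x.2).
  by case: x => a b; congr (_, _); rewrite /= ?scaler0 ?add0r.
split=> /is_derive_epsP H; apply/is_derive_epsP => e /H[r r0 rP]; exists r => // t /rP.
  by rewrite E -surjective_pairing.
by rewrite E -surjective_pairing.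
Qed.

Lemma is_derive_d2 (g : R * R -> R) x (d : R) :
  is_derive x (0, 1) g d <-> is_derive x.2 1 (fun t => g (x.1, t)) d.
Proof.
have E (t : R) : t *: ((0, 1) : R * R) + x = (x.1, t *: 1 + x.2).
  by case: x => a b; congr (_, _); rewrite /= ?scaler0 ?add0r.
split=> /is_derive_epsP H; apply/is_derive_epsP => e /H[r r0 rP]; exists r => // t /rP.
  by rewrite E -surjective_pairing.
by rewrite E -surjective_pairing.
Qed.

Definition C1 (Omega : set (R * R)) (g : R * R -> R) := forall x, Omega x ->
  [/\ derivable g x (1, 0), derivable g x (0, 1),
     {for x, continuous (d1 g)} & {for x, continuous (d2 g)}].

Lemma segment_MVT (f df : R -> R) (a b : R) :
  (forall t, Num.min a b <= t <= Num.max a b -> is_derive t 1 f (df t)) ->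
  exists2 c, Num.min a b <= c <= Num.max a b & f b - f a = df c * (b - a).
Proof.
wlog ab : a b / a <= b => [wl|].
  case/orP: (le_total a b) => [|ba]; first exact: wl.
  rewrite minC maxC => H; have [c cab cE] := wl _ _ ba H.
  by exists c => //; rewrite -opprB cE -mulrN opprB.
rewrite (min_idPl ab) (max_idPr ab) => H.
have [t||c cab cE] := @MVT_segment R f df a b ab; last by exists c.
  by move=> /subset_itv_oo_cc tab; apply: H; rewrite in_itv in tab.
apply: derivable_within_continuous => t tab; apply: ex_derive.
by apply: H; rewrite in_itv in tab.
Qed.

Lemma between_dist (a b t x r : R) : `|a - x| < r -> `|b - x| < r ->
  Num.min a b <= t <= Num.max a b -> `|t - x| < r.
Proof.
rewrite !ltr_distl => /andP[a1 a2] /andP[b1 b2] /andP[t1 t2].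
apply/andP; split.
  by apply: lt_le_trans t1; rewrite lt_min a1.
by apply: le_lt_trans t2 _; rewrite gt_max a2.
Qed.

Definition partially_derivable (Omega : set (R * R)) (g : R * R -> R) :=
  forall x, Omega x -> derivable g x (1, 0) /\ derivable g x (0, 1).

Lemma C1_partially_derivable (Omega : set (R * R)) g :
  C1 Omega g -> partially_derivable Omega g.
Proof. by move=> gC1 x /gC1[]. Qed.

(** A ball of the sup norm is a square, so it contains the corner [(z.1, y.2)]; the one-variable
    theorem applies on each leg of the path through that corner. *)
Lemma plane_MVT (Omega : set (R * R)) g x r : partially_derivable Omega g ->
  (forall y, `|y - x| < r -> Omega y) ->
  forall y z, `|y - x| < r -> `|z - x| < r -> exists q1 q2,
    [/\ `|q1 - x| < r, `|q2 - x| < r &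
       g z - g y = d1 g q1 * (z.1 - y.1) + d2 g q2 * (z.2 - y.2)].
Proof.
move=> gC1 xO y z.
rewrite !norm_pair_lt => /andP[/= y1 y2] /andP[/= z1 z2].
have [c1 c1P c1E] : exists2 c1, Num.min y.1 z.1 <= c1 <= Num.max y.1 z.1 &
    g (z.1, y.2) - g (y.1, y.2) = d1 g (c1, y.2) * (z.1 - y.1).
  apply: (@segment_MVT (fun t => g (t, y.2)) (fun t => d1 g (t, y.2))) => t tP.
  apply: (is_derive_d1 g (t, y.2) _).1; apply: derivableP.
  have /gC1[] // : Omega (t, y.2).
  apply: xO; rewrite norm_pair_lt /= y2 andbT.
  exact: between_dist tP.
have [c2 c2P c2E] : exists2 c2, Num.min y.2 z.2 <= c2 <= Num.max y.2 z.2 &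
    g (z.1, z.2) - g (z.1, y.2) = d2 g (z.1, c2) * (z.2 - y.2).
  apply: (@segment_MVT (fun t => g (z.1, t)) (fun t => d2 g (z.1, t))) => t tP.
  apply: (is_derive_d2 g (z.1, t) _).1; apply: derivableP.
  have /gC1[] // : Omega (z.1, t).
  apply: xO; rewrite norm_pair_lt /= z1/=.
  exact: between_dist tP.
exists (c1, y.2), (z.1, c2); split.
- by rewrite norm_pair_lt /= y2 andbT; exact: between_dist c1P.
- by rewrite norm_pair_lt /= z1/=; exact: between_dist c2P.
- rewrite -c1E -c2E -!surjective_pairing; ring.
Qed.

(** The factor 2 counts the two legs of [plane_MVT]. Bounded partial derivatives are all that
    condition (b) gives for the starting points of the level curves. *)
Lemma partial_lip_near (Omega : set (R * R)) g x (C : R) : open Omega ->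
  partially_derivable Omega g -> Omega x ->
  (forall y, Omega y -> `|d1 g y| <= C /\ `|d2 g y| <= C) ->
  lip_near x g (2 * C).
Proof.
move=> oO gC1 Ox gC; have [r r0 rP] := open_ball oO Ox.
exists r => // y z yr zr.
have [q1 [q2 [q1r q2r E]]] := plane_MVT gC1 rP zr yr.
have [+ _] := gC _ (rP _ q1r); have [_ +] := gC _ (rP _ q2r) => B2 B1.
rewrite E (le_trans (ler_normD _ _))// !normrM mulrDl mul1r mulrDl.
have h1 := norm_fst (y - z); have h2 := norm_snd (y - z).
by apply: lerD; apply: ler_pM.
Qed.

Lemma C1_is_derive (Omega : set (R * R)) g x v : open Omega ->
  C1 Omega g -> Omega x -> is_derive x v g (dot2 (grad g x) v).
Proof.
move=> oO gC1 Ox; have [r r0 rP] := open_ball oO Ox.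
apply/is_derive_epsP => e e0; pose N := 1 + `|v|.
have N0 : 0 < N by rewrite /N ltr_wpDr.
have [_ _ c1 c2] := gC1 _ Ox.
have e20 : 0 < e / (2 * N) by rewrite divr_gt0// mulr_gt0.
have [r1 r10 r1P] := (continuous_plane _ _).1 c1 _ e20.
have [r2 r20 r2P] := (continuous_plane _ _).1 c2 _ e20.
pose q := Num.min r (Num.min r1 r2).
have q0 : 0 < q by rewrite !lt_min r0 r10.
exists (q / N); first by rewrite divr_gt0.
move=> t; rewrite ltr_pdivlMr// => tN.
have tv : `|t *: v + x - x| < q.
  rewrite addrK normrZ; apply: le_lt_trans tN.
  by rewrite ler_wpM2l// /N lerDr.
have xx : `|x - x| < q by rewrite subrr normr0.
have qO y : `|y - x| < q -> Omega y.
  by move=> yq; apply: rP; apply: lt_le_trans yq _; rewrite ge_min lexx.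
have [q1 [q2 [q1r q2r ->]]] := plane_MVT (C1_partially_derivable gC1) qO xx tv.
rewrite /dot2 /grad /= !addrK /GRing.scale/= -/(d1 g x) -/(d2 g x).
have -> : d1 g q1 * (t * v.1) + d2 g q2 * (t * v.2) -
    t * (d1 g x * v.1 + d2 g x * v.2) =
    (d1 g q1 - d1 g x) * (t * v.1) + (d2 g q2 - d2 g x) * (t * v.2) by ring.
have b1 : `|d1 g q1 - d1 g x| <= e / (2 * N).
  by apply/ltW/r1P/(lt_le_trans q1r); rewrite !ge_min lexx orbT.
have b2 : `|d2 g q2 - d2 g x| <= e / (2 * N).
  by apply/ltW/r2P/(lt_le_trans q2r); rewrite !ge_min lexx !orbT.
have h1 : `|t * v.1| <= N * `|t|.
  by rewrite normrM mulrC ler_wpM2r// (le_trans (norm_fst v))// lerDr.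
have h2 : `|t * v.2| <= N * `|t|.
  by rewrite normrM mulrC ler_wpM2r// (le_trans (norm_snd v))// lerDr.
have -> : e * `|t| = e / (2 * N) * (N * `|t|) + e / (2 * N) * (N * `|t|).
  by field; rewrite gt_eqF.
rewrite (le_trans (ler_normD _ _))// !normrM -!normrM normrM [X in _ + X]normrM.
by apply: lerD; apply: ler_pM.
Qed.

Lemma lip_near_continuous (W : normedModType R) (g : R * R -> W) x (C : R) :
  lip_near x g C -> {for x, continuous g}.
Proof.
move=> [r r0 rP]; apply/continuous_plane => e e0.
have C0 : 0 < `|C| + 1 by rewrite ltr_wpDl.
exists (Num.min r (e / (`|C| + 1))); first by rewrite lt_min r0 divr_gt0.
move=> y; rewrite lt_min => /andP[yr ye].
have xx : `|x - x| < r by rewrite subrr normr0.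
apply: le_lt_trans (rP _ _ yr xx) _.
apply: (@le_lt_trans _ _ ((`|C| + 1) * `|y - x|)).
  by rewrite ler_wpM2r// (le_trans (ler_norm _))// lerDl.
by rewrite mulrC -ltr_pdivlMr.
Qed.

End plane.

(** * Lebesgue measure in the plane *)

Section planar_lebesgue.
Context {R : realType}.
Local Notation mu1 := (@lebesgue_measure R).
Local Notation mu2 := (@lebesgue2 R).
Local Notation plane := (measurableTypeR R * measurableTypeR R)%type.

Definition rat_square (q : rat * rat * rat) : set (R * R) :=
  `]ratr q.1.1 - ratr q.2, ratr q.1.1 + ratr q.2[ `*`
  `]ratr q.1.2 - ratr q.2, ratr q.1.2 + ratr q.2[.

(** Rational squares form a countable base of the topology and belong to the product
    sigma-algebra. *)
Lemma measurable_open_plane (A : set (R * R)) :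
  open A -> measurable (A : set plane).
Proof.
move=> oA; pose D := [set q | rat_square q `<=` A].
have -> : A = \bigcup_(q : rat * rat * rat) (if `[<D q>] then rat_square q else set0).
  apply/seteqP; split=> [x Ax|x [q _]]; last by case: asboolP => // Dq /Dq.
  have [r r0 rP] := open_ball oA Ax.
  have r20 : 0 < r / 2 by rewrite divr_gt0.
  (* A square of half-side [s < r / 2] centred within [s] of [x] contains [x] and stays within [r]
     of it. *)
  have [s /itvP sP] := rat_in_itvoo r20.
  have s0 : 0 < ratr s :> R by rewrite sP.
  have lt1 : x.1 - ratr s < x.1 + ratr s by rewrite ltrD2l gtrN.
  have lt2 : x.2 - ratr s < x.2 + ratr s by rewrite ltrD2l gtrN.
  have [a /itvP aP] := rat_in_itvoo lt1.
  have [b /itvP bP] := rat_in_itvoo lt2.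
  exists (a, b, s) => //; case: asboolP => [_|nD].
    rewrite /rat_square /=; split; rewrite /= in_itv/=; apply/andP; split.
    - by rewrite ltrBlDr aP.
    - by rewrite -ltrBlDr aP.
    - by rewrite ltrBlDr bP.
    - by rewrite -ltrBlDr bP.
  exfalso; apply: nD => y [] /=; rewrite !in_itv/= => /andP[y1 y2] /andP[y3 y4].
  apply: rP; rewrite norm_pair_lt /= !ltr_distl.
  have a1 : ratr a < x.1 + ratr s by rewrite aP.
  have a2 : x.1 - ratr s < ratr a by rewrite aP.
  have b1 : ratr b < x.2 + ratr s by rewrite bP.
  have b2 : x.2 - ratr s < ratr b by rewrite bP.
  have sr : ratr s < r / 2 by rewrite sP.
  by apply/andP; split; apply/andP; split; lra.
apply: countable_bigcupT_measurable; first exact: countableP.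
move=> q; case: ifP => // _; apply: measurableX; exact: measurable_itv.
Qed.

Lemma measurable_closed_plane (A : set (R * R)) :
  closed A -> measurable (A : set plane).
Proof.
move=> cA; rewrite -(setCK A); apply: measurableC.
by apply: measurable_open_plane; exact: closed_openC.
Qed.

Lemma measurable_fun_continuous (Omega : set (R * R)) (f : R * R -> R) :
  open Omega -> (forall x, Omega x -> {for x, continuous f}) ->
  measurable_fun (Omega : set plane) f.
Proof.
move=> oO cf; apply: (measurability _ (RGenOpens.measurableE R)).
move=> _ [_ [a [b ->] <-]]; apply: measurable_open_plane.
rewrite openE => x [Ox fx]; apply: filterI; first exact: open_nbhs_nbhs.
by apply: (cf _ Ox); apply: open_nbhs_nbhs; split => //; exact: interval_open.
Qed.

(** Convolution needs the substitution [z |-> x - z], and two reflections make a translation. The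
    reflection exchanges the open and the closed end of []c, d]], which leaves the length
    unchanged. *)
Lemma lebesgue1_reflection (a : R) (A : set R) : measurable A ->
  mu1 ((fun x => a - x) @^-1` A) = mu1 A.
Proof.
move=> mA.
have mf : measurable_fun setT ((fun x => a - x) : measurableTypeR R -> measurableTypeR R).
  exact: measurable_funB.
rewrite -[LHS]/(pushforward mu1 ((fun x => a - x) : _ -> measurableTypeR R) A).
apply/esym/lebesgue_measure_unique => //= _ [[c d]] _ <-.
rewrite /pushforward /=.
have -> : ((fun x => a - x) @^-1` `]c, d]) = `[a - d, a - c[%classic.
  by apply/seteqP; split => x /=; rewrite !in_itv/= => /andP[h1 h2];
    apply/andP; split; lra.
rewrite !lebesgue_measure_itv /= !lte_fin ltrD2l ltrN2.
by case: ifP => // _; rewrite -!EFinD; congr (_%:E); ring.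
Qed.

Lemma measurable_reflection (a : R * R) :
  measurable_fun setT (fun x : plane => (a - x : plane)).
Proof.
apply/measurable_fun_pairP; split.
  rewrite (_ : _ \o _ = (fun x : plane => a.1 - x.1))//.
  by apply: measurable_funB => //; exact: measurable_fst.
rewrite (_ : _ \o _ = (fun x : plane => a.2 - x.2))//.
by apply: measurable_funB => //; exact: measurable_snd.
Qed.

Lemma lebesgue2_reflection (a : R * R) (A : set plane) : measurable A ->
  mu2 ((fun x => a - x) @^-1` A) = mu2 A.
Proof.
move=> mA.
have mf := measurable_reflection a.
rewrite -[LHS]/(pushforward mu2 ((fun x => a - x) : plane -> plane) A).
apply/esym/product_measure_unique => // B C mB mC.
transitivity (mu2 (((fun x => a.1 - x) @^-1` B) `*` ((fun x => a.2 - x) @^-1` C))).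
  by [].
rewrite /lebesgue2 product_measure1E//.
- by congr (_ * _)%E; exact: lebesgue1_reflection.
- by rewrite -[X in measurable X]setTI; apply: measurable_funB.
- by rewrite -[X in measurable X]setTI; apply: measurable_funB.
Qed.

Lemma Rintegral_reflection (a : R * R) (f : plane -> R) :
  measurable_fun setT f ->
  \int[mu2]_x f (a - x) = \int[mu2]_x f x.
Proof.
move=> mf; rewrite /Rintegral; congr fine.
have ge0case (g : plane -> \bar R) : measurable_fun setT g ->
    (forall x, 0 <= g x)%E ->
    (\int[mu2]_x g (a - x)%R = \int[mu2]_x g x)%E.
  move=> mg g0.
  have mr := measurable_reflection a.
  pose r := (fun x : plane => (a - x : plane)%R).
  transitivity (\int[pushforward mu2 r]_x g x)%E; last first.
    by apply: eq_measure_integral => A mA _; exact: lebesgue2_reflection.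
  by apply/esym; apply: (ge0_integral_pushforward mr mu2 measurableT mg (fun x _ => g0 x)).
rewrite integralE [RHS]integralE; congr (_ - _)%E.
  rewrite -[RHS]ge0case//; first by apply: eq_integral => x _; rewrite !funeposE.
  exact/measurable_funepos/measurable_EFinP.
rewrite -[RHS]ge0case//; first by apply: eq_integral => x _; rewrite !funenegE.
exact/measurable_funeneg/measurable_EFinP.
Qed.

Lemma bounded_set_lebesgue2 (A : set (R * R)) : measurable (A : set plane) ->
  bounded_set A -> (mu2 A < +oo)%E.
Proof.
move=> mA [N [_ NP]]; have /NP {}NP : N < `|N| + 1.
  by rewrite (le_lt_trans (ler_norm _))// ltrDl.
pose B : set R := `[- (`|N| + 1), `|N| + 1]%classic.
have mB : measurable B by exact: measurable_itv.
apply: (@le_lt_trans _ _ (mu2 (B `*` B))).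
  apply: le_measure; rewrite ?inE//; first exact: measurableX.
  move=> x /NP /=; rewrite norm_pair_le => /andP[h1 h2].
  by split; rewrite /B /= in_itv/= -ler_norml.
rewrite /lebesgue2 product_measure1E//.
have B1 : (mu1 B < +oo)%E.
  by rewrite /B lebesgue_measure_itv/=; case: ifP => _; rewrite -?EFinD ltry.
by apply: lte_mul_pinfty => //; rewrite ge0_fin_numE.
Qed.

End planar_lebesgue.

(** * Compactness and continuity in the plane *)

Section compact_plane.
Context {R : realType}.

Lemma compact_closed_bounded (K : set (R * R)) : closed K -> bounded_set K -> compact K.
Proof.
move=> cK [N [_ NP]]; have /NP {}NP : N < `|N| + 1.
  by rewrite (le_lt_trans (ler_norm _))// ltrDl.
have cI := @segment_compact R (- (`|N| + 1)) (`|N| + 1).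
apply: (subclosed_compact cK (compact_setX cI cI)).
move=> x /NP /=; rewrite norm_pair_le => /andP[h1 h2].
by split; rewrite /= in_itv/= -ler_norml.
Qed.

Lemma continuous_compact_bounded (W : normedModType R) (K : set (R * R))
    (V : R * R -> W) : compact K -> (forall x, K x -> {for x, continuous V}) ->
  exists C, forall x, K x -> `|V x| <= C.
Proof.
move=> cK cV.
have cVK : {within K, continuous V}.
  by apply: continuous_in_subspaceT => x; rewrite inE; exact: cV.
have [N [_ NP]] := compact_bounded (continuous_compact cVK cK).
exists (`|N| + 1) => x Kx; apply: NP; last by exists x.
by rewrite (le_lt_trans (ler_norm _))// ltrDl.
Qed.

(** Uniform continuity around [K], with [y] free to leave [K]. The near-covering form of compactness
    yields one radius for all points at once. *)
Lemma compact_uniform (W : normedModType R) (Omega K : set (R * R))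
    (V : R * R -> W) (e : R) : open Omega -> compact K -> K `<=` Omega ->
  (forall x, Omega x -> {for x, continuous V}) -> 0 < e ->
  exists2 r, 0 < r & forall x y, K x -> `|y - x| < r -> Omega y /\ `|V y - V x| <= e.
Proof.
move=> oO /compact_near_coveringP cK KO cV e0.
pose P (r : R) (x : R * R) := forall y, `|y - x| < r -> Omega y /\ `|V y - V x| <= e.
have /(_ R (0^'+) P _) H := cK.
have : \forall r \near 0^'+, K `<=` P r.
  apply: H => x Kx; have Ox := KO _ Kx.
  have e20 : 0 < e / 2 by rewrite divr_gt0.
  have [r1 r10 r1P] := open_ball oO Ox.
  have [r2 r20 r2P] := (continuous_plane _ _).1 (cV _ Ox) _ e20.
  pose r := Num.min r1 r2; have r0 : 0 < r by rewrite lt_min r10.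
  have r20' : 0 < r / 2 by rewrite divr_gt0.
  exists ([set x' | `|x' - x| < r / 2], [set t : R | t < r / 2]) => /=.
    split; first by apply/near_ball; exists (r / 2).
    by near=> t; near: t; exact: nbhs_right_lt.
  move=> [x' t] [/= x'x tr] y yx'.
  have yx : `|y - x| < r.
    by rewrite -(subrKA x') (splitr r) (le_lt_trans (ler_normD _ _))// ltrD// (lt_trans yx').
  have x'xr : `|x' - x| < r by rewrite (lt_le_trans x'x)// ler_pdivrMr// ler_peMr ?ler1n ?(ltW r0).
  split; first by apply: r1P; rewrite (lt_le_trans yx)// /r ge_min lexx.
  have -> : V y - V x' = (V y - V x) - (V x' - V x) by rewrite opprB addrA subrK.
  rewrite (splitr e) (le_trans (ler_normB _ _))// lerD// ltW// r2P//.
    by rewrite (lt_le_trans yx)// /r ge_min lexx orbT.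
  by rewrite (lt_le_trans x'xr)// /r ge_min lexx orbT.
move=> KP; near (0 : R)^'+ => r.
exists r; first by near: r; exact: nbhs_right_gt.
have PK : K `<=` P r by near: r.
by move=> x y /PK; apply.
Unshelve. all: by end_near. Qed.

Lemma continuous_fst_snd (V : R * R -> R * R) x : {for x, continuous V} <->
  {for x, continuous (fst \o V)} /\ {for x, continuous (snd \o V)}.
Proof.
split=> [cV|[c1 c2]].
  by split; apply: continuous_comp => //; [exact: cvg_fst|exact: cvg_snd].
rewrite (_ : V = fun x => ((fst \o V) x, (snd \o V) x)); first exact: cvg_pair c1 c2.
by apply/funext => y /=; rewrite -surjective_pairing.
Qed.

Lemma continuous_mulr_for (f g : R * R -> R) x : {for x, continuous f} ->
  {for x, continuous g} -> {for x, continuous (fun x => f x * g x)}.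
Proof. by move=> cf cg; exact: cvgM cf cg. Qed.

Lemma continuous_addr_for (f g : R * R -> R) x : {for x, continuous f} ->
  {for x, continuous g} -> {for x, continuous (fun x => f x + g x)}.
Proof. by move=> cf cg; exact: cvgD cf cg. Qed.

Lemma continuous_dot2 (V W : R * R -> R * R) x : {for x, continuous V} ->
  {for x, continuous W} -> {for x, continuous (fun x => dot2 (V x) (W x))}.
Proof.
move=> /continuous_fst_snd[c1 c2] /continuous_fst_snd[c3 c4].
exact: (continuous_addr_for (continuous_mulr_for c1 c3) (continuous_mulr_for c2 c4)).
Qed.

Lemma continuous_grad (g : R * R -> R) x : {for x, continuous (d1 g)} ->
  {for x, continuous (d2 g)} -> {for x, continuous (grad g)}.
Proof. by move=> c1 c2; apply/continuous_fst_snd. Qed.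

Lemma measurable_dot2_grad (Omega : set (R * R)) (V : R * R -> R * R) (g : R * R -> R) :
  open Omega -> (forall x, Omega x -> {for x, continuous V}) -> C1 Omega g ->
  measurable_fun (Omega : set (measurableTypeR R * measurableTypeR R))
    (fun x => dot2 (V x) (grad g x)).
Proof.
move=> oO cV gC1; apply: measurable_fun_continuous => // x Ox.
have [_ _ c1 c2] := gC1 _ Ox.
exact: (continuous_dot2 (cV _ Ox) (continuous_grad c1 c2)).
Qed.

End compact_plane.

(** * Integrals of bounded functions *)

Section integral_facts.
Context d (T : measurableType d) (R : realType) (mu : {measure set T -> \bar R}).
Implicit Types (f g : T -> R) (D E : set T).

Lemma integrable_bounded D f (C : R) : measurable D -> (mu D < +oo)%E ->
  measurable_fun D f -> (forall x, D x -> `|f x| <= C) ->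
  mu.-integrable D (EFin \o f).
Proof.
move=> mD D1 mf fC; apply: measurable_bounded_integrable => //.
exists C; split; first exact: num_real.
by move=> r Cr x /= Dx; rewrite (le_trans (fC _ Dx))// ltW.
Qed.

Lemma integrable_bounded_support E f (C : R) : measurable E -> (mu E < +oo)%E ->
  measurable_fun setT f -> (forall x, `|f x| <= C) -> (forall x, ~ E x -> f x = 0) ->
  mu.-integrable setT (EFin \o f).
Proof.
move=> mE E1 mf fC f0.
have -> : EFin \o f = (EFin \o f) \_ E.
  by apply/funext => x /=; rewrite patchE; case: ifPn => //; rewrite notin_setE => /f0->.
apply: (integrable_mkcond _ mE).1.
by apply: (@integrable_bounded _ _ C) => //; exact: measurable_funTS.
Qed.

Lemma EFin_Rintegral D f : measurable D -> mu.-integrable D (EFin \o f) ->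
  (\int[mu]_(x in D) f x)%:E = (\int[mu]_(x in D) (f x)%:E)%E.
Proof. by move=> mD fi; rewrite fineK//; exact: integrable_fin_num. Qed.

Lemma integrable_funB D f g : measurable D -> mu.-integrable D (EFin \o f) ->
  mu.-integrable D (EFin \o g) -> mu.-integrable D (EFin \o (fun x => f x - g x)).
Proof. by move=> mD fi gi; exact: (integrableB mD fi gi). Qed.

Lemma integrable_funD D f g : measurable D -> mu.-integrable D (EFin \o f) ->
  mu.-integrable D (EFin \o g) -> mu.-integrable D (EFin \o (fun x => f x + g x)).
Proof. by move=> mD fi gi; exact: (integrableD mD fi gi). Qed.

Lemma integrable_funZl D f (r : R) : measurable D -> mu.-integrable D (EFin \o f) ->
  mu.-integrable D (EFin \o (fun x => r * f x)).
Proof. by move=> mD fi; exact: (integrableZl mD r fi). Qed.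

Lemma dominated_cvg_Rintegral D (f_ : nat -> T -> R) f g : measurable D ->
  (forall n, measurable_fun D (f_ n)) ->
  (forall x, D x -> f_ ^~ x @ \oo --> f x) ->
  mu.-integrable D (EFin \o g) ->
  (forall n x, D x -> `|f_ n x| <= g x) ->
  \int[mu]_(x in D) f_ n x @[n --> \oo] --> \int[mu]_(x in D) f x.
Proof.
move=> mD mf ff gi fg.
have mf' : measurable_fun D f by apply: measurable_fun_cvg ff.
have fi n : mu.-integrable D (EFin \o f_ n).
  apply: (le_integrable mD _ _ gi); first exact/measurable_EFinP.
  by move=> x Dx /=; rewrite lee_fin (le_trans (fg n _ Dx))// ler_norm.
have fi' : mu.-integrable D (EFin \o f).
  apply: (le_integrable mD _ _ gi); first exact/measurable_EFinP.
  move=> x Dx /=; rewrite lee_fin (le_trans _ (ler_norm _))//.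
  have cn : (fun n => `|f_ n x|) @ \oo --> `|f x| by apply: cvg_norm; exact: ff.
  apply: (ler_cvg_to cn (@cvg_cst _ (g x) _ \oo _)).
  by apply: nearW => n; exact: fg.
apply: fine_cvg; rewrite EFin_Rintegral//.
apply: (@dominated_cvg _ _ _ _ _ _ _ _ (EFin \o g)) => //.
- by move=> n; apply/measurable_EFinP.
- by move=> x Dx; apply: cvg_EFin; [exact: nearW|exact: ff].
Qed.

Lemma Rintegral_normr_le D f (C : R) : measurable D -> (mu D < +oo)%E ->
  mu.-integrable D (EFin \o f) -> (forall x, D x -> `|f x| <= C) ->
  `|\int[mu]_(x in D) f x| <= C * fine (mu D).
Proof.
move=> mD D1 fi fC; apply: le_trans (le_normr_Rintegral mD fi) _.
rewrite -(Rintegral_cst mu mD); apply: le_Rintegral => //.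
  exact: integrable_norm.
apply: (@integrable_bounded _ _ `|C|) => //; exact: measurable_cst.
Qed.

End integral_facts.

(** The sequential form serves twice: it makes derivatives measurable as limits of quotients, and it
    feeds dominated convergence. *)
Lemma is_derive_seq (R : realType) (V : normedModType R) (f : V -> R) (x v : V) (d : R) :
  is_derive x v f d ->
  (fun n : nat => n.+1%:R * (f (n.+1%:R^-1 *: v + x) - f x)) @ \oo --> d.
Proof.
move=> /is_derive_epsP fd; apply/cvgrPdist_le => e e0; have [r r0 rP] := fd _ e0.
near=> n.
have n0 : 0 < n.+1%:R :> R by [].
have nr : `|n.+1%:R^-1 : R| < r.
  rewrite ger0_norm// ?invr_ge0//.
  by near: n; exact: (near_infty_natSinv_lt (PosNum r0)).
have := rP _ nr; set u := f _ - f x => H.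
rewrite distrC -(@ler_pM2r _ n.+1%:R^-1) ?invr_gt0//.
rewrite -[X in _ * X <= _]ger0_norm ?invr_ge0// -normrM mulrBl mulrAC divff// ?gt_eqF//.
rewrite mul1r mulrC [X in _ <= _ * X](_ : _ = `|n.+1%:R^-1|)//.
by rewrite ger0_norm// invr_ge0.
Unshelve. all: by end_near. Qed.

(** * Mollification *)

Section smooth_bump.
Context {R : realType}.
Implicit Types (f g : R -> R) (P : {poly R}).

Fixpoint Cn (n : nat) (f : R -> R) : Prop :=
  match n with
  | 0 => True
  | n'.+1 => (forall x, derivable f x 1) /\ Cn n' (derive1 f)
  end.

Lemma Cn_pred n f : Cn n.+1 f -> Cn n f.
Proof. by elim: n f => // n IH f [df Cf]; split => //; exact: IH. Qed.

Lemma CnD n f g : Cn n f -> Cn n g -> Cn n (f \+ g).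
Proof.
elim: n f g => // n IH f g [df Cf] [dg Cg]; split.
  by move=> x; apply: derivableD.
have -> : derive1 (f \+ g) = derive1 f \+ derive1 g.
  apply/funext => x; rewrite derive1E; apply: derive_val.
  by apply: is_derive_eq (is_deriveD (derivableP (df x)) (derivableP (dg x))) _; rewrite -!derive1E.
exact: IH.
Qed.

Lemma CnM n f g : Cn n f -> Cn n g -> Cn n (f \* g).
Proof.
elim: n f g => // n IH f g Cf Cg.
have [[df Cf'] [dg Cg']] := (Cf, Cg); split.
  by move=> x; apply: derivableM.
have -> : derive1 (f \* g) = (f \* derive1 g) \+ (g \* derive1 f).
  apply/funext => x; rewrite derive1E; apply: derive_val.
  by apply: is_derive_eq (is_deriveM (derivableP (df x)) (derivableP (dg x))) _; rewrite -!derive1E.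
by apply: CnD; apply: IH => //; exact: Cn_pred.
Qed.

Lemma is_derive_affine (c d x : R) : is_derive x 1 (fun t => c * t + d) c.
Proof.
apply/is_derive_epsP => e e0; exists 1 => // t _.
by rewrite /GRing.scale/= mulr1 mulrDr opprD addrACA subrr addr0 addrK mulrC subrr normr0
  mulr_ge0// ltW.
Qed.

Lemma CnZ n (c : R) f : Cn n f -> Cn n (fun x => c * f x).
Proof.
elim: n f => // n IH f [df Cf]; split.
  by move=> x; apply: derivableZ.
have -> : derive1 (fun x => c * f x) = (fun x => c * derive1 f x).
  apply/funext => x; rewrite derive1E; apply: derive_val.
  by apply: is_derive_eq (is_deriveZ c (derivableP (df x))) _; rewrite -!derive1E.
exact: IH.
Qed.

Lemma Cn_affine n (c d : R) f : Cn n f -> Cn n (fun x => f (c * x + d)).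
Proof.
elim: n f => // n IH f [df Cf].
have D (x : R) : is_derive x 1 (fun x => f (c * x + d)) (c * derive1 f (c * x + d)).
  rewrite mulrC; apply: (@is_derive1_comp _ f (fun t => c * t + d)).
    by rewrite derive1E; exact: derivableP.
  exact: is_derive_affine.
split; first by move=> x; exact: ex_derive.
have -> : derive1 (fun x => f (c * x + d)) = (fun x => c * derive1 f (c * x + d)).
  by apply/funext => x; rewrite derive1E derive_val.
by apply: CnZ; exact: IH.
Qed.

Lemma exprn_le_expR n : exists2 C : R, 0 < C & forall y, 0 <= y -> y ^+ n <= C * expR y.
Proof.
elim: n => [|n [C C0 CP]].
  exists 1 => // y y0; rewrite expr0 mul1r; apply: le_trans (expR_ge1Dx y).
  by rewrite lerDl.
exists (C * 2 ^+ n.+1); first by rewrite mulr_gt0// exprn_gt0.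
move=> y y0; have y20 : 0 <= y / 2 by rewrite divr_ge0.
(* Halving [y] provides two exponentials: one absorbs [z ^+ n], the other absorbs [z]. *)
set z := y / 2 in y20 *; have yz : y = z * 2 by rewrite /z; field.
have z_le : z <= expR z by apply: le_trans (expR_ge1Dx z); rewrite lerDr.
have -> : y ^+ n.+1 = 2 ^+ n.+1 * (z ^+ n * z) by rewrite yz exprMn mulrC [z ^+ n.+1]exprSr.
have -> : C * 2 ^+ n.+1 * expR y = 2 ^+ n.+1 * (C * expR z * expR z).
  rewrite yz mulr_natr mulr2n expRD; ring.
by rewrite ler_pM2l ?exprn_gt0// ler_pM ?exprn_ge0// CP.
Qed.

(** With [y = x^-1] this says that [P(1/x) exp(-1/x)] is [O(x^2)] as [x] decreases to 0, so
    [expflat P] has derivative 0 there. *)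
Lemma horner_expRN_bound P : exists2 C : R, 0 < C &
  forall y, 1 <= y -> `|P.[y]| * expR (- y) * y ^+ 2 <= C.
Proof.
have [C C0 CP] := exprn_le_expR (size P + 2).
pose S := \sum_(i < size P) `|P`_i|; have S0 : 0 <= S by apply: sumr_ge0.
exists (S * C + 1) => [|y y1]; first by rewrite ltr_wpDl// mulr_ge0// ltW.
have y0 : 0 <= y by rewrite (le_trans _ y1).
have PS : `|P.[y]| <= S * y ^+ size P.
  rewrite horner_coef (le_trans (ler_norm_sum _ _ _))// /S mulr_suml ler_sum// => i _.
  rewrite normrM ler_wpM2l// normrX (ger0_norm y0).
  by rewrite ler_weXn2l// ltnW.
apply: (@le_trans _ _ (S * (y ^+ (size P + 2) * expR (- y)))).
  have -> : S * (y ^+ (size P + 2) * expR (- y)) =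
      S * y ^+ size P * expR (- y) * y ^+ 2 by rewrite exprD; ring.
  by rewrite ler_wpM2r ?exprn_ge0// ler_wpM2r ?expR_ge0.
apply: (@le_trans _ _ (S * C)); last by rewrite lerDl.
by rewrite ler_wpM2l// expRN ler_pdivrMr ?expR_gt0// CP.
Qed.

(* This family is stable under differentiation, hence consists of smooth functions. *)
Definition expflat P (x : R) : R := if 0 < x then P.[x^-1] * expR (- x^-1) else 0.

Lemma is_derive_expflat P (x : R) :
  is_derive x 1 (expflat P) (expflat ('X^2 * (P - P^`())) x).
Proof.
have [x0|x0|->] := ltgtP x 0.
- rewrite /expflat ltNge (ltW x0)/=.
  apply: (@near_eq_is_derive _ _ _ (cst 0)).
  near=> y; rewrite /expflat ltNge ltW//.
  by near: y; exact: lt_nbhsl.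
- rewrite {2}/expflat x0.
  apply: (@near_eq_is_derive _ _ _
    ((horner P \* (expR \o -%R)) \o (fun t => t^-1))).
    near=> y; rewrite /expflat ifT//.
    by near: y; exact: lt_nbhsr.
  have xn0 : x != 0 by rewrite gt_eqF.
  have dV : is_derive x 1 (fun t : R => t^-1) (- x ^- 2).
    have := @is_deriveV R id x 1 1 xn0 (is_derive_id _ _).
    by rewrite /GRing.scale/= mulr1.
  have dE : is_derive x^-1 1 (expR \o -%R) (expR (- x^-1) * -1).
    exact: (@is_derive1_comp R expR -%R x^-1).
  have dP : is_derive x^-1 1 (horner P) P^`().[x^-1] by exact: is_derive_poly.
  apply: is_derive_eq (is_derive1_comp (is_deriveM dP dE) dV) _.
  rewrite /GRing.scale/= hornerM hornerXn hornerD hornerN -exprVn.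
  move: (expR _) P.[_] P^`().[_] => E p p'; ring.
- rewrite {2}/expflat ltxx; apply/is_derive_epsP => e e0.
  have [C C0 CP] := horner_expRN_bound P.
  exists (Num.min 1 (e / C)); first by rewrite lt_min ltr01 divr_gt0.
  move=> t; rewrite lt_min => /andP[t1 te].
  rewrite addr0 scaler0 subr0 /GRing.scale/= mulr1 {2}/expflat ltxx subr0.
  rewrite /expflat; case: ifPn => t0; last by rewrite normr0 mulr_ge0// ltW.
  rewrite (gtr0_norm t0) in t1 te *.
  have tV1 : 1 <= t^-1 by rewrite invf_ge1// ltW.
  have := CP _ tV1; rewrite exprVn ler_pdivrMr ?exprn_gt0// => H.
  rewrite normrM [`|expR _|]ger0_norm ?expR_ge0// (le_trans H)// expr2 mulrA.
  by rewrite ler_pM2r// mulrC -ler_pdivlMr// ltW.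
Unshelve. all: by end_near. Qed.

Lemma Cn_expflat n P : Cn n (expflat P).
Proof.
elim: n P => // n IH P; split; first by move=> x; have := is_derive_expflat P x.
have -> : derive1 (expflat P) = expflat ('X^2 * (P - P^`())).
  by apply/funext => x; rewrite derive1E; apply: derive_val; exact: is_derive_expflat.
exact: IH.
Qed.

Definition smooth_supported (d : R) f :=
  (forall n, Cn n f) /\ (forall x, d < `|x| -> f x = 0).

Lemma smooth_supported_derive1 d f : smooth_supported d f ->
  smooth_supported d (derive1 f).
Proof.
move=> [Cf f0]; split=> [n|x dx]; first by have [] := Cf n.+1.
rewrite derive1E; apply: derive_val.
apply: (@near_eq_is_derive _ _ _ (cst 0)).
have : \forall y \near x, d < `|y|.
  have := @norm_continuous R R x; move=> /cvgrPdist_lt/(_ (`|x| - d)).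
  rewrite subr_gt0 => /(_ dx); apply: filterS => y.
  by move=> /(le_lt_trans (ler_norm _)); rewrite ltrD2l ltrN2.
by apply: filterS => y dy; rewrite f0.
Qed.

Lemma smooth_supported_is_derive d f (x : R) : smooth_supported d f ->
  is_derive x 1 f (derive1 f x).
Proof.
by move=> [/(_ 1%N)[df _] _]; rewrite derive1E; exact: derivableP.
Qed.

Lemma smooth_supported_continuous d f : smooth_supported d f -> continuous f.
Proof.
move=> [/(_ 1%N)[df _] _] x.
by apply: differentiable_continuous; apply/derivable1_diffP.
Qed.

Lemma smooth_supported_bounded d f : smooth_supported d f ->
  exists C, forall x, `|f x| <= C.
Proof.
move=> sf; have cf := smooth_supported_continuous sf; have [_ f0] := sf.
have [d0|d0] := ltP d 0.
  by exists 0 => x; rewrite f0 ?normr0// (lt_le_trans d0).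
have dd : - d <= d by rewrite ge0_cp.
have cnf : continuous (fun x => `|f x|).
  by move=> x; apply: cvg_norm; exact: cf.
have [c _ cP] := EVT_max dd (continuous_subspaceT cnf).
exists `|f c| => x; have [dx|xd] := ltP d `|x|; first by rewrite f0// normr0.
by apply: cP; rewrite in_itv/= -ler_norml.
Qed.

Lemma smooth_bump_exists (d : R) : 0 < d -> exists a : R -> R,
  [/\ smooth_supported d a, (forall x, 0 <= a x) &
     forall x, `|x| < d -> 0 < a x].
Proof.
move=> d0; pose e := expflat 1.
have e0 x : 0 <= e x.
  by rewrite /e /expflat; case: ifP => // _; rewrite hornerC mul1r expR_ge0.
exists (fun x => e (1 * x + d) * e (-1 * x + d)); split.
- split=> [n|x dx].
    by apply: CnM; apply: Cn_affine; exact: Cn_expflat.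
  have /orP[h|h] : (1 * x + d <= 0) || (-1 * x + d <= 0).
    by move: dx; rewrite lter_normr => /orP[h|h]; apply/orP; [right|left]; lra.
  + by rewrite {1}/e /expflat ltNge h/= mul0r.
  + by rewrite {2}/e /expflat [in X in _ * X]ltNge h/= mulr0.
- by move=> x; rewrite mulr_ge0.
- move=> x; rewrite ltr_norml => /andP[h1 h2].
  rewrite /e /expflat !hornerC !mul1r !ifT ?mulr_gt0 ?expR_gt0//; lra.
Qed.

End smooth_bump.

Section convolution.
Context {R : realType}.
Local Notation mu2 := (@lebesgue2 R).
Local Notation plane := (measurableTypeR R * measurableTypeR R)%type.
Variables (D : set plane) (psi : R * R -> R) (B d : R).
Hypotheses (mD : measurable D) (D_fin : (mu2 D < +oo)%E).
Hypotheses (mpsi : measurable_fun D psi) (psiB : forall z, D z -> `|psi z| <= B).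

(** With a product kernel, a partial derivative merely replaces [a] or [b] by its derivative, so
    these convolutions are closed under differentiation. *)
Definition conv (a b : R -> R) (x : R * R) : R :=
  \int[mu2]_(z in D) (a (x.1 - z.1) * b (x.2 - z.2) * psi z).

Lemma measurable_conv_kernel (a b : R -> R) (x : R * R) :
  smooth_supported d a -> smooth_supported d b ->
  measurable_fun D (fun z : plane => a (x.1 - z.1) * b (x.2 - z.2)).
Proof.
move=> sa sb; have ca := smooth_supported_continuous sa.
have cb := smooth_supported_continuous sb.
apply: measurable_funTS; apply: measurable_fun_continuous; first exact: openT.
move=> z _; apply: cvgM.
  apply: continuous_comp; last exact: ca.
  by apply: cvgB; [exact: cvg_cst|exact: cvg_fst].
apply: continuous_comp; last exact: cb.
by apply: cvgB; [exact: cvg_cst|exact: cvg_snd].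
Qed.

Lemma conv_integrable (a b : R -> R) (x : R * R) :
  smooth_supported d a -> smooth_supported d b ->
  mu2.-integrable D (EFin \o (fun z => a (x.1 - z.1) * b (x.2 - z.2) * psi z)).
Proof.
move=> sa sb.
have [Ca CaP] := smooth_supported_bounded sa.
have [Cb CbP] := smooth_supported_bounded sb.
apply: (@integrable_bounded _ _ _ mu2 D _ (Ca * Cb * B)) => //.
  by apply: measurable_funM => //; exact: measurable_conv_kernel.
move=> z Dz; rewrite !normrM ler_pM ?mulr_ge0//; last exact: psiB.
by rewrite ler_pM.
Qed.

Lemma conv_bounded (a b : R -> R) :
  smooth_supported d a -> smooth_supported d b ->
  exists C, forall x, `|conv a b x| <= C.
Proof.
move=> sa sb.
have [Ca CaP] := smooth_supported_bounded sa.
have [Cb CbP] := smooth_supported_bounded sb.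
exists (`|Ca * Cb * B| * fine (mu2 D)) => x.
have ci := conv_integrable x sa sb.
apply: le_trans (le_normr_Rintegral mD ci) _.
rewrite -(Rintegral_cst mu2 mD); apply: le_Rintegral => //.
- by apply: (@integrable_norm _ _ _ _ _ _ ci).
- by apply: (@integrable_bounded _ _ _ mu2 D _ `|Ca * Cb * B|) => // z _; rewrite normr_id.
- move=> z Dz; rewrite (le_trans _ (ler_norm _))// !normrM ler_pM ?mulr_ge0//.
    by rewrite ler_pM.
  exact: psiB.
Qed.

Lemma is_derive_translateM (a : R -> R) (c k t : R) : smooth_supported d a ->
  is_derive t 1 (fun t => k * a (t - c)) (k * derive1 a (t - c)).
Proof.
move=> sa; apply: (is_deriveZ (f := fun t => a (t - c)) k).
have ha : is_derive (shift (- c) t) 1 a (derive1 a (t - c)).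
  exact: smooth_supported_is_derive sa.
have hs : is_derive t 1 (shift (- c)) (1 : R) by exact: is_derive_shift.
exact: is_derive_eq (is_derive1_comp ha hs) (mulr1 _).
Qed.

Lemma conv_is_derive1 (a b : R -> R) (x : R * R) :
  smooth_supported d a -> smooth_supported d b ->
  is_derive x (1, 0) (conv a b) (conv (derive1 a) b x).
Proof.
move=> sa sb; apply/is_derive_d1.
have sa' := smooth_supported_derive1 sa.
have [Ca CaP] := smooth_supported_bounded sa'.
have [Cb CbP] := smooth_supported_bounded sb.
pose f (t : R) (z : plane) := a (t - z.1) * b (x.2 - z.2) * psi z.
have fd (t : R) (z : plane) : is_derive t 1 (f ^~ z)
    (derive1 a (t - z.1) * b (x.2 - z.2) * psi z).
  rewrite /f; under eq_fun do rewrite -mulrA mulrC.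
  by rewrite -[X in is_derive _ _ _ X]mulrA [X in is_derive _ _ _ X]mulrC;
    exact: is_derive_translateM.
have fp (t : R) (z : plane) : partial1of2 f t z =
    derive1 a (t - z.1) * b (x.2 - z.2) * psi z.
  by rewrite partial1of2E; apply: derive_val; exact: fd.
have xI : `]x.1 - 1, x.1 + 1[%classic x.1.
  by rewrite /= in_itv/= ltrBlDr ltrDl ltr01.
have intf t : `]x.1 - 1, x.1 + 1[%classic t -> mu2.-integrable D (EFin \o f t).
  by move=> _; exact: (conv_integrable (t, x.2) sa sb).
have derf (t : R) (z : plane) : `]x.1 - 1, x.1 + 1[%classic t -> D z -> derivable (f ^~ z) t 1.
  by move=> _ _; have [] := fd t z.
pose G (z : plane) := `|Ca * Cb * B|.
have intG : mu2.-integrable D (EFin \o G).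
  apply: (@integrable_bounded _ _ _ mu2 D _ `|Ca * Cb * B|) => //.
    exact: measurable_cst.
  by move=> z _; rewrite normr_id.
have G_ub (t : R) (z : plane) : `]x.1 - 1, x.1 + 1[%classic t -> D z ->
    `|partial1of2 f t z| <= G z.
  move=> _ Dz; rewrite fp (le_trans _ (ler_norm _))// !normrM ler_pM ?mulr_ge0//.
    by rewrite ler_pM.
  exact: psiB.
have dF := derivable_under_integral mD xI intf derf (fun _ => normr_ge0 _) intG G_ub.
have := differentiation_under_integral mD xI intf derf (fun _ => normr_ge0 _) intG G_ub.
rewrite derive1E => E; split; first exact: dF.
by rewrite [LHS]E; apply: eq_Rintegral => z _; rewrite fp.
Qed.

Lemma conv_is_derive2 (a b : R -> R) (x : R * R) :
  smooth_supported d a -> smooth_supported d b ->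
  is_derive x (0, 1) (conv a b) (conv a (derive1 b) x).
Proof.
move=> sa sb; apply/is_derive_d2.
have sb' := smooth_supported_derive1 sb.
have [Ca CaP] := smooth_supported_bounded sa.
have [Cb CbP] := smooth_supported_bounded sb'.
pose f (t : R) (z : plane) := a (x.1 - z.1) * b (t - z.2) * psi z.
have fd (t : R) (z : plane) : is_derive t 1 (f ^~ z)
    (a (x.1 - z.1) * derive1 b (t - z.2) * psi z).
  rewrite /f; under eq_fun do rewrite mulrAC.
  by rewrite [X in is_derive _ _ _ X]mulrAC; exact: is_derive_translateM.
have fp (t : R) (z : plane) : partial1of2 f t z =
    a (x.1 - z.1) * derive1 b (t - z.2) * psi z.
  by rewrite partial1of2E; apply: derive_val; exact: fd.
have xI : `]x.2 - 1, x.2 + 1[%classic x.2.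
  by rewrite /= in_itv/= ltrBlDr ltrDl ltr01.
have intf t : `]x.2 - 1, x.2 + 1[%classic t -> mu2.-integrable D (EFin \o f t).
  by move=> _; exact: (conv_integrable (x.1, t) sa sb).
have derf (t : R) (z : plane) : `]x.2 - 1, x.2 + 1[%classic t -> D z -> derivable (f ^~ z) t 1.
  by move=> _ _; have [] := fd t z.
pose G (z : plane) := `|Ca * Cb * B|.
have intG : mu2.-integrable D (EFin \o G).
  apply: (@integrable_bounded _ _ _ mu2 D _ `|Ca * Cb * B|) => //.
    exact: measurable_cst.
  by move=> z _; rewrite normr_id.
have G_ub (t : R) (z : plane) : `]x.2 - 1, x.2 + 1[%classic t -> D z ->
    `|partial1of2 f t z| <= G z.
  move=> _ Dz; rewrite fp (le_trans _ (ler_norm _))// !normrM ler_pM ?mulr_ge0//.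
    by rewrite ler_pM.
  exact: psiB.
have dF := derivable_under_integral mD xI intf derf (fun _ => normr_ge0 _) intG G_ub.
have := differentiation_under_integral mD xI intf derf (fun _ => normr_ge0 _) intG G_ub.
rewrite derive1E => E; split; first exact: dF.
by rewrite [LHS]E; apply: eq_Rintegral => z _; rewrite fp.
Qed.

Lemma d1_conv (a b : R -> R) : smooth_supported d a -> smooth_supported d b ->
  d1 (conv a b) = conv (derive1 a) b.
Proof.
move=> sa sb; apply/funext => x; apply: derive_val.
exact: conv_is_derive1.
Qed.

Lemma d2_conv (a b : R -> R) : smooth_supported d a -> smooth_supported d b ->
  d2 (conv a b) = conv a (derive1 b).
Proof.
move=> sa sb; apply/funext => x; apply: derive_val.
exact: conv_is_derive2.
Qed.

Lemma conv_partially_derivable (a b : R -> R) :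
  smooth_supported d a -> smooth_supported d b ->
  partially_derivable setT (conv a b).
Proof.
move=> sa sb x _; split; apply: ex_derive.
  exact: conv_is_derive1.
exact: conv_is_derive2.
Qed.

Lemma conv_continuous (a b : R -> R) : smooth_supported d a ->
  smooth_supported d b -> continuous (conv a b).
Proof.
move=> sa sb x.
have sa' := smooth_supported_derive1 sa; have sb' := smooth_supported_derive1 sb.
have [C1 C1P] := conv_bounded sa' sb; have [C2 C2P] := conv_bounded sa sb'.
apply: (@lip_near_continuous _ _ _ _ (2 * Num.max C1 C2)).
apply: (@partial_lip_near _ setT) => //; first exact: openT.
  exact: conv_partially_derivable.
by move=> y _; rewrite (d1_conv sa sb) (d2_conv sa sb) !le_max C1P C2P orbT.
Qed.

Lemma conv_Ck (a b : R -> R) k : smooth_supported d a ->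
  smooth_supported d b -> Ck_closure k setT (conv a b).
Proof.
elim: k a b => [|k IH] a b sa sb.
  split=> //; exists (conv a b); split=> // .
  by apply: continuous_subspaceT; exact: conv_continuous.
split.
  exists (conv a b); split=> //.
  by apply: continuous_subspaceT; exact: conv_continuous.
split; first exact: conv_partially_derivable.
- by rewrite (d1_conv sa sb); apply: IH => //; exact: smooth_supported_derive1.
- by rewrite (d2_conv sa sb); apply: IH => //; exact: smooth_supported_derive1.
Qed.

Lemma conv_C1 (a b : R -> R) : smooth_supported d a ->
  smooth_supported d b -> C1 setT (conv a b).
Proof.
move=> sa sb x _.
have sa' := smooth_supported_derive1 sa; have sb' := smooth_supported_derive1 sb.
have pd := conv_partially_derivable sa sb; have [h1 h2] := pd x I.
split; [exact: h1|exact: h2| |].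
  by rewrite (d1_conv sa sb); exact: conv_continuous.
by rewrite (d2_conv sa sb); exact: conv_continuous.
Qed.

(** Both sides equal [conv (derive1 a) (derive1 b)]. This symmetry is what makes the rotated
    gradient divergence free when tested with a mollification. *)
Lemma conv_d1_d2 (a b : R -> R) : smooth_supported d a ->
  smooth_supported d b -> d1 (d2 (conv a b)) = d2 (d1 (conv a b)).
Proof.
move=> sa sb; have sa' := smooth_supported_derive1 sa.
have sb' := smooth_supported_derive1 sb.
by rewrite (d2_conv sa sb) (d1_conv sa sb') (d1_conv sa sb) (d2_conv sa' sb).
Qed.

End convolution.

Section squares.
Context {R : realType}.
Local Notation mu2 := (@lebesgue2 R).
Local Notation plane := (measurableTypeR R * measurableTypeR R)%type.

Definition square (r : R) : set (R * R) := [set z | `|z| <= r].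

Lemma measurable_square r : measurable (square r : set plane).
Proof.
apply: measurable_closed_plane; apply: (@preimage_closed _ _ (fun z : R * R => `|z|) [set t | t <= r]).
  by move=> x _; exact: norm_continuous.
exact: closed_le.
Qed.

Lemma square_fin r : (mu2 (square r) < +oo)%E.
Proof.
apply: bounded_set_lebesgue2; first exact: measurable_square.
by exists r; split; [exact: num_real|move=> s rs z /= zr; rewrite (le_trans zr)// ltW].
Qed.

(* [lebesgue2] under a name that carries the sigma-finite structure required by
   Fubini's theorem on plane * plane. *)
Definition plane_measure : set plane -> \bar R := mu2.

HB.instance Definition _ :=
  Measure.copy plane_measure (@lebesgue_measure R \x @lebesgue_measure R)%E.

Lemma plane_measure_sigma_finite : sigma_finite setT plane_measure.
Proof.
exists (fun n => square n%:R); last first.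
  by move=> n; split; [exact: measurable_square|exact: square_fin].
apply/seteqP; split=> // x _; exists (Num.Def.archi_bound `|x|) => //.
by rewrite /square /= ltW// archi_boundP.
Qed.

HB.instance Definition _ := Measure_isSigmaFinite.Build _ _ _ plane_measure
  plane_measure_sigma_finite.

End squares.

Section kernel.
Context {R : realType}.
Local Notation mu2 := (@lebesgue2 R).
Local Notation plane := (measurableTypeR R * measurableTypeR R)%type.
Variables (a : R -> R) (d : R).
Hypotheses (d0 : 0 < d) (sa : smooth_supported d a) (a_ge0 : forall x, 0 <= a x).
Hypothesis a_gt0 : forall x, `|x| < d -> 0 < a x.

Definition kernel2 (z : R * R) : R := a z.1 * a z.2.

Lemma kernel2_ge0 z : 0 <= kernel2 z.
Proof. by rewrite mulr_ge0. Qed.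

Lemma kernel2_support z : ~ square d z -> kernel2 z = 0.
Proof.
have [_ a0] := sa.
rewrite /square /= norm_pair_le /kernel2 => /negP; rewrite negb_and -!ltNge.
by case/orP => /a0 ->; rewrite ?mul0r ?mulr0.
Qed.

Lemma kernel2_continuous : continuous kernel2.
Proof.
have ca := smooth_supported_continuous sa.
move=> z; apply: cvgM.
  by apply: (continuous_comp (f := fst) (g := a)); [exact: cvg_fst|exact: ca].
by apply: (continuous_comp (f := snd) (g := a)); [exact: cvg_snd|exact: ca].
Qed.

Lemma measurable_kernel2 : measurable_fun setT (kernel2 : plane -> R).
Proof.
apply: measurable_fun_continuous; first exact: openT.
by move=> x _; exact: kernel2_continuous.
Qed.

Lemma kernel2_bounded : exists C, forall z, `|kernel2 z| <= C.
Proof.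
have [C CP] := smooth_supported_bounded sa.
by exists (C * C) => z; rewrite normrM ler_pM.
Qed.

Lemma integrable_kernel2M (g : plane -> R) (C : R) : measurable_fun setT g ->
  (forall z, `|g z| <= C) -> mu2.-integrable setT (EFin \o (fun z => kernel2 z * g z)).
Proof.
move=> mg gC; have [B BP] := kernel2_bounded.
apply: (@integrable_bounded_support _ _ _ mu2 (square d) _ (B * C)).
- exact: measurable_square.
- exact: square_fin.
- by apply: measurable_funM => //; exact: measurable_kernel2.
- by move=> z; rewrite normrM ler_pM.
- by move=> z /kernel2_support ->; rewrite mul0r.
Qed.

Lemma integrable_kernel2 : mu2.-integrable setT (EFin \o kernel2).
Proof.
have := @integrable_kernel2M (cst 1) 1 (measurable_cst _).
by rewrite (_ : (fun z => _) = kernel2);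
  [apply=> z; rewrite normr1|apply/funext => z; rewrite mulr1].
Qed.

(** The kernel is not normalized: its mass appears as a factor on both sides of the final estimate
    and is cancelled there. On the square of half-side [d / 2] it is at least the square of the
    positive minimum of [a]. *)
Lemma kernel2_int_gt0 : 0 < \int[mu2]_z kernel2 z.
Proof.
have d20 : 0 < d / 2 by rewrite divr_gt0.
have ca := smooth_supported_continuous sa.
have dd : - (d / 2) <= d / 2 by rewrite ge0_cp// ltW.
have [c cd cP] := EVT_min dd (continuous_subspaceT ca).
have ac0 : 0 < a c.
  apply: a_gt0; move: cd; rewrite in_itv/= -ler_norml => /le_lt_trans; apply.
  by rewrite ltr_pdivrMr// ltr_pMr// ltr1n.
pose J : set R := `[- (d / 2), d / 2]%classic.
have mJ : measurable J by exact: measurable_itv.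
have JE : lebesgue_measure J = d%:E.
  have lt : - (d / 2) < d / 2 by rewrite gtrN.
  by rewrite /J lebesgue_measure_itv/= lte_fin lt -EFinD; congr (_%:E); lra.
pose S : set plane := J `*` J.
have mS : measurable S by apply: measurableX.
have SE : mu2 S = (d * d)%:E.
  transitivity (lebesgue_measure J * lebesgue_measure J)%E; last by rewrite JE -EFinM.
  exact: product_measure1E.
have h : a c * a c * (d * d) <= \int[mu2]_z kernel2 z.
  have -> : a c * a c * (d * d) = \int[mu2]_(z in S) (a c * a c).
    apply/esym; apply: etrans (Rintegral_cst mu2 mS _) _; congr (_ * _).
    exact: (congr1 fine SE).
  rewrite Rintegral_mkcond; apply: le_Rintegral => //.
  - rewrite (_ : EFin \o _ = (EFin \o cst (a c * a c)) \_ S); last first.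
      by apply/funext => z /=; rewrite !patchE; case: ifP.
    apply: (integrable_mkcond _ mS).1.
    apply: (@integrable_bounded _ _ _ mu2 S _ `|a c * a c|) => //.
      by apply: (@le_lt_trans _ _ (d * d)%:E); [rewrite -SE|rewrite ltry].
  - exact: integrable_kernel2.
  - move=> z _; rewrite patchE; case: ifPn => [|_]; last exact: kernel2_ge0.
    rewrite inE => -[z1 z2]; by rewrite /kernel2 ler_pM ?(ltW ac0)// cP.
apply: lt_le_trans h; by rewrite !mulr_gt0.
Qed.

End kernel.

(** * Lipschitz test functions *)

Section weak_divergence.
Context {R : realType}.
Local Notation mu2 := (@lebesgue2 R).
Local Notation plane := (measurableTypeR R * measurableTypeR R)%type.
Variables (Omega K : set (R * R)) (V : R * R -> R * R) (psi D : R * R -> R) (L : R).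
Hypotheses (oO : open Omega) (bO : bounded_set Omega).
Hypothesis cV : forall x, Omega x -> {for x, continuous V}.
Hypothesis weakV : forall theta, test_function Omega theta ->
  d1 (d2 theta) = d2 (d1 theta) ->
  \int[mu2]_(x in Omega) dot2 (V x) (grad theta x) = 0.
Hypotheses (L0 : 0 <= L) (psiL : forall x y, `|psi x - psi y| <= L * `|x - y|).
Hypotheses (cK : compact K) (KO : K `<=` Omega) (psi0 : forall x, ~ K x -> psi x = 0).
Hypothesis dpsi : forall x, Omega x -> is_derive x (V x) psi (D x).

Let mO : measurable (Omega : set plane) := measurable_open_plane oO.
Let O_fin : (mu2 Omega < +oo)%E := bounded_set_lebesgue2 mO bO.
Let closedK : closed K. Proof. exact: compact_closed. Qed.
Let mK : measurable (K : set plane) := measurable_closed_plane closedK.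

Let psi_cont : continuous psi.
Proof.
by move=> x; apply: (@lip_near_continuous _ _ _ _ L); exists 1 => // y z _ _; exact: psiL.
Qed.

Let mpsi : measurable_fun setT (psi : plane -> R).
Proof.
apply: measurable_fun_continuous; first exact: openT.
by move=> x _; exact: psi_cont.
Qed.

Let psi_bounded : exists2 B, 0 <= B & forall x, `|psi x| <= B.
Proof.
have [C CP] := continuous_compact_bounded cK (fun x _ => @psi_cont x).
exists `|C| => // x; have [Kx|/psi0 ->] := pselect (K x); last by rewrite normr0.
by rewrite (le_trans (CP _ Kx))// ler_norm.
Qed.

Lemma is_derive_off_support y v : ~ K y -> is_derive y v psi 0.
Proof.
move=> nKy; have oK : open (~` K) by exact: closed_openC.
apply: (@near_eq_is_derive _ _ _ (cst 0)).
have : \forall z \near y, (~` K) z by exact: open_nbhs_nbhs.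
by apply: filterS => z /psi0 ->.
Qed.

(** Zero off [K], so that it can be convolved over the whole plane. *)
Let Dt : R * R -> R := D \_ K.

Let DtK y : K y -> Dt y = D y.
Proof. by move=> Ky; rewrite /Dt patchE mem_set. Qed.

Let Dt0 y : ~ K y -> Dt y = 0.
Proof. by move=> nKy; rewrite /Dt patchE memNset. Qed.

(** Off [K] the function [psi] vanishes locally, so uniqueness of the derivative gives [D y = 0]. *)
Let DtE y : Omega y -> Dt y = D y.
Proof.
move=> Oy; have [/DtK//|nKy] := pselect (K y); rewrite Dt0//.
have h1 := @is_derive_off_support y (V y) nKy; have h2 := dpsi Oy.
by rewrite -(@derive_val _ _ _ _ _ _ _ h1) (@derive_val _ _ _ _ _ _ _ h2).
Qed.

Let Dt_bounded : exists2 B, 0 <= B & forall x, `|Dt x| <= B.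
Proof.
have [C CP] := continuous_compact_bounded cK (fun x Kx => cV (KO Kx)).
exists (L * `|C| + 1); first by rewrite addr_ge0// mulr_ge0.
move=> x; have [Kx|/Dt0 ->] := pselect (K x); last first.
  by rewrite normr0 addr_ge0// mulr_ge0.
(* A single difference quotient with error at most 1 bounds [D x] by [L * |V x| + 1]. *)
rewrite (DtK Kx); have [r r0 rP] := (is_derive_epsP _ _ _ _).1 (dpsi (KO Kx)) _ ltr01.
have r2 : `|r / 2| < r by rewrite gtr0_norm ?divr_gt0// ltr_pdivrMr// ltr_pMr// ltr1n.
have := rP _ r2; set t := r / 2 => H.
have t0 : 0 < `|t| by rewrite normr_gt0 gt_eqF// divr_gt0.
rewrite -(ler_pM2l t0) -normrM -[t * _]/(t *: D x).
have -> : t *: D x = (psi (t *: V x + x) - psi x) - (psi (t *: V x + x) - psi x - t *: D x).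
  by rewrite opprB addrC subrK.
rewrite mulrDr mulr1 (le_trans (ler_normB _ _))// lerD//; last by rewrite -[leRHS]mul1r.
rewrite (le_trans (psiL _ _))// addrK normrZ mulrCA ler_wpM2l// ler_wpM2l//.
by rewrite (le_trans (CP _ Kx))// ler_norm.
Qed.

(** [D] is a pointwise limit of difference quotients, which are continuous on [Omega] because [V]
    and [psi] are. *)
Let mDt : measurable_fun setT (Dt : plane -> R).
Proof.
suff mD : measurable_fun (Omega : set plane) D.
  apply: (measurable_restrictT _ mK).1; exact: (measurable_funS mO KO mD).
apply: (@measurable_fun_cvg _ _ _ _ (fun n (x : plane) =>
    n.+1%:R * (psi (n.+1%:R^-1 *: V x + x) - psi x))) => [n|x Ox]; last first.
  by apply: is_derive_seq; exact: dpsi.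
apply: measurable_fun_continuous => // x Ox.
apply: cvgM; first exact: cvg_cst.
apply: cvgB; last exact: psi_cont.
apply: (continuous_comp (f := fun x => n.+1%:R^-1 *: V x + x) (g := psi)); last exact: psi_cont.
by apply: cvgD; [apply: cvgZr; exact: cV|exact: cvg_id].
Qed.

Section mollified.
Variables (eta d : R).
Hypotheses (eta0 : 0 < eta) (d0 : 0 < d).
Hypothesis etaP : forall x y, K x -> `|y - x| < 2 * d -> Omega y /\ `|V y - V x| <= eta.
Variable a : R -> R.
Hypotheses (sa : smooth_supported d a) (a_ge0 : forall x, 0 <= a x).
Hypothesis a_gt0 : forall x, `|x| < d -> 0 < a x.

Let k := kernel2 a.
Let A := \int[mu2]_z k z.
Let theta := conv Omega psi a a.
Let mpsiO : measurable_fun (Omega : set plane) psi := measurable_funTS mpsi.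

Let A_gt0 : 0 < A. Proof. exact: kernel2_int_gt0 d0 sa a_ge0 a_gt0. Qed.

Let kernel_near z : k z != 0 -> `|z| <= d.
Proof.
by move=> kz; apply: contrapT => /(kernel2_support sa) k0; move: kz; rewrite /k k0 eqxx.
Qed.

Lemma mollify_convE x : theta x = \int[mu2]_z (k z * psi (x - z)).
Proof.
transitivity (\int[mu2]_z (k (x - z) * psi z)).
  rewrite /theta /conv Rintegral_mkcond; apply: eq_Rintegral => z _.
  rewrite patchE; case: ifPn => // /negP; rewrite inE => nOz.
  by rewrite psi0 ?mulr0// => /KO.
rewrite -(Rintegral_reflection x).
  by apply: eq_Rintegral => z _; rewrite opprB addrC subrK.
apply: measurable_funM => //.
apply: (measurableT_comp (measurable_kernel2 sa) (measurable_reflection x)).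
Qed.

Lemma mollify_support x : theta x != 0 -> exists2 z, K z & `|x - z| <= d.
Proof.
apply: contraNP => H; rewrite /theta /conv; apply/eqP.
rewrite (@eq_Rintegral _ _ _ _ _ (cst 0)).
  by rewrite (Rintegral_cst mu2 mO) mul0r.
move=> z _ /=; have [Kz|/psi0 ->] := pselect (K z); last by rewrite mulr0.
rewrite -[a _ * a _]/(k (x - z)); have [->|/kernel_near] := eqVneq (k (x - z)) 0.
  by rewrite mul0r.
by move=> xz; exfalso; apply: H; exists z.
Qed.

Lemma mollify_test_function : test_function Omega theta.
Proof.
have d2 : 0 < d / 2 by rewrite divr_gt0.
have [psiB B0 psiBP] := psi_bounded.
(* A point of the closed support is within [d] of a point of the support, itself within [d] of [K]:
   hence the radius [2 * d] in [etaP]. *)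
have sub x : closure [set x | theta x != 0] x -> exists2 z, K z & `|x - z| < 2 * d.
  move=> /(_ [set y | `|y - x| < d]) [|y [/mollify_support[z Kz yz] /= yx]].
    by apply/near_ball; exists d.
  exists z => //; rewrite -(subrKA y) (le_lt_trans (ler_normD _ _))//.
  by rewrite mulrDl mul1r ltr_leD// distrC.
split.
- by move=> n; apply: (@conv_Ck _ _ _ psiB d) => //.
- apply: compact_closed_bounded; first exact: closed_closure.
  have [N [_ NP]] := bO; exists N; split; first exact: num_real.
  move=> s Ns x /sub[z Kz xz]; apply: NP => //.
  exact: (etaP Kz xz).1.
- by move=> x /sub[z Kz xz]; exact: (etaP Kz xz).1.
Qed.

Let c x := \int[mu2]_z (k z * Dt (x - z)).

Let mDt_refl x : measurable_fun setT (fun z : plane => Dt (x - z)).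
Proof. exact: (measurableT_comp mDt (measurable_reflection x)). Qed.

Let mpsi_refl x : measurable_fun setT (fun z : plane => psi (x - z)).
Proof. exact: (measurableT_comp mpsi (measurable_reflection x)). Qed.

Section at_point.
Variable x : R * R.
Hypothesis Ox : Omega x.
Let Q (n : nat) (z : R * R) := n.+1%:R * (psi (n.+1%:R^-1 *: V x + (x - z)) - psi (x - z)).
(** At [x - z] the function [psi] is known to be differentiable along [V (x - z)], not along [V x],
    so [Q n z] may diverge. Its excess over the tolerated error [L * eta] does tend to 0, which
    allows dominated convergence. *)
Let m (n : nat) (z : R * R) := Num.max (`|Q n z - Dt (x - z)| - L * eta) 0.

Let Q_bounded n z : `|Q n z| <= L * `|V x|.
Proof.
rewrite /Q normrM ger0_norm// -ler_pdivlMl//.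
rewrite (le_trans (psiL _ _))// addrK normrZ ger0_norm ?invr_ge0//.
by rewrite mulrCA.
Qed.

Let mQ n : measurable_fun setT (Q n : plane -> R).
Proof.
apply: measurable_funM => //; apply: measurable_funB => //.
rewrite (_ : (fun z : plane => _) = fun z : plane => psi (n.+1%:R^-1 *: V x + x - z)).
  exact: mpsi_refl.
by apply/funext => z; rewrite addrA.
Qed.

Let mm n : measurable_fun setT (m n : plane -> R).
Proof.
apply: measurable_maxr => //; apply: measurable_funB => //.
apply: measurableT_comp => //; apply: measurable_funB => //.
Qed.

Let m_cvg z : k z != 0 -> m ^~ z @ \oo --> 0.
Proof.
move=> /kernel_near kz; set y := x - z.
have key (e : nat -> R) : (forall n, m n z <= e n) -> e @ \oo --> 0 -> m ^~ z @ \oo --> 0.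
  move=> me e0; apply: (@squeeze_cvgr _ _ _ _ (cst 0) e) => //.
    by apply: nearW => n; rewrite me andbT le_max lexx orbT.
  exact: cvg_cst.
have [Ky|nKy] := pselect (K y).
- apply: (key (fun n => `|n.+1%:R * (psi (n.+1%:R^-1 *: V y + y) - psi y) - D y|)); last first.
    have := is_derive_seq (dpsi (KO Ky)).
    by move=> /cvgr_distC_lt H; apply/cvgrPdist_lt => e /H; apply: filterS => n; rewrite sub0r normrN normr_id.
  move=> n; rewrite ge_max normr_ge0 andbT -/y DtK// lerBlDr.
  set q := _ * (psi (_ *: V y + y) - _).
  (* [Q n z - q] comes from replacing [V y] by [V x] in the quotient and costs [L * |V x - V y|], at
     most the amount subtracted in [m]. *)
  have -> : Q n z - D y = (q - D y) + (Q n z - q) by ring.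
  rewrite (le_trans (ler_normD _ _))// lerD//.
  rewrite /Q -/y /q -mulrBr opprB addrA subrK normrM ger0_norm// -ler_pdivlMl//.
  rewrite (le_trans (psiL _ _))// opprD addrACA subrr addr0 -scalerBr normrZ.
  rewrite ger0_norm ?invr_ge0// mulrCA ler_wpM2l ?invr_ge0// ler_wpM2l//.
  apply: (etaP Ky _).2; rewrite /y opprB addrC subrK.
  by rewrite (le_lt_trans kz)// ltr_pMl// ltr1n.
- apply: (key (fun n => `|Q n z|)); last first.
    have := is_derive_seq (@is_derive_off_support _ (V x) nKy).
    by move=> /cvgr_distC_lt H; apply/cvgrPdist_lt => e /H; apply: filterS => n; rewrite sub0r normrN normr_id subr0.
  move=> n; rewrite ge_max normr_ge0 andbT -/y Dt0// subr0 gerBl.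
  by rewrite mulr_ge0// ltW.
Qed.

(* The derivative of [psi] along [V x] at [x - z] differs from [D (x - z)] by at most
   [L * eta], because [V] varies by at most [eta] there; so [psi] need not be
   differentiable in any other direction. *)
Lemma mollify_commutator : `|dot2 (V x) (grad theta x) - c x| <= A * (L * eta).
Proof.
have [B B0 BP] := psi_bounded; have [B' B'0 B'P] := Dt_bounded.
have i_psi y : mu2.-integrable setT (EFin \o (fun z => k z * psi (y - z))).
  by apply: (integrable_kernel2M sa (C := B)).
have i_Dt : mu2.-integrable setT (EFin \o (fun z => k z * Dt (x - z))).
  by apply: (integrable_kernel2M sa (C := B')).
have i_Q n : mu2.-integrable setT (EFin \o (fun z => k z * Q n z)).
  by apply: (integrable_kernel2M sa (C := L * `|V x|)).
have m_bounded n z : `|m n z| <= L * `|V x| + B'.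
  rewrite ger0_norm ?le_max ?lexx ?orbT// ge_max addr_ge0 ?mulr_ge0// andbT.
  rewrite lerBlDr (le_trans (ler_normB _ _))// (le_trans (lerD (Q_bounded n z) (B'P _)))//.
  by rewrite lerDl mulr_ge0// ltW.
have i_m n : mu2.-integrable setT (EFin \o (fun z => k z * m n z)).
  by apply: (integrable_kernel2M sa (C := L * `|V x| + B')).
pose q n := n.+1%:R * (theta (n.+1%:R^-1 *: V x + x) - theta x).
have qE n : q n = \int[mu2]_z (k z * Q n z).
  rewrite /q !mollify_convE -RintegralB// -RintegralZl//.
    by apply: eq_Rintegral => z _; rewrite /Q -addrA; ring.
  exact: integrable_funB.
have q_cvg : q @ \oo --> dot2 (V x) (grad theta x).
  rewrite dot2C; apply: is_derive_seq.
  apply: (@C1_is_derive _ setT) => //; first exact: openT.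
  by apply: (@conv_C1 _ _ _ B d).
have m_int : (fun n => \int[mu2]_z (k z * m n z)) @ \oo --> Rintegral mu2 setT (cst 0).
  apply: (@dominated_cvg_Rintegral _ _ _ mu2 setT _ (cst 0) (fun z => k z * (L * `|V x| + B'))) => //.
  - by move=> n; apply: measurable_funM => //; exact: measurable_kernel2 sa.
  - move=> z _; have [->|kz] := eqVneq (k z) 0.
      by under eq_fun do rewrite mul0r; exact: cvg_cst.
    by rewrite -[X in _ --> X](mulr0 (k z)); apply: cvgM; [exact: cvg_cst|exact: m_cvg].
  - by apply: (integrable_kernel2M sa (g := cst _) (C := `|L * `|V x| + B'|)).
  - by move=> n z _; rewrite normrM ger0_norm ?kernel2_ge0// ler_wpM2l// kernel2_ge0.
rewrite (Rintegral_cst mu2 measurableT) mul0r in m_int.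
have q_bound n : `|q n - c x| <= A * (L * eta) + \int[mu2]_z (k z * m n z).
  rewrite qE /c -RintegralB// /A.
  rewrite -RintegralZr//; last exact: integrable_kernel2 sa.
  rewrite -RintegralD//; last first.
    by apply: (integrable_kernel2M sa (g := cst _) (C := `|L * eta|)).
  apply: le_trans (le_normr_Rintegral _ _) _ => //.
    exact: integrable_funB.
  apply: le_Rintegral => //.
  - by apply: integrable_norm; exact: integrable_funB.
  - apply: integrable_funD => //.
    by apply: (integrable_kernel2M sa (g := cst _) (C := `|L * eta|)).
  - move=> z _; rewrite -mulrBr normrM ger0_norm ?kernel2_ge0// -mulrDr.
    by rewrite ler_wpM2l ?kernel2_ge0// -lerBlDl /m le_max lexx.
have c1 : (fun n => `|q n - c x|) @ \oo --> `|dot2 (V x) (grad theta x) - c x|.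
  by apply: cvg_norm; apply: cvgB => //; exact: cvg_cst.
have c2 : (fun n => A * (L * eta) + \int[mu2]_z (k z * m n z)) @ \oo --> A * (L * eta).
  by rewrite -[X in _ --> X]addr0; apply: cvgD => //; exact: cvg_cst.
by apply: (ler_cvg_to c1 c2); apply: nearW => n; exact: q_bound.
Qed.
End at_point.

Let F (p : plane * plane) : R := k p.2 * Dt (p.1 - p.2).

Let mF : measurable_fun setT F.
Proof.
suff msub : measurable_fun setT (fun p : plane * plane => (p.1 - p.2 : plane)).
  apply: measurable_funM; last exact: (measurableT_comp mDt msub).
  exact: (measurableT_comp (measurable_kernel2 sa) measurable_snd).
apply/measurable_fun_pairP; split.
  rewrite (_ : _ \o _ = (fun p : plane * plane => p.1.1 - p.2.1))//.
  apply: measurable_funB.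
    exact: (measurableT_comp measurable_fst measurable_fst).
  exact: (measurableT_comp measurable_fst measurable_snd).
rewrite (_ : _ \o _ = (fun p : plane * plane => p.1.2 - p.2.2))//.
apply: measurable_funB.
  exact: (measurableT_comp measurable_snd measurable_fst).
exact: (measurableT_comp measurable_snd measurable_snd).
Qed.

Let iF : (plane_measure \x plane_measure)%E.-integrable setT (EFin \o F).
Proof.
have [B B0 BP] := Dt_bounded; have [B' B'P] := kernel2_bounded sa.
(* If both factors of [F] are nonzero, then [p.1] is within [d] of [K], hence in [Omega]: [F] is
   supported in a set of finite measure. *)
pose E := (Omega `*` square d) : set (plane * plane).
apply: (@integrable_bounded_support _ _ _ (plane_measure \x plane_measure)%E E F (B' * B)).
- by apply: measurableX => //; exact: measurable_square.
- apply: (@le_lt_trans _ _ (mu2 Omega * mu2 (square d))%E).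
    rewrite le_eqVlt; apply/orP; left; apply/eqP.
    by apply: product_measure1E => //; exact: measurable_square.
  apply: lte_mul_pinfty => //; last exact: square_fin.
  by rewrite ge0_fin_numE.
- exact: mF.
- by move=> p; rewrite normrM ler_pM//; exact: B'P.
- move=> p nEp; rewrite /F; apply: contrapT => /eqP.
  rewrite mulf_eq0 negb_or => /andP[/kernel_near kp Dp]; apply: nEp.
  have Kp : K (p.1 - p.2) by apply: contrapT => /Dt0 /eqP; exact/negP.
  split => //; apply: (etaP Kp _).1; rewrite opprB addrC subrK.
  by rewrite (le_lt_trans kp)// ltr_pMl// ltr1n.
Qed.

Let i_Dt_refl x : mu2.-integrable setT (EFin \o (fun z => k z * Dt (x - z))).
Proof.
by have [B B0 BP] := Dt_bounded; apply: (integrable_kernel2M sa (C := B)).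
Qed.

Let cE x : ((c x)%:E = \int[mu2]_z (F (x, z))%:E)%E.
Proof. by rewrite /c EFin_Rintegral. Qed.

Let mc : measurable_fun setT (c : plane -> R).
Proof.
apply/measurable_EFinP; rewrite (_ : EFin \o c = fubini_F mu2 (EFin \o F)).
  exact: measurable_fubini_F iF.
by apply/funext => x /=; rewrite cE.
Qed.

Let c_bounded : exists C, forall x, `|c x| <= C.
Proof.
have [B B0 BP] := Dt_bounded; exists (A * B) => x.
rewrite /c; apply: le_trans (le_normr_Rintegral _ (i_Dt_refl x)) _ => //.
rewrite /A -RintegralZr//; last exact: integrable_kernel2 sa.
apply: le_Rintegral => //.
- exact: integrable_norm (i_Dt_refl x).
- by apply: (integrable_kernel2M sa (g := cst B) (C := B)) => // z; rewrite ger0_norm.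
- by move=> z _; rewrite normrM ger0_norm ?kernel2_ge0// ler_wpM2l// kernel2_ge0.
Qed.

Let i_Dt : mu2.-integrable setT (EFin \o Dt).
Proof.
have [B B0 BP] := Dt_bounded.
apply: (@integrable_bounded_support _ _ _ mu2 Omega _ B) => // x nOx.
by apply: Dt0 => /KO.
Qed.

(** The integral of a convolution is the product of the integrals. Nothing is lost outside [Omega],
    since [c] vanishes farther than [d] from [K]. *)
Lemma mollify_fubini : \int[mu2]_(x in Omega) c x = A * \int[mu2]_x Dt x.
Proof.
have [B B0 BP] := Dt_bounded.
have -> : \int[mu2]_(x in Omega) c x = \int[mu2]_x c x.
  rewrite Rintegral_mkcond; apply: eq_Rintegral => x _.
  rewrite patchE; case: ifPn => // /negP; rewrite inE => nOx; apply/esym.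
  rewrite /c (@eq_Rintegral _ _ _ _ _ (cst 0)).
    by rewrite (Rintegral_cst mu2 measurableT) mul0r.
  move=> z _ /=; have [->|/kernel_near kz] := eqVneq (k z) 0; first by rewrite mul0r.
  rewrite Dt0 ?mulr0// => Kxz; apply: nOx; apply: (etaP Kxz _).1.
  by rewrite opprB addrC subrK (le_lt_trans kz)// ltr_pMl// ltr1n.
have mDtz z : measurable_fun setT (fun x : plane => Dt (x - z)).
  have mN : measurable_fun setT (fun y : plane => Dt (- y)).
    rewrite (_ : (fun y : plane => _) = (fun y => Dt (0 - y))); first exact: mDt_refl.
    by apply/funext => y; rewrite sub0r.
  rewrite (_ : (fun x => _) = (fun y => Dt (- y)) \o (fun x : plane => (z - x : plane))).
    exact: (measurableT_comp mN (measurable_reflection z)).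
  by apply/funext => x /=; rewrite opprB.
have refl z : \int[mu2]_x Dt (x - z) = \int[mu2]_x Dt x.
  have -> : (fun x => Dt (x - z)) = (fun x => (fun y => Dt (- y)) (z - x)).
    by apply/funext => x; rewrite opprB.
  have mN : measurable_fun setT (fun y : plane => Dt (- y)).
    rewrite (_ : (fun y : plane => _) = (fun y => Dt (0 - y))); first exact: mDt_refl.
    by apply/funext => y; rewrite sub0r.
  rewrite (Rintegral_reflection z mN) -(Rintegral_reflection 0 mDt).
  by apply: eq_Rintegral => y _; rewrite sub0r.
have i_Dtz z : mu2.-integrable setT (EFin \o (fun x => Dt (x - z))).
  apply: (@integrable_bounded_support _ _ _ mu2 [set x | Omega (x - z)] _ B).
  - apply: measurable_open_plane; apply: open_comp oO => x _.
    by apply: cvgB; [exact: cvg_id|exact: cvg_cst].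
  - apply: bounded_set_lebesgue2; last first.
      have [N [_ NP]] := bO; exists (N + 1 + `|z|); split; first exact: num_real.
      move=> r Nr x /= Oxz; rewrite -(subrK z x) (le_trans (ler_normD _ _))//.
      have N1 : N < N + 1 by rewrite ltrDl.
      by rewrite (le_trans _ (ltW Nr))// lerD2r; exact: (NP _ N1 _ Oxz).
    apply: measurable_open_plane; apply: open_comp oO => x _.
    by apply: cvgB; [exact: cvg_id|exact: cvg_cst].
  - exact: mDtz.
  - by move=> x; exact: BP.
  - by move=> x nOx; apply: Dt0 => /KO.
rewrite {1}/Rintegral; under eq_integral do rewrite cE.
rewrite (Fubini iF) /=.
transitivity (fine (\int[mu2]_z (k z * \int[mu2]_x Dt x)%:E)).
  congr fine; apply: eq_integral => z _.
  transitivity (\int[mu2]_x (k z * Dt (x - z)))%:E.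
    by apply/esym/EFin_Rintegral => //; exact: integrable_funZl.
  by rewrite RintegralZl// refl.
rewrite -/(Rintegral _ _ _) RintegralZr//; exact: integrable_kernel2 sa.
Qed.

(** The integral of [V . grad theta] is 0 by [weakV]; only the commutator remains, of size
    [A * (L * eta)], and [A] cancels. *)
Lemma mollify_estimate :
  `|\int[mu2]_(x in Omega) D x| <= L * eta * fine (mu2 Omega).
Proof.
have -> : \int[mu2]_(x in Omega) D x = \int[mu2]_x Dt x.
  rewrite Rintegral_mkcond; apply: eq_Rintegral => x _.
  rewrite patchE; case: ifPn => [|/negP]; rewrite inE; first by move=> /DtE.
  by move=> nOx; rewrite Dt0// => /KO.
rewrite -(ler_pM2l A_gt0) -{1}(gtr0_norm A_gt0) -normrM -mollify_fubini.
have [C CP] := c_bounded.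
have ic : mu2.-integrable Omega (EFin \o c).
  by apply: (@integrable_bounded _ _ _ mu2 Omega _ C) => //; exact: measurable_funTS.
pose Dth x := dot2 (V x) (grad theta x).
have [B B0 BP] := psi_bounded.
have C1th : C1 setT theta by apply: (@conv_C1 _ _ _ B d).
have mDth := measurable_dot2_grad oO cV (fun x (_ : Omega x) => C1th x I).
have iDth : mu2.-integrable Omega (EFin \o Dth).
  apply: (@integrable_bounded _ _ _ mu2 Omega _ (C + A * (L * eta))) => // x Ox.
  rewrite -[Dth x](subrK (c x)) addrC (le_trans (ler_normD _ _))// lerD//.
  exact: mollify_commutator.
have -> : \int[mu2]_(x in Omega) c x = \int[mu2]_(x in Omega) (c x - Dth x).
  have d12 : d1 (d2 theta) = d2 (d1 theta) := conv_d1_d2 mO O_fin mpsiO (fun z _ => BP z) sa sa.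
  have w0 : \int[mu2]_(x in Omega) Dth x = 0 := weakV mollify_test_function d12.
  by rewrite (RintegralB mO ic iDth) w0 subr0.
rewrite mulrA; apply: Rintegral_normr_le => //; first exact: integrable_funB.
by move=> x Ox; rewrite distrC; exact: mollify_commutator.
Qed.

End mollified.

(** The estimate does not involve [d], and [eta] can be made small with the mollification radius,
    since [V] is uniformly continuous around [K]. *)
Theorem weak_divergence_Lipschitz : \int[mu2]_(x in Omega) D x = 0.
Proof.
apply/eqP; rewrite -normr_le0; apply/ler_addgt0Pl => e e0; rewrite addr0.
pose N := L * fine (mu2 Omega) + 1.
have N0 : 0 < N by rewrite ltr_wpDl// mulr_ge0// fine_ge0.
have eta0 : 0 < e / N by rewrite divr_gt0.
have [r r0 rP] := compact_uniform oO cK KO cV eta0.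
have d0 : 0 < r / 2 by rewrite divr_gt0.
have [a [sa a0 a1]] := smooth_bump_exists d0.
have etaP x y : K x -> `|y - x| < 2 * (r / 2) -> Omega y /\ `|V y - V x| <= e / N.
  by rewrite mulrC divfK//; exact: rP.
apply: le_trans (mollify_estimate eta0 d0 etaP sa a0 a1) _.
rewrite mulrAC mulrA ler_pdivrMr// [e * _]mulrC ler_wpM2r ?(ltW e0)//.
by rewrite /N lerDl.
Qed.

End weak_divergence.

(** * Arc length along the level curves *)

Lemma connected_locally_constant (T : topologicalType) (U : Type) (A : set T)
    (f : T -> U) (x y : T) : connected A ->
  (forall z, A z -> \forall w \near z, A w -> f w = f z) -> A x -> A y -> f y = f x.
Proof.
move=> cA lc Ax Ay; pose B := [set z | A z /\ f z = f x].
suff BA : B = A by have [] : B y by rewrite BA.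
apply: cA; first by exists x.
- exists (interior [set z | A z -> f z = f x]); first exact: open_interior.
  apply/seteqP; split=> z /=; last by move=> [Az /interior_subset /(_ Az)].
  move=> [Az fz]; split=> //; have := lc _ Az; rewrite /interior/=.
  by apply: filterS => w wf /wf ->.
- exists (~` interior [set z | A z -> f z <> f x]).
    by apply: open_closedC; exact: open_interior.
  apply/seteqP; split=> z /=.
    by move=> [Az fz]; split=> // /interior_subset /(_ Az).
  move=> [Az nz]; split=> //; apply: contrapT => fz; apply: nz.
  have := lc _ Az; rewrite /interior/=.
  by apply: filterS => w wf /wf ->.
Qed.

Section real_line.
Context {R : realType}.

(** Darboux's property, for a [df] that is not assumed continuous: by the mean value theorem [f] is
    injective, hence monotone, and monotonicity fixes the sign of the derivative. *)
Lemma is_derive_neq0_sign (f df : R -> R) (a b : R) :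
  (forall t, a < t < b -> is_derive t 1 f (df t)) ->
  (forall t, a < t < b -> df t != 0) ->
  forall s t, a < s < b -> a < t < b -> 0 < df s * df t.
Proof.
move=> fd df0.
have fdr t : t \in `]a, b[ -> derivable f t 1.
  by rewrite in_itv => /fd[].
have cf : {within [set` `]a, b[], continuous f}.
  by apply: derivable_within_continuous => t; exact: fdr.
have d1f t : a < t < b -> derive1 f t = df t.
  by move=> /fd h; rewrite derive1E; exact: derive_val.
have finj : {in `]a, b[ &, injective f}.
  suff lt_inj s t : a < s -> s < t -> t < b -> f s != f t.
    move=> s t; rewrite !in_itv/= => /andP[as_ sb] /andP[at_ tb] fst.
    have [st|ts|//] := ltgtP s t.
      by have := lt_inj _ _ as_ st tb; rewrite fst eqxx.
    by have := lt_inj _ _ at_ ts sb; rewrite fst eqxx.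
  move=> as_ st tb; rewrite eq_sym -subr_eq0.
  apply: (@differentiable_subr_neq0 _ f df s t st).
  - apply: derivable_within_continuous => r; rewrite in_itv/= => /andP[sr rt].
    by apply: fdr; rewrite in_itv/= (lt_le_trans as_ sr) (le_lt_trans rt tb).
  - move=> r; rewrite in_itv/= => /andP[sr rt].
    by apply: fd; rewrite (lt_trans as_ sr) (lt_trans rt tb).
  - move=> r; rewrite in_itv/= => /andP[sr rt].
    by apply: df0; rewrite (lt_trans as_ sr) (lt_trans rt tb).
move=> s t sab tab.
have [inc|dec] := itv_continuous_inj_mono cf finj.
- have pos r : a < r < b -> 0 < df r.
    move=> rab; rewrite lt_def df0//= -d1f//.
    apply: (@incr_derive1_ge0_itv _ f false true a b r).
    + by move=> z; rewrite inE => /= zab; exact: fdr.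
    + by move=> z w zI wI zw; rewrite inc.
    + by rewrite in_itv.
  by rewrite mulr_gt0 ?pos.
- have neg r : a < r < b -> df r < 0.
    move=> rab; rewrite lt_def eq_sym df0//= -d1f//.
    apply: (@decr_derive1_le0_itv _ f false true a b r).
    + by move=> z; rewrite inE => /= zab; exact: fdr.
    + by move=> z w zI wI zw; rewrite dec.
    + by rewrite in_itv.
  by rewrite nmulr_lgt0 ?neg.
Qed.

Lemma is_derive_lin_le (V W : normedModType R) (f : V -> W) (l : W -> R) (x v : V) (d : W) :
  (forall y z, l (y - z) = l y - l z) -> (forall (k : R) y, l (k *: y) = k * l y) ->
  (forall y, `|l y| <= `|y|) ->
  is_derive x v f d -> is_derive x v (l \o f) (l d).
Proof.
move=> lB lZ lle /is_derive_epsP fd; apply/is_derive_epsP => e /fd[r r0 rP].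
exists r => // t /rP; apply: le_trans.
by rewrite /= -lB -[t *: l d]/(t * l d) -lZ -lB; exact: lle.
Qed.

Definition coord (b : bool) (p : R * R) : R := if b then p.1 else p.2.

Lemma coordB b p q : coord b (p - q) = coord b p - coord b q.
Proof. by case: b. Qed.

Lemma coordZ b (k : R) p : coord b (k *: p) = k * coord b p.
Proof. by case: b. Qed.

Lemma coord_le b p : `|coord b p| <= `|p|.
Proof. by case: b; [exact: norm_fst|exact: norm_snd]. Qed.

Lemma coord_le_enorm b p : `|coord b p| <= enorm p.
Proof. by case: b; [exact: enorm_fst|exact: enorm_snd]. Qed.

Lemma norm_coord_le p (r : R) : (forall b, `|coord b p| <= r) -> `|p| <= r.
Proof. by move=> pr; rewrite norm_pair_le (pr true) (pr false). Qed.

Lemma is_derive_coord (V : normedModType R) (f : V -> R * R) b (x v : V) d :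
  is_derive x v f d -> is_derive x v (coord b \o f) (coord b d).
Proof.
by apply: is_derive_lin_le; [exact: coordB|exact: coordZ|exact: coord_le].
Qed.

Lemma is_derive_dirZ (V W : normedModType R) (f : V -> W) (x v : V) (d : W) (k : R) :
  is_derive x v f d -> is_derive x (k *: v) f (k *: d).
Proof.
move=> /is_derive_epsP fd; apply/is_derive_epsP => e e0.
have N0 : 0 < `|k| + 1 by rewrite ltr_wpDl.
have eN : 0 < e / (`|k| + 1) by rewrite divr_gt0.
have [r r0 rP] := fd _ eN; exists (r / (`|k| + 1)); first by rewrite divr_gt0.
move=> t tr; rewrite !scalerA.
have tk : `|t * k| <= `|t| * (`|k| + 1) by rewrite normrM ler_wpM2l// lerDl.
have := rP (t * k); rewrite (le_lt_trans tk) -?ltr_pdivlMr// => /(_ isT) h.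
apply: le_trans h _; rewrite mulrAC -mulrA ler_wpM2l ?(ltW e0)//.
by rewrite ler_pdivrMr.
Qed.

Section arc.
Variables (L : R) (g g' : R -> R * R).
Hypothesis gd : forall s : R, s \in `[0, L] ->
  (fun r => (r - s)^-1 *: (g r - g s)) @ within `[0, L] s^' --> g' s /\ enorm (g' s) = 1.

Lemma arc_epsP s : 0 <= s <= L -> forall e, 0 < e -> exists2 r, 0 < r &
  forall t, 0 <= t <= L -> `|t - s| < r -> `|g t - g s - (t - s) *: g' s| <= e * `|t - s|.
Proof.
move=> sI e e0; have sI' : s \in `[0, L] by rewrite in_itv.
have [+ _] := gd sI'.
move=> /cvgrPdist_le/(_ _ e0)/nbhs_ballP[r /= r0 rP]; exists r => // t tI tr.
have [->|ts] := eqVneq t s; first by rewrite !subrr scale0r subrr !normr0 mulr0.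
have ts0 : t - s != 0 by rewrite subr_eq0.
have := rP t _ ts; rewrite /ball /= distrC => /(_ tr).
rewrite /= in_itv/= => /(_ tI) H.
have -> : g t - g s - (t - s) *: g' s = - ((t - s) *: (g' s - (t - s)^-1 *: (g t - g s))).
  by rewrite scalerBr scalerA divff// scale1r opprB.
by rewrite normrN normrZ mulrC ler_wpM2r.
Qed.

Lemma arc_is_derive s : 0 < s < L -> is_derive s 1 g (g' s).
Proof.
move=> /andP[s0 sL]; apply/is_derive_epsP => e e0.
have sI : 0 <= s <= L by rewrite !ltW.
have [r r0 rP] := arc_epsP sI e0.
exists (Num.min r (Num.min s (L - s))) => [|t].
  by rewrite !lt_min r0 s0 subr_gt0.
rewrite !lt_min => /andP[tr /andP[ts tL]].
have tE : t *: 1 + s = t + s by rewrite /GRing.scale/= mulr1.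
have := rP (t + s); rewrite addrK tE; apply => //.
move: ts tL; rewrite !ltr_norml => /andP[h1 h2] /andP[h3 h4].
by apply/andP; split; lra.
Qed.

Lemma arc_coord_continuous b a c : 0 <= a -> c <= L ->
  {within `[a, c], continuous (coord b \o g)}.
Proof.
move=> a0 cL; apply/subspace_continuousP => s.
rewrite /= in_itv/= => /andP[as_ sc].
have sI : 0 <= s <= L by rewrite (le_trans a0 as_) (le_trans sc cL).
apply/cvgrPdist_le => e e0; have [r r0 rP] := arc_epsP sI ltr01.
have N0 : 0 < 1 + `|g' s| by rewrite ltr_pwDl.
apply/nbhs_ballP; exists (Num.min r (e / (1 + `|g' s|))) => /=.
  by rewrite lt_min r0 divr_gt0.
move=> t; rewrite /ball /= distrC lt_min => /andP[tr te].
rewrite in_itv/= => /andP[at_ tc].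
rewrite distrC -coordB (le_trans (coord_le _ _))//.
have tI : 0 <= t <= L by rewrite (le_trans a0 at_) (le_trans tc cL).
rewrite -(subrK ((t - s) *: g' s) (g t - g s)) (le_trans (ler_normD _ _))//.
apply: (@le_trans _ _ (1 * `|t - s| + `|t - s| * `|g' s|)).
  by rewrite lerD ?rP// normrZ.
by rewrite mul1r -[X in X + _]mulr1 -mulrDr -ler_pdivlMr// ltW.
Qed.

Lemma arc_coord_MVT b s t : 0 <= s -> s <= t -> t <= L -> exists2 c : R,
  s <= c <= t & coord b (g t) - coord b (g s) = coord b (g' c) * (t - s) /\ (s < t -> s < c < t).
Proof.
move=> s0; rewrite le_eqVlt => /orP[/eqP <- tL|st tL].
  by exists s; rewrite ?lexx// !subrr mulr0 ltxx.
have [c|/=|c cI cE] := @MVT R (coord b \o g) (coord b \o g') s t st.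
- rewrite in_itv/= => /andP[sc ct]; apply: is_derive_coord; apply: arc_is_derive.
  by rewrite (le_lt_trans s0 sc) (lt_le_trans ct tL).
- exact: arc_coord_continuous.
- rewrite in_itv/= in cI; exists c; last by split.
  by case/andP : cI => h1 h2; rewrite !ltW.
Qed.

Lemma arc_lip s t : 0 <= s <= L -> 0 <= t <= L -> `|g t - g s| <= `|t - s|.
Proof.
wlog st : s t / s <= t => [wl|].
  case/orP: (le_total s t) => [|ts h1 h2]; first exact: wl.
  by rewrite distrC [leRHS]distrC; exact: wl.
move=> /andP[s0 sL] /andP[t0 tL]; apply: norm_coord_le => b.
have [c /andP[sc ct] [E _]] := arc_coord_MVT b s0 st tL.
rewrite coordB E normrM -[leRHS]mul1r ler_wpM2r//.
have cI : c \in `[0, L] by rewrite in_itv/= (le_trans s0 sc) (le_trans ct tL).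
by rewrite (le_trans (coord_le_enorm _ _))// (gd cI).2.
Qed.

End arc.
End real_line.

(** * Level arcs in a local chart *)

Section level_arcs.
Context {R : realType}.
Variables (Omega : set (R * R)) (u : R * R -> R) (G : R).
Hypotheses (oO : open Omega) (uC1 : C1 Omega u).
Hypothesis gradG : forall x, Omega x -> enorm (grad u x) <= G.
Hypothesis grad_gt0 : forall x, Omega x -> 0 < enorm (grad u x).

Definition tangent (x : R * R) : R * R :=
  (enorm (grad u x))^-1 *: (- d2 u x, d1 u x).

Lemma enorm_tangent x : Omega x -> enorm (tangent x) = 1.
Proof.
move=> Ox; rewrite /tangent enormZ ger0_norm ?invr_ge0 ?enorm_ge0//.
have -> : enorm (- d2 u x, d1 u x) = enorm (grad u x).
  by rewrite /enorm /dot2 /grad /=; congr Num.sqrt; ring.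
by rewrite mulVf// gt_eqF// grad_gt0.
Qed.

Lemma tangent_orthogonal x v : Omega x -> enorm v = 1 -> dot2 (grad u x) v = 0 ->
  v = dot2 v (tangent x) *: tangent x /\ dot2 v (tangent x) ^+ 2 = 1.
Proof.
move=> Ox v1 gv; have := enorm_tangent Ox.
have n0 : enorm (grad u x) != 0 by rewrite gt_eqF// grad_gt0.
have n2 := sqr_enorm (grad u x); have t2 := sqr_enorm v.
move=> _; move: n0 n2 t2; rewrite v1 expr1n.
rewrite /tangent; set n := enorm _ => n0 n2 t2.
move: gv n2; rewrite /dot2 /grad /=; set a := d1 u x; set b := d2 u x => gv n2.
have n20 : n ^+ 2 != 0 by rewrite sqrf_eq0.
(* Here and in [k2] the two sides differ by a multiple of [dot2 (grad u x) v], which is 0. *)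
have k1 : v.1 * n ^+ 2 = (v.1 * - b + v.2 * a) * - b.
  rewrite n2; have : a * (a * v.1 + b * v.2) = 0 by rewrite gv mulr0.
  move=> h; apply/eqP; rewrite -subr_eq0 -h; apply/eqP; ring.
have k2 : v.2 * n ^+ 2 = (v.1 * - b + v.2 * a) * a.
  rewrite n2; have : b * (a * v.1 + b * v.2) = 0 by rewrite gv mulr0.
  move=> h; apply/eqP; rewrite -subr_eq0 -h; apply/eqP; ring.
split.
  rewrite [LHS]surjective_pairing; congr (_, _); rewrite /GRing.scale/= /GRing.scale/=.
    by apply: (mulIf n20); rewrite k1; field.
  by apply: (mulIf n20); rewrite k2; field.
rewrite /GRing.scale/= ?/GRing.scale/=; apply: (mulIf n20); rewrite mul1r.
have -> : (v.1 * (n^-1 * - b) + v.2 * (n^-1 * a)) ^+ 2 * n ^+ 2 = (v.1 * - b + v.2 * a) ^+ 2 by field.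
apply: (mulIf n20); rewrite -exprMn.
have : (v.1 * n ^+ 2) ^+ 2 + (v.2 * n ^+ 2) ^+ 2 = n ^+ 2 * n ^+ 2.
  by rewrite !exprMn -mulrDl -t2 mul1r expr2.
rewrite k1 k2 => h.
by rewrite exprMn -h n2; ring.
Qed.

Lemma tangent_continuous x : Omega x -> {for x, continuous tangent}.
Proof.
move=> Ox; have [_ _ c1 c2] := uC1 Ox.
have cg := continuous_grad c1 c2.
have cE : {for x, continuous (fun y => enorm (grad u y))}.
  exact: (continuous_comp (continuous_dot2 cg cg) (@sqrt_continuous R _)).
have cV : {for x, continuous (fun y => (enorm (grad u y))^-1)}.
  by apply: cvgV => //; rewrite gt_eqF// grad_gt0.
apply/continuous_fst_snd; split; last exact: (continuous_mulr_for cV c1).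
have cN : {for x, continuous (fun y => - d2 u y)} by exact: cvgN c2.
exact: (continuous_mulr_for cV cN).
Qed.

(* Near [x0] the level sets are graphs over the coordinate [b]. *)
Definition chart (x0 : R * R) (r : R) (b : bool) (e : R) := [/\ 0 < r, e ^+ 2 = 1,
  forall x, `|x - x0| < r -> Omega x /\ 1 / 2 <= e * coord b (tangent x) &
  forall p q, `|p - x0| < r -> `|q - x0| < r -> u p = u q ->
    coord b p = coord b q -> p = q].

(** A unit vector has a coordinate larger than 1/2 in absolute value, and continuity preserves this
    nearby. Up to sign and norm, that coordinate of the tangent is the derivative of [u] in the
    other variable, so [u] is injective where the coordinate [b] is fixed. *)
Lemma chart_exists x0 : Omega x0 -> exists r b e, chart x0 r b e.
Proof.
move=> Ox0.
have [b [e e2 eb]] : exists b, exists2 e, e ^+ 2 = 1 & 1 / 2 < e * coord b (tangent x0).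
  have t1 : coord true (tangent x0) ^+ 2 + coord false (tangent x0) ^+ 2 = 1.
    by rewrite /coord -sqr_enorm enorm_tangent// expr1n.
  set c := coord true _ in t1; set d := coord false _ in t1.
  have [c1|c1] := ltP (1 / 2) c; first by exists true, 1; [exact: expr1n|rewrite -/c; lra].
  have [c2|c2] := ltP c (- (1 / 2)).
    by exists true, (-1); [by rewrite sqrrN expr1n|rewrite -/c; lra].
  have [d1|d1] := ltP (1 / 2) d; first by exists false, 1; [exact: expr1n|rewrite -/d; lra].
  have [d2|d2] := ltP d (- (1 / 2)).
    by exists false, (-1); [by rewrite sqrrN expr1n|rewrite -/d; lra].
  by exfalso; nra.
have [r1 r10 r1P] := open_ball oO Ox0.
have ct := tangent_continuous Ox0.
pose eps := e * coord b (tangent x0) - 1 / 2.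
have eps0 : 0 < eps by rewrite subr_gt0.
have [r2 r20 r2P] := (continuous_plane _ _).1 ct _ eps0.
exists (Num.min r1 r2), b, e.
have ball1 x : `|x - x0| < Num.min r1 r2 -> Omega x.
  by rewrite lt_min => /andP[/r1P].
have ball2 x : `|x - x0| < Num.min r1 r2 -> 1 / 2 <= e * coord b (tangent x).
  rewrite lt_min => /andP[_ /r2P h].
  have e1 : `|e| = 1.
    by apply/eqP; rewrite -sqrp_eq1// real_normK ?num_real// e2.
  have : `|e * coord b (tangent x) - e * coord b (tangent x0)| < eps.
    rewrite -mulrBr -coordB normrM e1 mul1r.
    exact: le_lt_trans (coord_le _ _) h.
  by rewrite ltr_distl /eps => /andP[h1 h2]; lra.
split=> //.
- by rewrite lt_min r10.
- by move=> x xr; split; [exact: ball1|exact: ball2].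
- move=> p q pr qr upq bpq.
  have [q1 [q2 [q1r q2r]]] := plane_MVT (C1_partially_derivable uC1) ball1 pr qr.
  rewrite upq subrr => E.
  have t1 := ball2 _ q1r; have t2 := ball2 _ q2r.
  rewrite [p]surjective_pairing [q]surjective_pairing.
  move: bpq t1 t2 {ball2}; rewrite /coord; case: b {eb eps eps0 r2P} => bpq t1 t2.
    congr (_, _) => //; move: E; rewrite bpq subrr mulr0 add0r => /esym/eqP.
    rewrite mulf_eq0 subr_eq0 => /orP[/eqP d20|/eqP->//].
    by move: t2; rewrite /tangent /= d20 oppr0 scaler0 mulr0 => h; exfalso; lra.
  congr (_, _) => //; move: E; rewrite bpq subrr mulr0 addr0 => /esym/eqP.
  rewrite mulf_eq0 subr_eq0 => /orP[/eqP d10|/eqP->//].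
  by move: t1; rewrite /tangent /= d10 scaler0 mulr0 => h; exfalso; lra.
Qed.

Section one_arc.
Variables (L c : R) (g g' : R -> R * R).
Hypotheses (L0 : 0 < L) (g0 : ~ Omega (g 0)).
Hypothesis gd : forall s : R, s \in `[0, L] ->
  (fun r => (r - s)^-1 *: (g r - g s)) @ within `[0, L] s^' --> g' s /\ enorm (g' s) = 1.
Hypothesis g_inj : forall s t : R, 0 < s < L -> 0 < t < L -> g s = g t -> s = t.
Hypothesis g_in : forall s : R, 0 < s < L -> Omega (g s) /\ u (g s) = c.

(** Equal to 1 or -1: the direction of travel relative to the rotated gradient. *)
Definition arc_sign (s : R) := dot2 (g' s) (tangent (g s)).

Let gdI (s : R) : 0 < s < L -> is_derive s 1 g (g' s).
Proof. exact: (arc_is_derive gd). Qed.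

Lemma lip_near_u x : Omega x -> lip_near x u (2 * G).
Proof.
move=> Ox; apply: (partial_lip_near oO (C1_partially_derivable uC1) Ox) => y Oy.
by split; apply: le_trans (gradG Oy); [exact: (enorm_fst (grad u y))|exact: (enorm_snd (grad u y))].
Qed.

(** [u] is constant on the arc, so the unit vector [g' s] is orthogonal to the gradient, and the
    plane leaves two choices. *)
Lemma arc_tangent (s : R) : 0 < s < L ->
  g' s = arc_sign s *: tangent (g s) /\ arc_sign s ^+ 2 = 1.
Proof.
move=> sI; have [Os _] := g_in sI.
apply: tangent_orthogonal => //.
  have /gd[] // : s \in `[0, L].
  by move: sI => /andP[h1 h2]; rewrite in_itv/= !ltW.
have h := (is_derive_lip_curve (lip_near_u Os) (gdI sI) erefl _).1
  (C1_is_derive (g' s) oO uC1 Os).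
rewrite -(@derive_val _ _ _ _ _ _ _ h); apply: derive_val.
apply: (@near_eq_is_derive _ _ _ (cst c)).
have : \forall t \near s, t \in `]0, L[ by apply: near_in_itvoo; rewrite in_itv.
by apply: filterS => t; rewrite in_itv/= => /g_in[_ ->].
Qed.

Lemma arc_coord_derive b (s : R) : 0 < s < L ->
  is_derive s 1 (coord b \o g) (arc_sign s * coord b (tangent (g s))).
Proof.
by move=> sI; rewrite -coordZ -(arc_tangent sI).1; apply: is_derive_coord; exact: gdI.
Qed.

Lemma arc_sign_const (s t : R) : 0 < s < L -> 0 < t < L -> arc_sign t = arc_sign s.
Proof.
move=> sI tI.
have cA : connected [set` `]0, L[] by apply/connected_intervalP; exact: interval_is_interval.
apply: (connected_locally_constant cA); rewrite /= ?in_itv//.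
move=> {sI tI s t} s; rewrite in_itv/= => sI.
have [r [b [e [r0 e2 chartP _]]]] := chart_exists (g_in sI).1.
have /andP[s0 sL] := sI.
pose lo := Num.max 0 (s - r); pose hi := Num.min L (s + r).
have lohi t : lo < t < hi -> 0 < t < L /\ `|g t - g s| < r.
  rewrite gt_max lt_min => /andP[/andP[t0 tr] /andP[tL tr']]; rewrite t0 tL; split=> //.
  apply: (@le_lt_trans _ _ `|t - s|); last by rewrite ltr_distl tr.
  by apply: (arc_lip gd); rewrite !ltW// (ltW s0).
have sh : lo < s < hi by rewrite gt_max lt_min s0 sL gtrBl ltrDl r0.
have fd t : lo < t < hi -> is_derive t 1 (coord b \o g) (arc_sign t * coord b (tangent (g t))).
  by move=> /lohi[tI _]; exact: arc_coord_derive.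
have epos t : lo < t < hi -> 1 / 2 <= e * coord b (tangent (g t)).
  by move=> /lohi[_ /chartP[]].
have fd0 t : lo < t < hi -> arc_sign t * coord b (tangent (g t)) != 0.
  move=> th; have [tI _] := lohi _ th; rewrite mulf_eq0 negb_or -sqrf_eq0 (arc_tangent tI).2 oner_eq0/=.
  by apply: contraTneq (epos _ th) => ->; rewrite mulr0 -ltNge divr_gt0.
have near_s : \forall t \near s, t \in `]lo, hi[ by apply: near_in_itvoo; rewrite in_itv.
apply: filterS near_s => t; rewrite in_itv/= => th _.
have := is_derive_neq0_sign fd fd0 sh th.
have [tI _] := lohi _ th.
have /eqP := (arc_tangent tI).2; have /eqP := (arc_tangent sI).2.
have := epos _ th; have := epos _ sh; rewrite !sqrf_eq1.
set p := coord _ _; set q := coord _ _ => hp hq.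
have pq : 0 < p * q.
  have : 0 < (e * p) * (e * q) by rewrite mulr_gt0//; lra.
  by rewrite mulrACA -expr2 e2 mul1r.
move=> /orP[/eqP ->|/eqP ->] /orP[/eqP ->|/eqP ->]//; nra.
Qed.

(** As long as the arc stays in the chart, its coordinate [b] moves with speed at least 1/2. The
    point is to exclude that the arc leaves the chart and returns close to its first passage. *)
Lemma arc_chart x0 r b e (s t : R) : chart x0 r b e -> 0 < s < L -> 0 < t < L ->
  `|g s - x0| < r / 8 -> `|g t - x0| < r / 8 ->
  `|s - t| <= 2 * `|coord b (g s) - coord b (g t)|.
Proof.
move=> ch; wlog st : s t / s <= t => [wl|].
  case/orP: (le_total s t) => [|ts h1 h2 h3 h4]; first exact: wl.
  by rewrite distrC [X in _ * X]distrC; exact: wl.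
move=> sI tI gs gt.
have [r0 e2 chartP graph] := ch.
have /andP[s0 sL] := sI; have /andP[t0 tL] := tI.
pose rho := r / 2; have rho0 : 0 < rho by rewrite divr_gt0.
have in_ball z : 0 <= z <= L -> `|z - s| <= rho -> `|g z - x0| < r.
  move=> zI zs; rewrite -(subrKA (g s)) (le_lt_trans (ler_normD _ _))//.
  have sI' : 0 <= s <= L by rewrite !ltW.
  have := arc_lip gd sI' zI; rewrite /rho in zs => h; lra.
(* Otherwise the arc from 0 to [s] stays in the chart and [g 0] lies in [Omega]. *)
have rho_s : rho < s.
  rewrite ltNge; apply/negP => sr; apply: g0.
  have h : `|g 0 - x0| < r.
    by apply: in_ball; rewrite ?lexx ?(ltW L0)// sub0r normrN gtr0_norm.
  exact: (chartP _ h).1.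
pose S := arc_sign s.
have S2 : S ^+ 2 = 1 := (arc_tangent sI).2.
have growth a z : s - rho <= a -> a <= z -> z <= s + rho -> z <= t ->
    (z - a) / 2 <= e * S * (coord b (g z) - coord b (g a)).
  move=> sa az zs zt; have a0 : 0 < a by apply: lt_le_trans sa; rewrite subr_gt0.
  have zL : z < L by exact: le_lt_trans tL.
  have [c0 /andP[ac cz] [E _]] := arc_coord_MVT gd b (ltW a0) az (ltW zL).
  have cI : 0 < c0 < L by rewrite (lt_le_trans a0 ac) (le_lt_trans cz zL).
  rewrite E (arc_tangent cI).1 coordZ (arc_sign_const sI cI) -/S.
  have -> : e * S * (S * coord b (tangent (g c0)) * (z - a)) =
      S ^+ 2 * (e * coord b (tangent (g c0))) * (z - a) by ring.
  rewrite S2 mul1r mulrC -[_^-1]mul1r.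
  have /chartP[_ h] : `|g c0 - x0| < r.
    apply: in_ball; first by move: cI => /andP[h1 h2]; rewrite !ltW.
    by rewrite ler_distl; apply/andP; split; lra.
  by rewrite ler_wpM2r// subr_ge0.
have eS : `|e * S| = 1.
  by apply/eqP; rewrite -sqrp_eq1// real_normK ?num_real// exprMn e2 S2 mulr1.
have [ts|ts] := leP t (s + rho).
  have := growth s t; rewrite gerBl (ltW rho0) st ts lexx => /(_ isT isT isT isT) h.
  have := ler_norm (e * S * (coord b (g t) - coord b (g s))).
  rewrite normrM eS mul1r distrC => h'.
  by rewrite distrC ger0_norm ?subr_ge0//; lra.
(* If [t > s + rho], then over [[s - rho, s + rho]] the coordinate sweeps at least [rho / 2] to each
   side of [coord b (g s)], whereas [g t] is less than [rho / 2] away. So some [w] in that interval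
   has the coordinate of [g t]; the chart gives [g w = g t], and injectivity [w = t]. *)
exfalso.
pose a := s - rho; pose z := s + rho.
have az : a <= z by rewrite /a /z; lra.
have ga := growth a s; have gz := growth s z.
rewrite lexx gerBl (ltW rho0) lerDl (ltW rho0) st in ga.
rewrite gerBl (ltW rho0) lerDl (ltW rho0) lexx (ltW ts) in gz.
move: (ga isT isT isT isT) (gz isT isT isT isT) => {}ga {}gz.
have gst : `|coord b (g t) - coord b (g s)| < rho / 2.
  rewrite -coordB (le_lt_trans (coord_le _ _))//.
  rewrite -(subrKA x0) (le_lt_trans (ler_normD _ _))// /rho [X in _ + X]distrC.
  by lra.
have cont : {within `[a, z], continuous (coord b \o g)}.
  apply: (arc_coord_continuous gd); first by rewrite subr_ge0 ltW.
  by rewrite (le_trans (ltW ts))// ltW.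
have between : Num.min (coord b (g a)) (coord b (g z)) <= coord b (g t) <=
    Num.max (coord b (g a)) (coord b (g z)).
  have eS2 : (e * S) * (e * S) = 1 by rewrite -expr2 exprMn e2 S2 mulr1.
  move: ga gz gst; rewrite /a /z ltr_norml.
  have /eqP := eS2; rewrite -expr2 sqrf_eq1 => /orP[/eqP ->|/eqP ->];
    rewrite ?mul1r ?mulN1r => ga gz /andP[h1 h2].
    by rewrite ge_min le_max; apply/andP; split; apply/orP; [left|right]; lra.
  by rewrite ge_min le_max; apply/andP; split; apply/orP; [right|left]; lra.
have [w] := IVT az cont between; rewrite in_itv/= => /andP[aw wz] gw.
have wI : 0 < w < L.
  by rewrite (lt_le_trans _ aw) ?subr_gt0// (le_lt_trans wz)// (lt_trans ts).
have gwt : g w = g t.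
  apply: graph => //.
  - apply: in_ball; first by move: wI => /andP[h1 h2]; rewrite !ltW.
    by rewrite ler_distl; apply/andP; split.
  - by rewrite (lt_trans gt)// ltr_pdivrMr// ltr_pMr// ltr1n.
  - by rewrite (g_in wI).2 (g_in tI).2.
have wt := g_inj wI tI gwt.
by move: wz; rewrite wt leNgt => /negP.
Qed.

End one_arc.
End level_arcs.

(** * Uniqueness of the arc length parametrization *)

Section family.
Context {R : realType}.
Variables (Omega : set (R * R)) (u : R * R -> R) (G : R).
Hypotheses (oO : open Omega) (uC1 : C1 Omega u).
Hypothesis gradG : forall x, Omega x -> enorm (grad u x) <= G.
Hypothesis grad_gt0 : forall x, Omega x -> 0 < enorm (grad u x).

Definition level_arc (L c : R) (g g' : R -> R * R) :=
  [/\ 0 < L, ~ Omega (g 0),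
   forall s : R, s \in `[0, L] ->
    (fun r => (r - s)^-1 *: (g r - g s)) @ within `[0, L] s^' --> g' s /\ enorm (g' s) = 1,
   forall s t : R, 0 < s < L -> 0 < t < L -> g s = g t -> s = t &
   forall s : R, 0 < s < L -> Omega (g s) /\ u (g s) = c].

Section two_arcs.
Variables (L c S : R) (g1 g1' g2 g2' : R -> R * R).
Hypotheses (A1 : level_arc L c g1 g1') (A2 : level_arc L c g2 g2').
Hypothesis sub : forall s : R, 0 < s < L -> exists2 t : R, 0 < t < L & g2 t = g1 s.
Hypothesis S1 : forall s : R, 0 < s < L -> arc_sign u g1 g1' s = S.
Hypothesis S2 : forall s : R, 0 < s < L -> arc_sign u g2 g2' s = S.

(** The change of parameter [f] with [g2 (f s) = g1 s] has derivative 1, hence is a shift; a shift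
    of []0, L[] into itself is the identity. *)
Lemma level_arc_unique (s : R) : 0 < s < L -> g2 s = g1 s.
Proof.
have [L0 n1 gd1 inj1 in1] := A1; have [_ n2 gd2 inj2 in2] := A2.
pose f (s : R) := xget 0 [set t : R | 0 < t < L /\ g2 t = g1 s].
have fP t : 0 < t < L -> 0 < f t < L /\ g2 (f t) = g1 t.
  move=> /sub[z zI gz]; have : [set w : R | 0 < w < L /\ g2 w = g1 t] z by [].
  by move=> /(xgetI 0).
have fd t : 0 < t < L -> is_derive t 1 f 1.
  move=> tI; have [aI ga] := fP _ tI; set a := f t in aI ga.
  have [r [b [e ch]]] := chart_exists oO uC1 grad_gt0 (in1 _ tI).1.
  have [r0 e2 chP _] := ch.
  have d1 := arc_coord_derive oO uC1 gradG grad_gt0 gd1 in1 b tI.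
  have d2 := arc_coord_derive oO uC1 gradG grad_gt0 gd2 in2 b aI.
  rewrite (S1 tI) in d1; rewrite (S2 aI) ga in d2.
  set m := S * coord b (tangent u (g1 t)) in d1 d2.
  have m12 : 1 / 2 <= `|m|.
    have xx : `|g1 t - g1 t| < r by rewrite subrr normr0.
    have [_ h] := chP _ xx.
    have SS : `|S| = 1.
      apply/eqP; rewrite -sqrp_eq1// real_normK ?num_real// -(S1 tI).
      by rewrite (arc_tangent oO uC1 gradG grad_gt0 gd1 in1 tI).2.
    have ee : `|e| = 1.
      by apply/eqP; rewrite -sqrp_eq1// real_normK ?num_real// e2.
    by apply: le_trans h _; rewrite (le_trans (ler_norm _))// /m !normrM SS ee.
  apply/is_derive_epsP => eps eps0.
  (* The linearization errors of the two arcs, the second taken at an increment of size up to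
     [2 * |h|], add up to [eps / 2 * |h|]; dividing by [|m| >= 1 / 2] gives [eps * |h|]. *)
  have e60 : 0 < eps / 6 by rewrite divr_gt0.
  have [r1 r10 r1P] := (is_derive_epsP _ _ _ _).1 d1 _ e60.
  have [r2 r20 r2P] := (is_derive_epsP _ _ _ _).1 d2 _ e60.
  have /andP[t0 tL] := tI.
  pose q := Num.min (r / 8) (Num.min (Num.min t (L - t)) (Num.min r1 (r2 / 2))).
  have q0 : 0 < q by rewrite !lt_min !divr_gt0// t0 r10 subr_gt0 tL.
  exists q => // h; rewrite !lt_min => /andP[h1 /andP[/andP[h2 h3] /andP[h4 h5]]].
  have hE (w : R) : h *: 1 + w = h + w by rewrite /GRing.scale/= mulr1.
  have thI : 0 < h + t < L.
    move: h2 h3; rewrite !ltr_norml => /andP[? ?] /andP[? ?].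
    by apply/andP; split; lra.
  have [fI gf] := fP _ thI.
  have lip : `|f (h + t) - f t| <= 2 * `|h|.
    have near1 : `|g2 (f (h + t)) - g1 t| < r / 8.
      rewrite gf; apply: (le_lt_trans _ h1).
      have := arc_lip gd1 (s := t) (t := h + t); rewrite addrK; apply.
        by rewrite !ltW.
      by case/andP : thI => ? ?; rewrite !ltW.
    have near2 : `|g2 (f t) - g1 t| < r / 8 by rewrite ga subrr normr0 divr_gt0.
    have := arc_chart oO uC1 gradG grad_gt0 L0 n2 gd2 inj2 in2 ch fI aI near1 near2.
    move=> /le_trans; apply; rewrite ler_wpM2l// gf ga -coordB (le_trans (coord_le _ _))//.
    have := arc_lip gd1 (s := t) (t := h + t); rewrite addrK; apply.
      by rewrite !ltW.
    by case/andP : thI => ? ?; rewrite !ltW.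
  have E1 := r1P _ h4; rewrite hE in E1.
  have E2 : `|coord b (g2 (f (h + t))) - coord b (g2 a) - (f (h + t) - a) * m| <=
      eps / 6 * `|f (h + t) - a|.
    have := r2P (f (h + t) - a); rewrite {1 2}/GRing.scale/= mulr1 subrK; apply.
    by apply: le_lt_trans lip _; rewrite mulrC -ltr_pdivlMr.
  rewrite hE; rewrite gf ga /= in E2; rewrite /= in E1.
  set D := coord b (g1 (h + t)) - coord b (g1 t) in E1 E2.
  set k := f (h + t) - a in E2 lip *; rewrite -/k in lip.
  rewrite /GRing.scale/= mulr1.
  have E3 : `|m| * `|k - h| <= eps / 2 * `|h|.
    rewrite -normrM (_ : m * (k - h) = (D - h * m) - (D - k * m)); last by ring.
    rewrite (le_trans (ler_normB _ _))//.
    have := ler_wpM2l (ltW e60) lip; rewrite /GRing.scale/= in E1; lra.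
  have := normr_ge0 (k - h); have := normr_ge0 h; nra.
have fconst : forall s t : R, 0 < s -> s <= t -> t < L -> f t - t = f s - s.
  move=> s' t s0 st tL.
  have [||w _] := @MVT_segment _ (fun z => f z - z) (cst 0) _ _ st.
  - move=> z; rewrite in_itv/= => /andP[sz zt].
    have zI : 0 < z < L by rewrite (lt_trans s0 sz) (lt_trans zt tL).
    exact: is_derive_eq (is_deriveB (fd z zI) (is_derive_id z 1)) (subrr 1).
  - apply: derivable_within_continuous => z; rewrite in_itv/= => /andP[sz zt].
    have zI : 0 < z < L by rewrite (lt_le_trans s0 sz) (le_lt_trans zt tL).
    by have [] := is_deriveB (fd z zI) (is_derive_id z 1).
  - by rewrite mul0r => /eqP; rewrite subr_eq0 => /eqP.
have fconst2 z w : 0 < z < L -> 0 < w < L -> f w - w = f z - z.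
  move=> /andP[z0 zL] /andP[w0 wL]; case/orP: (le_total z w) => [zw|wz].
    exact: fconst.
  by apply/esym; exact: fconst.
move=> sI; suff fs : f s = s by have [_] := fP _ sI; rewrite fs.
have /andP[s0 sL] := sI.
apply/eqP; rewrite -subr_eq0; apply/eqP; set k := f s - s.
(* A nonzero shift pushes some parameter close to an end out of []0, L[]. *)
have [k0|k0|//] := ltgtP k 0.
- pose z := Num.min (- k) s / 2.
  have z0 : 0 < Num.min (- k) s by rewrite lt_min oppr_gt0 k0.
  have zk : Num.min (- k) s <= - k by rewrite ge_min lexx.
  have zs : Num.min (- k) s <= s by rewrite ge_min lexx orbT.
  have zI : 0 < z < L by rewrite /z; apply/andP; split; lra.
  have := fconst2 _ _ sI zI; rewrite -/k => E.
  have [/andP[+ _] _] := fP _ zI; move: E; rewrite /z => E h; exfalso; lra.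
- pose z := L - Num.min k (L - s) / 2.
  have z0 : 0 < Num.min k (L - s) by rewrite lt_min k0 subr_gt0.
  have zk : Num.min k (L - s) <= k by rewrite ge_min lexx.
  have zs : Num.min k (L - s) <= L - s by rewrite ge_min lexx orbT.
  have zI : 0 < z < L by rewrite /z; apply/andP; split; lra.
  have := fconst2 _ _ sI zI; rewrite -/k => E.
  have [/andP[_ +] _] := fP _ zI; move: E; rewrite /z => E h; exfalso; lra.
Qed.

End two_arcs.

End family.

(** * Arc length as a function on the domain *)

Section arclength_coordinate.
Context {R : realType}.
Variables (Omega : set (R * R)) (u : R * R -> R) (G : R).
Hypotheses (oO : open Omega) (conO : connected Omega) (uC1 : C1 Omega u).
Hypothesis gradG : forall x, Omega x -> enorm (grad u x) <= G.
Hypothesis grad_gt0 : forall x, Omega x -> 0 < enorm (grad u x).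

Let len x := curve_length (level_curve Omega u x).

Variables (LM K B : R) (ga ga' : R * R -> R -> R * R) (F : R * R -> R * R -> R -> R * R).
Hypothesis gaP : forall x, Omega x ->
  arclength_param Omega (level_curve Omega u x) (ga x) (ga' x).
Hypothesis lenLM : forall x, Omega x -> len x <= LM.
Hypotheses (K0 : 0 <= K) (B0 : 0 <= B).
Hypothesis gaK : forall x h (t s : R), Omega x -> enorm h = 1 ->
  t != 0 -> Omega (x + t *: h) ->
  s \in `[0, len x] -> s \in `[0, len (x + t *: h)] ->
  enorm (t^-1 *: (ga' (x + t *: h) s - ga' x s)) <= K.
Hypothesis FB : forall x h (s : R), Omega x -> enorm h = 1 ->
  s \in `[0, LM] -> enorm (F x h s) <= B.
Hypothesis gaF : forall x h (s : R), Omega x -> enorm h = 1 -> s \in `[0, len x] ->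
  (fun t => t^-1 *: (ga (x + t *: h) s - ga x s)) @
    within [set t | Omega (x + t *: h) /\ s \in `[0, len (x + t *: h)]] (0 : R)^'
  --> F x h s.

Lemma level_curve_arc x : Omega x -> level_arc Omega u (len x) (u x) (ga x) (ga' x).
Proof.
move=> Ox; have [L0 [_ nb] [inj im] d] := gaP Ox.
have inI (s : R) : 0 < s < len x -> s \in [set` `]0, len x[].
  by move=> sI; rewrite inE /= in_itv.
split => //.
- by move=> O0; apply: nb; exact: open_nbhs_nbhs.
- move=> s t sI tI; apply: inj; exact: inI.
- move=> s sI; have : level_curve Omega u x (ga x s).
    by rewrite -im; exists s => //; rewrite /= in_itv.
  by move=> /connected_component_sub.
Qed.

Let len_gt0 x : Omega x -> 0 < len x.
Proof. by move=> /level_curve_arc[]. Qed.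

(** The arc length from the chosen starting end to [x], which becomes [phi] in the stability
    estimate. The default 0 is never taken on [Omega]. *)
Definition arc_time x := xget 0 [set s : R | 0 < s < len x /\ ga x s = x].

Lemma arc_timeP x : Omega x -> 0 < arc_time x < len x /\ ga x (arc_time x) = x.
Proof.
move=> Ox; have [L0 _ [_ im] _] := gaP Ox.
have : level_curve Omega u x x by apply: connected_component_refl.
rewrite -im => -[s]; rewrite /= in_itv/= => sI gs.
have : [set s : R | 0 < s < len x /\ ga x s = x] s by [].
by move=> /(xgetI 0).
Qed.

(** The parameter 0 lies in the domain of every parametrization, so the restriction on [t] in
    condition (b) reduces to [Omega (x + t *: h)], which holds for small [t]. *)
Lemma base_is_derive x h : Omega x -> enorm h = 1 ->
  is_derive x h (fun y => ga y 0) (F x h 0).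
Proof.
move=> Ox h1; apply/is_derive_epsP => e e0.
have zI : (0 : R) \in `[0, len x] by rewrite in_itv/= lexx ltW ?len_gt0.
have := gaF Ox h1 zI; move=> /cvgrPdist_le/(_ _ e0)/nbhs_ballP[r /= r0 rP].
have [q q0 qP] := open_ball oO Ox.
have N0 : 0 < `|h| + 1 by rewrite ltr_wpDl.
exists (Num.min r (q / (`|h| + 1))); first by rewrite lt_min r0 divr_gt0.
move=> t; rewrite lt_min => /andP[tr]; rewrite ltr_pdivlMr// => tq.
have [->|t0] := eqVneq t 0.
  by rewrite scale0r add0r subrr scale0r subrr !normr0 mulr0.
have Oxt : Omega (x + t *: h).
  apply: qP; rewrite addrAC subrr add0r normrZ; apply: le_lt_trans tq.
  by rewrite ler_wpM2l// lerDl.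
have := rP t _ t0; rewrite /ball /= sub0r normrN => /(_ tr) H.
have {H} : `|F x h 0 - t^-1 *: (ga (x + t *: h) 0 - ga x 0)| <= e.
  by apply: H; split => //; rewrite in_itv/= lexx ltW ?len_gt0.
rewrite [t *: h + x]addrC => H.
have -> : ga (x + t *: h) 0 - ga x 0 - t *: F x h 0 =
    - (t *: (F x h 0 - t^-1 *: (ga (x + t *: h) 0 - ga x 0))).
  by rewrite scalerBr scalerA divff// scale1r opprB.
by rewrite normrN normrZ mulrC ler_wpM2r.
Qed.

Lemma base_lip x : Omega x -> lip_near x (fun y => ga y 0) (2 * B).
Proof.
move=> Ox.
have e1 : enorm ((1, 0) : R * R) = 1 by rewrite /enorm /dot2 /= mul1r mul0r addr0 sqrtr1.
have e2 : enorm ((0, 1) : R * R) = 1 by rewrite /enorm /dot2 /= mul1r mul0r add0r sqrtr1.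
have LM0 : (0 : R) \in `[0, LM].
  by rewrite in_itv/= lexx (le_trans _ (lenLM Ox))// ltW// len_gt0.
have c1 b y : Omega y -> is_derive y (1, 0) (coord b \o ga^~ 0) (coord b (F y (1, 0) 0)).
  by move=> Oy; apply: is_derive_coord; exact: base_is_derive.
have c2 b y : Omega y -> is_derive y (0, 1) (coord b \o ga^~ 0) (coord b (F y (0, 1) 0)).
  by move=> Oy; apply: is_derive_coord; exact: base_is_derive.
have lip b : lip_near x (coord b \o ga^~ 0) (2 * B).
  apply: (partial_lip_near oO _ Ox).
    by move=> y Oy; split; [have [] := c1 b y Oy|have [] := c2 b y Oy].
  move=> y Oy; rewrite /d1 /d2 (@derive_val _ _ _ _ _ _ _ (c1 b y Oy)).
  rewrite (@derive_val _ _ _ _ _ _ _ (c2 b y Oy)).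
  by split; apply: le_trans (coord_le_enorm _ _) _; apply: FB.
have [r1 r10 r1P] := lip true; have [r2 r20 r2P] := lip false.
exists (Num.min r1 r2); first by rewrite lt_min r10.
move=> y z; rewrite !lt_min => /andP[y1 y2] /andP[z1 z2].
by apply: norm_coord_le => -[]; rewrite coordB; [exact: r1P|exact: r2P].
Qed.

Lemma tangent_close x y (s : R) : Omega x -> Omega y -> 0 <= s <= len x -> s <= len y ->
  enorm (ga' y s - ga' x s) <= 2 * K * `|y - x|.
Proof.
move=> Ox Oy sx sy; have [->|xy] := eqVneq y x.
  by rewrite !subrr normr0 mulr0 /enorm /dot2 /= mulr0 addr0 sqrtr0.
pose t := enorm (y - x).
have t0 : 0 < t.
  rewrite lt_def enorm_ge0 andbT; apply: contra xy => /eqP /enorm_eq0 /eqP.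
  by rewrite subr_eq0.
pose h := t^-1 *: (y - x).
have h1 : enorm h = 1 by rewrite enormZ gtr0_norm ?invr_gt0// mulVf// gt_eqF.
have yE : x + t *: h = y by rewrite /h scalerA divff ?gt_eqF// scale1r addrC subrK.
have := @gaK x h t s Ox h1; rewrite yE !in_itv/= sx sy (andP sx).1 gt_eqF//.
move=> /(_ isT Oy isT isT); rewrite enormZ gtr0_norm ?invr_gt0// ler_pdivrMl// => H.
by apply: le_trans H _; rewrite mulrC -mulrA mulrCA ler_wpM2l// enorm_le_norm.
Qed.

(** The gap at [s] is at most the gap between the starting points plus the accumulated difference of
    velocities, which condition (a) bounds on a parameter interval of length at most [LM]. *)
Lemma arc_close x y (s : R) : Omega x -> Omega y -> 0 <= s <= len x -> s <= len y ->
  `|ga y s - ga x s| <= `|ga y 0 - ga x 0| + LM * (2 * K * `|y - x|).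
Proof.
move=> Ox Oy /andP[s0 sx] sy; apply: norm_coord_le => b.
have [L0 _ dx _ _] := level_curve_arc Ox; have [M0 _ dy _ _] := level_curve_arc Oy.
pose D (z : R) := coord b (ga y z) - coord b (ga x z).
have [w||w wI E] := @MVT_segment _ D (fun z => coord b (ga' y z) - coord b (ga' x z)) 0 s s0.
- rewrite in_itv/= => /andP[w0 ws].
  have wx : 0 < w < len x by rewrite w0 (lt_le_trans ws sx).
  have wy : 0 < w < len y by rewrite w0 (lt_le_trans ws sy).
  apply: (@is_deriveB _ _ _ (coord b \o ga y) (coord b \o ga x)); apply: is_derive_coord.
    exact: (arc_is_derive dy wy).
  exact: (arc_is_derive dx wx).
- have cx := arc_coord_continuous dx (b := b) (lexx 0) sx.
  have cy := arc_coord_continuous dy (b := b) (lexx 0) sy.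
  by move=> z; apply: cvgB; [exact: cy|exact: cx].
- rewrite coordB -/(D s) -(subrK (D 0) (D s)) E addrC (le_trans (ler_normD _ _))//.
  rewrite in_itv/= in wI; have /andP[w0 ws] := wI.
  rewrite subr0 normrM lerD//; first by rewrite /D -coordB coord_le.
  rewrite mulrC ler_pM//.
    by rewrite ger0_norm// (le_trans sx)// lenLM.
  rewrite -coordB (le_trans (coord_le_enorm _ _))// tangent_close//.
    by rewrite w0 (le_trans ws sx).
  exact: le_trans ws sy.
Qed.

(** Records which end of the level curve through [x] was chosen as its start. *)
Definition orientation x := arc_sign u (ga x) (ga' x) (arc_time x).

Lemma orientationP x (s : R) : Omega x -> 0 < s < len x ->
  [/\ arc_sign u (ga x) (ga' x) s = orientation x, orientation x ^+ 2 = 1 &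
      ga' x s = orientation x *: tangent u (ga x s)].
Proof.
move=> Ox sI; have [L0 n0 d inj inn] := level_curve_arc Ox.
have [tI _] := arc_timeP Ox.
have sE : arc_sign u (ga x) (ga' x) s = orientation x.
  exact: (arc_sign_const oO uC1 gradG grad_gt0 d inn tI sI).
have [h1 h2] := arc_tangent oO uC1 gradG grad_gt0 d inn sI.
by split => //; rewrite -sE.
Qed.

Let Cphi := 2 * B + LM * (2 * K).

(** If [s = arc_time x <= arc_time y], the curve of [y] is defined at [s] too, and [arc_close] puts
    it within [Cphi * |y - x|] of [x] there. As it passes through [y] at [arc_time y], [arc_chart]
    on this single curve compares the two times. *)
Lemma arc_time_local x0 : Omega x0 -> exists2 r, 0 < r &
  forall x y, `|x - x0| < r -> `|y - x0| < r -> arc_time x <= arc_time y ->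
    `|arc_time x - arc_time y| <= 2 * (1 + Cphi) * `|x - y| /\
    orientation x = orientation y.
Proof.
move=> Ox0; have [r [b [e ch]]] := chart_exists oO uC1 grad_gt0 Ox0.
have [r0 e2 chP _] := ch; have [q q0 qP] := base_lip Ox0.
have LM0 : 0 <= LM by rewrite (le_trans _ (lenLM Ox0))// ltW// len_gt0.
have Cphi0 : 0 <= Cphi by rewrite addr_ge0// !mulr_ge0.
(* Dividing the radius by [N] keeps [ga y s] within [r / 8] of [x0]; [N'] ensures
   [2 * K * |y - x| < 1]. *)
pose N := 1 + 2 * Cphi; have N0 : 0 < N by rewrite ltr_wpDr// mulr_ge0.
pose N' := 4 * K + 2; have N'0 : 0 < N' by rewrite ltr_wpDl// mulr_ge0.
exists (Num.min q (Num.min (r / 8 / N) N'^-1)).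
  by rewrite !lt_min q0 invr_gt0 N'0 !divr_gt0.
move=> x y; rewrite !lt_min => /andP[xq /andP[xr xK]] /andP[yq /andP[yr yK]] xy.
have near8 z : `|z - x0| < r / 8 / N -> `|z - x0| < r / 8.
  move=> h; apply: (lt_le_trans h); rewrite ler_pdivrMr// ler_peMr ?divr_ge0 ?(ltW r0)//.
  by rewrite lerDl mulr_ge0.
have lt8 (z : R) : z < r / 8 -> z < r.
  by move=> h; apply: (lt_trans h); rewrite ltr_pdivrMr// ltr_pMr// ltr1n.
have Ox : Omega x by apply: (chP _ (lt8 _ (near8 _ xr))).1.
have Oy : Omega y by apply: (chP _ (lt8 _ (near8 _ yr))).1.
have [sI gs] := arc_timeP Ox; have [tI gt] := arc_timeP Oy.
set s := arc_time x in xy sI gs *; set t := arc_time y in xy tI gt *.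
have /andP[s0 sx] := sI; have /andP[t0 ty] := tI.
have sy : s < len y by exact: le_lt_trans ty.
have sI' : 0 <= s <= len x by rewrite !ltW.
have close : `|ga y s - x| <= Cphi * `|y - x|.
  have h := arc_close Ox Oy sI' (ltW sy); rewrite gs in h.
  rewrite (le_trans h)// /Cphi [leRHS]mulrDl; apply: lerD.
    exact: qP.
  by rewrite !mulrA.
have xyN : `|y - x| < 2 * (r / 8 / N).
  rewrite -(subrKA x0) (le_lt_trans (ler_normD _ _))// mulrDl mul1r ltrD//.
  by rewrite distrC.
have gs8 : `|ga y s - x0| < r / 8.
  rewrite -(subrKA x) (le_lt_trans (ler_normD _ _))//.
  apply: (@le_lt_trans _ _ (Cphi * (2 * (r / 8 / N)) + `|x - x0|)).
    by rewrite lerD2r (le_trans close)// ler_wpM2l// ltW.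
  rewrite [ltRHS](_ : _ = Cphi * (2 * (r / 8 / N)) + r / 8 / N).
    by rewrite ltrD2l.
  by rewrite /N; field; rewrite gt_eqF.
have gt8 : `|ga y t - x0| < r / 8 by rewrite gt; exact: near8.
have [M0 n0 d inj inn] := level_curve_arc Oy.
have sIy : 0 < s < len y by rewrite s0.
split.
  apply: (le_trans (arc_chart oO uC1 gradG grad_gt0 M0 n0 d inj inn ch sIy tI gs8 gt8)).
  rewrite -mulrA ler_wpM2l// -coordB (le_trans (coord_le _ _))// gt.
  rewrite -(subrKA x) (le_trans (ler_normD _ _))// addrC mulrDl mul1r lerD2l.
  by rewrite [`|x - y|]distrC.
have [_ ox2 ox] := orientationP Ox sI; have [_ oy2 oy] := orientationP Oy sIy.
rewrite gs in ox.
have := tangent_close Ox Oy sI' (ltW sy).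
rewrite ox oy => H.
have := le_trans (coord_le_enorm b _) H; rewrite coordB (coordZ b (orientation y)) (coordZ b (orientation x)) => {}H.
have tx := (chP _ (lt8 _ (near8 _ xr))).2; have ty' := (chP _ (lt8 _ gs8)).2.
(* Opposite orientations would separate the coordinates [b] of the two velocities at [s] by at least
   1, more than condition (a) permits at this distance. *)
have KK : 2 * K * `|y - x| < 1.
  have yx : `|y - x| < 2 * N'^-1.
    rewrite -(subrKA x0) (le_lt_trans (ler_normD _ _))// mulrDl mul1r ltrD//.
    by rewrite distrC.
  apply: (@le_lt_trans _ _ (2 * K * (2 * N'^-1))).
    by rewrite ler_wpM2l ?mulr_ge0// ltW.
  rewrite mulrA ltr_pdivrMr// mul1r /N'; lra.
have ee : `|e| = 1.
  by apply/eqP; rewrite -sqrp_eq1// real_normK ?num_real// e2.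
move: ox2 oy2 => /eqP + /eqP; rewrite !sqrf_eq1.
set p := coord b (tangent u (ga y s)) in H ty'; set w := coord b (tangent u x) in H tx.
have big : 1 <= `|p + w|.
  have h : 1 <= e * p + e * w by lra.
  apply: (le_trans h); rewrite -mulrDr (le_trans (ler_norm _))//.
  by rewrite normrM ee mul1r.
move=> /orP[/eqP o1|/eqP o1] /orP[/eqP o2|/eqP o2]; rewrite o1 o2// in H *.
- by exfalso; move: H; rewrite mulN1r mul1r -opprD normrN; lra.
- by exfalso; move: H; rewrite mulN1r mul1r opprK; lra.
Qed.

Lemma arc_time_lip x : Omega x -> lip_near x arc_time (2 * (1 + Cphi)).
Proof.
move=> /arc_time_local[r r0 rP]; exists r => // y z yr zr.
case/orP: (le_total (arc_time y) (arc_time z)) => h.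
  exact: (rP _ _ yr zr h).1.
by rewrite distrC [in leRHS]distrC; exact: (rP _ _ zr yr h).1.
Qed.

Lemma orientation_near x : Omega x -> exists2 r, 0 < r &
  forall y, `|y - x| < r -> orientation y = orientation x.
Proof.
move=> /arc_time_local[r r0 rP]; exists r => // y yr.
have xx : `|x - x| < r by rewrite subrr normr0.
case/orP: (le_total (arc_time y) (arc_time x)) => h.
  exact: (rP _ _ yr xx h).2.
by apply/esym; exact: (rP _ _ xx yr h).2.
Qed.

Lemma orientation_const x y : Omega x -> Omega y -> orientation y = orientation x.
Proof.
move=> Ox Oy; apply: (connected_locally_constant conO) => // z /orientation_near[r r0 rP].
by apply/near_ball; exists r => // w wr _; exact: rP.
Qed.

(** For [y] on the curve of [x] and close to it, [ga y] runs through the same curve with the same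
    orientation, so it equals [ga x] by [level_arc_unique]. Hence [arc_time] inverts [ga x] near
    [s], and [is_derive_lip_curve] moves the derivative 1 from the curve to its tangent. *)
Lemma arc_time_is_derive x : Omega x -> is_derive x (tangent u x) arc_time (orientation x).
Proof.
move=> Ox; have [sI gs] := arc_timeP Ox; have [L0 n0 d inj inn] := level_curve_arc Ox.
set s := arc_time x in sI gs.
have [_ o2 ox] := orientationP Ox sI; rewrite gs in ox.
have [r r0 rP] := orientation_near Ox.
have /andP[s0 sL] := sI.
have gd := arc_is_derive d sI.
have id_near : \forall t \near s, id t = (arc_time \o ga x) t.
  have : \forall t \near s, t \in `]Num.max 0 (s - r), Num.min (len x) (s + r)[.
    by apply: near_in_itvoo; rewrite in_itv/= gt_max lt_min s0 sL gtrBl ltrDl r0.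
  apply: filterS => t; rewrite in_itv/= gt_max lt_min.
  move=> /andP[/andP[t0 tr1] /andP[tL tr2]] /=.
  have tI : 0 < t < len x by rewrite t0.
  have gtr : `|ga x t - x| < r.
    rewrite -{2}gs; apply: (@le_lt_trans _ _ `|t - s|); last by rewrite ltr_distl tr1.
    by apply: (arc_lip d); rewrite !ltW.
  set y := ga x t in gtr *.
  have [Oy uy] := inn _ tI; rewrite -/y in Oy uy.
  have curveE : level_curve Omega u y = level_curve Omega u x.
    rewrite /level_curve uy; apply/esym/same_connected_component.
    have [_ _ [_ im] _] := gaP Ox; rewrite -/(level_curve Omega u x) -im.
    by exists t => //; rewrite /= in_itv.
  have lenE : len y = len x by rewrite /len curveE.
  have Ay := level_curve_arc Oy; rewrite lenE uy in Ay.
  have [_ _ _ injy _] := Ay.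
  have sub (z : R) : 0 < z < len x -> exists2 w : R, 0 < w < len x & ga y w = ga x z.
    move=> zI; have : level_curve Omega u x (ga x z).
      have [_ _ [_ im] _] := gaP Ox; rewrite -im.
      by exists z => //; rewrite /= in_itv.
    rewrite -curveE; have [_ _ [_ im] _] := gaP Oy; rewrite -im => -[w].
    by rewrite /= in_itv/= -/(len y) lenE => wI <-; exists w.
  have S1 (z : R) : 0 < z < len x -> arc_sign u (ga x) (ga' x) z = orientation x.
    by move=> zI; have [] := orientationP Ox zI.
  have S2 (z : R) : 0 < z < len x -> arc_sign u (ga y) (ga' y) z = orientation x.
    by rewrite -lenE => zI; have [->] := orientationP Oy zI; rewrite rP.
  have E := level_arc_unique oO uC1 gradG grad_gt0 (level_curve_arc Ox) Ay sub S1 S2 tI.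
  have [yI gy] := arc_timeP Oy; rewrite lenE in yI.
  by apply: injy => //; rewrite E gy.
have d1 : is_derive s 1 (arc_time \o ga x) (1 : R).
  exact: (@near_eq_is_derive _ _ _ (@id R) _ _ _ _ id_near (is_derive_id (s : R) (1 : R))).
have d2 := (is_derive_lip_curve (arc_time_lip Ox) gd gs 1).2 d1.
have := is_derive_dirZ (orientation x) d2.
by rewrite ox scalerA -expr2 o2 scale1r /GRing.scale/= mulr1.
Qed.

Lemma arclength_coordinate_exists : exists (phi : R * R -> R) (S C : R),
  [/\ S ^+ 2 = 1, 0 <= C, forall x, Omega x -> 0 <= phi x <= LM,
     forall x, Omega x -> lip_near x phi C &
     forall x, Omega x -> is_derive x (tangent u x) phi S].
Proof.
have [[x0 Ox0]|nO] := pselect (exists x, Omega x); last first.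
  exists (fun=> 0), 1, 0; split; rewrite ?expr1n// => x Ox; exfalso; apply: nO; by exists x.
have LM0 : 0 <= LM by rewrite (le_trans _ (lenLM Ox0))// ltW// len_gt0.
exists arc_time, (orientation x0), (2 * (1 + Cphi)); split.
- by have [sI _] := arc_timeP Ox0; have [] := orientationP Ox0 sI.
- by rewrite mulr_ge0// addr_ge0// addr_ge0// !mulr_ge0.
- move=> x Ox; have [/andP[s0 sL] _] := arc_timeP Ox.
  by rewrite (ltW s0) (le_trans (ltW sL))// lenLM.
- exact: arc_time_lip.
- by move=> x Ox; rewrite -(orientation_const Ox0 Ox); exact: arc_time_is_derive.
Qed.

End arclength_coordinate.

(** * Smoothness up to the boundary *)

Section closure_smoothness.
Context {R : realType}.
Implicit Types (Omega : set (R * R)) (f g : R * R -> R).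

Lemma extends_continuously_interior Omega g x : open Omega ->
  extends_continuously Omega g -> Omega x -> {for x, continuous g}.
Proof.
move=> oO [g' [cg' gE]] Ox; apply/continuous_plane => e e0.
have [r r0 rP] := open_ball oO Ox.
have gg y : Omega y -> g y = g' y by move=> Oy; apply: gE; rewrite inE.
have : {within Omega, continuous g'} by exact: continuous_subspaceW (@subset_closure _ _) cg'.
rewrite continuous_open_subspace// => /(_ x); rewrite inE => /(_ Ox).
move=> /(continuous_plane g' x).1 /(_ _ e0)[q q0 qP].
exists (Num.min r q); first by rewrite lt_min r0.
by move=> y; rewrite lt_min => /andP[/rP Oy /qP]; rewrite !gg.
Qed.

Lemma Ck_closure_continuous k Omega f x : open Omega -> Ck_closure k Omega f ->
  Omega x -> {for x, continuous f}.
Proof. by case: k => [|k] oO [fe _]; exact: extends_continuously_interior. Qed.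

Lemma Ck_closure_partial k Omega f : Ck_closure k.+1 Omega f ->
  Ck_closure k Omega (d1 f) /\ Ck_closure k Omega (d2 f).
Proof. by case=> _ [_ h1 h2]; split; [exact: h1|exact: h2]. Qed.

Lemma Ck_closure_C1 k Omega f : open Omega -> Ck_closure k.+1 Omega f -> C1 Omega f.
Proof.
move=> oO [_ [df f1 f2]] x Ox; have [h1 h2] := df _ Ox.
split; [exact: h1|exact: h2| |].
  exact: Ck_closure_continuous f1 Ox.
exact: Ck_closure_continuous f2 Ox.
Qed.

(** [C1] speaks only of the partial derivatives; their local boundedness makes [g] Lipschitz near
    [x]. *)
Lemma C1_continuous Omega g x : open Omega -> C1 Omega g -> Omega x ->
  {for x, continuous g}.
Proof.
move=> oO gC1 Ox; have [r r0 rP] := open_ball oO Ox.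
have [_ _ c1 c2] := gC1 _ Ox.
have [r1 r10 r1P] := (continuous_plane _ _).1 c1 _ ltr01.
have [r2 r20 r2P] := (continuous_plane _ _).1 c2 _ ltr01.
pose C : R := `|d1 g x| + `|d2 g x| + 1.
pose q : R := Num.min r (Num.min r1 r2).
pose B := [set y : R * R | `|y - x| < q].
have oB : open B.
  apply: (@open_comp _ _ (fun y : R * R => `|y - x|) [set t | t < q]); last exact: open_lt.
  by move=> y _; apply: cvg_norm; apply: cvgB; [exact: cvg_id|exact: cvg_cst].
have BP y : B y -> [/\ Omega y, `|y - x| < r1 & `|y - x| < r2].
  by rewrite /B /= !lt_min => /and3P[/rP ? ? ?].
have close (f : R * R -> R) y : `|f y - f x| < 1 -> `|f y| <= `|f x| + 1.
  move=> fy; rewrite -{1}(subrK (f x) (f y)) addrC.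
  by apply: le_trans (ler_normD _ _) _; rewrite lerD2l ltW.
have Bx : B x by rewrite /B /= subrr normr0 !lt_min r0 r10.
have pB : partially_derivable B g.
  by move=> y /BP[/gC1[h1 h2 _ _] _ _]; split; [exact: h1|exact: h2].
apply: (@lip_near_continuous _ _ _ _ (2 * C)).
apply: (partial_lip_near oB pB Bx) => y /BP[_ /r1P/close h1 /r2P/close h2].
split; [apply: le_trans h1 _|apply: le_trans h2 _]; rewrite /C lerD2r.
  by rewrite lerDl.
by rewrite lerDr.
Qed.

End closure_smoothness.

(** * Integration by parts and the rotated gradient *)

Section line_integrals.
Context {R : realType}.
Local Notation mu1 := (@lebesgue_measure R).
Local Notation mu2 := (@lebesgue2 R).
Local Notation plane := (measurableTypeR R * measurableTypeR R)%type.

Lemma integral_derive_compact_support (f df : R -> R) (r : R) : 0 <= r ->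
  (forall t : R, is_derive t 1 f (df t)) -> continuous df ->
  (forall t, r < `|t| -> f t = 0 /\ df t = 0) ->
  (\int[mu1]_t (df t)%:E)%E = 0%E.
Proof.
move=> r0 fd cd f0.
have -> : (\int[mu1]_t (df t)%:E)%E = (\int[mu1]_(t in `[(- (r + 1))%R, (r + 1)%R]) (df t)%:E)%E.
  rewrite [RHS]integral_mkcond; apply: eq_integral => t _; rewrite patchE.
  case: ifPn => // /negP; rewrite inE /= in_itv/= -ler_norml => /negP; rewrite -ltNge => tr.
  by rewrite (f0 t _).2// (lt_trans _ tr)// ltrDl.
have cf : continuous f.
  move=> t; apply: differentiable_continuous; apply/derivable1_diffP.
  exact: ex_derive.
have r1 : r < r + 1 by rewrite ltrDl.
have r10 : 0 <= r + 1 by rewrite addr_ge0.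
rewrite (@continuous_FTC2 _ df f).
- by rewrite (f0 (r + 1) _).1 ?(f0 (- (r + 1)) _).1 ?subee// ?normrN ger0_norm.
- by lra.
- exact: continuous_subspaceT.
- split=> [t _||]; first exact: ex_derive.
    by apply: cvg_at_right_filter; exact: cf.
  by apply: cvg_at_left_filter; exact: cf.
- by move=> t _; rewrite derive1E; apply: derive_val.
Qed.

Variables (F : R * R -> R) (r : R).
Hypotheses (r0 : 0 <= r) (F0 : forall x : R * R, r < `|x| -> F x = 0).

Let off_square_derive (v x : R * R) : r < `|x| -> 'D_v F x = 0.
Proof.
move=> rx; apply: derive_val; apply: (@near_eq_is_derive _ _ _ (cst 0)).
  apply/near_ball; exists (`|x| - r); first by rewrite subr_gt0.
  move=> y; rewrite ltrBrDl -ltrBrDr => h; apply/esym/F0.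
  apply: lt_le_trans h _; rewrite distrC lerBlDr.
  by rewrite -{1}(subrK y x) addrC ler_normD.
Qed.

Lemma integrable_compact_support (G : R * R -> R) : continuous G ->
  (forall x : R * R, r < `|x| -> G x = 0) -> mu2.-integrable setT (EFin \o (G : plane -> R)).
Proof.
move=> cG G0; pose S := [set x : R * R | `|x| <= r].
have cS : closed S.
  apply: (@preimage_closed _ _ (fun z : R * R => `|z|) [set t | t <= r]).
    by move=> x _; exact: norm_continuous.
  exact: closed_le.
have bS : bounded_set S.
  by exists r; split; [exact: num_real|move=> s rs z /= zr; rewrite (le_trans zr)// ltW].
have [C CP] := continuous_compact_bounded (compact_closed_bounded cS bS) (fun x _ => cG x).
have mS := measurable_closed_plane cS.
apply: (@integrable_bounded_support _ _ _ mu2 S _ `|C|) => //.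
- exact: bounded_set_lebesgue2.
- by apply: measurable_fun_continuous; [exact: openT|move=> x _; exact: cG].
- move=> x; have [xr|xr] := leP `|x| r; last by rewrite G0// normr0.
  by rewrite (le_trans (CP _ xr))// ler_norm.
- by move=> x /negP; rewrite -ltNge => /G0.
Qed.

Lemma Rintegral_d1_compact_support : (forall x, derivable F x (1, 0)) ->
  continuous (d1 F) -> \int[mu2]_x d1 F x = 0.
Proof.
move=> dF cF.
have iF := integrable_compact_support cF (fun x => @off_square_derive (1, 0) x).
rewrite /Rintegral /lebesgue2 -(integral21_prod_meas1 iF) /fubini_G.
rewrite (eq_integral (cst 0%E)) ?integral0// => y _.
apply: (@integral_derive_compact_support (fun t => F (t, y)) _ r) => //.
- by move=> t; apply: (is_derive_d1 F (t, y) _).1; apply: derivableP.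
- move=> t; apply: (continuous_comp (f := fun t => (t, y)) (g := d1 F)); last exact: cF.
  exact: (cvg_pair (@cvg_id _ _) (@cvg_cst _ y _ (nbhs t) _)).
- move=> t rt; have rt' : r < `|(t, y)| by rewrite (lt_le_trans rt)// (norm_fst (t, y)).
  by split; [exact: F0|exact: off_square_derive].
Qed.

Lemma Rintegral_d2_compact_support : (forall x, derivable F x (0, 1)) ->
  continuous (d2 F) -> \int[mu2]_x d2 F x = 0.
Proof.
move=> dF cF.
have iF := integrable_compact_support cF (fun x => @off_square_derive (0, 1) x).
rewrite /Rintegral /lebesgue2 -(integral12_prod_meas1 iF) /fubini_F.
rewrite (eq_integral (cst 0%E)) ?integral0// => y _.
apply: (@integral_derive_compact_support (fun t => F (y, t)) _ r) => //.
- by move=> t; apply: (is_derive_d2 F (y, t) _).1; apply: derivableP.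
- move=> t; apply: (continuous_comp (f := fun t => (y, t)) (g := d2 F)); last exact: cF.
  exact: (cvg_pair (@cvg_cst _ y _ (nbhs t) _) (@cvg_id _ _)).
- move=> t rt; have rt' : r < `|(y, t)| by rewrite (lt_le_trans rt)// (norm_snd (y, t)).
  by split; [exact: F0|exact: off_square_derive].
Qed.

End line_integrals.

Section perp_gradient.
Context {R : realType}.
Local Notation mu2 := (@lebesgue2 R).
Local Notation plane := (measurableTypeR R * measurableTypeR R)%type.
Variables (Omega : set (R * R)) (u : R * R -> R).
Hypotheses (oO : open Omega) (bO : bounded_set Omega) (uC1 : C1 Omega u).

Section product.
Variables (K : set (R * R)) (p : R * R -> R).
Hypotheses (cK : closed K) (KO : K `<=` Omega) (pC1 : C1 setT p).
Hypothesis p0 : forall x, ~ K x -> p x = 0.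

Let off x : ~ K x -> \forall y \near x, ~ K y.
Proof.
have oK : open (~` K) by exact: closed_openC.
by move=> nKx; apply: open_nbhs_nbhs; split.
Qed.

Let derive_p0 v x : ~ K x -> is_derive x v p 0.
Proof.
move=> /off nK; apply: (@near_eq_is_derive _ _ _ (cst 0)).
by apply: filterS nK => y /p0 ->.
Qed.

(** [u] is arbitrary outside [Omega], but off [K] the product vanishes locally, so the product rule
    holds on the whole plane. *)
Lemma is_derive_cutoff_mul v x : (Omega x -> derivable u x v) -> derivable p x v ->
  is_derive x v (fun x => u x * p x) ('D_v u x * p x + u x * 'D_v p x).
Proof.
move=> du dp; have [Kx|nKx] := pselect (K x).
  have := is_deriveM (derivableP (du (KO Kx))) (derivableP dp).
  by rewrite addrC /GRing.scale/= [p x * _]mulrC.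
have E : 'D_v p x = 0 := @derive_val _ _ _ _ _ _ _ (derive_p0 v nKx).
rewrite E (p0 nKx) !mulr0 addr0.
apply: (@near_eq_is_derive _ _ _ (cst 0)).
by apply: filterS (off nKx) => y /p0 ->; rewrite mulr0.
Qed.

Let continuous_cutoff_mul (f q : R * R -> R) : (forall x, Omega x -> {for x, continuous f}) ->
  continuous q -> (forall x, ~ K x -> q x = 0) -> continuous (fun x => f x * q x).
Proof.
move=> cf cq q0 x; have [Kx|nKx] := pselect (K x).
  exact: (continuous_mulr_for (cf _ (KO Kx)) (@cq x)).
apply: (near_cst_continuous 0).
by apply: filterS (off nKx) => y /q0 ->; rewrite mulr0.
Qed.

Let p_C1 x := pC1 (I : [set: R * R] x).

Let p_continuous : continuous p.
Proof. by move=> x; exact: (C1_continuous openT pC1 I). Qed.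

Let bK : exists2 r : R, 0 <= r & forall x : R * R, r < `|x| -> ~ K x.
Proof.
have [N [_ NP]] := bO; exists (`|N| + 1) => [|x]; first by rewrite addr_ge0.
have N1 : N < `|N| + 1 by rewrite (le_lt_trans (ler_norm _))// ltrDl.
by rewrite ltNge => /negP xN /KO/(NP _ N1).
Qed.

Let Rintegral_derive_cutoff_mul v :
  (forall (F : R * R -> R) r, 0 <= r -> (forall x : R * R, r < `|x| -> F x = 0) ->
    (forall x, derivable F x v) -> continuous (fun x => 'D_v F x) ->
    \int[mu2]_x 'D_v F x = 0) ->
  (forall x, Omega x -> derivable u x v) ->
  (forall x, Omega x -> {for x, continuous (fun x => 'D_v u x)}) ->
  (forall x, derivable p x v) -> continuous (fun x => 'D_v p x) ->
  mu2.-integrable Omega (EFin \o (fun x => 'D_v u x * p x + u x * 'D_v p x)) /\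
  \int[mu2]_(x in Omega) ('D_v u x * p x + u x * 'D_v p x) = 0.
Proof.
move=> intv du cdu dp cdp; have [r r0 rP] := bK.
have dup x := is_derive_cutoff_mul (@du x) (dp x).
have dE : (fun x => 'D_v (fun x => u x * p x) x) = (fun x => 'D_v u x * p x + u x * 'D_v p x).
  by apply/funext => x; apply: derive_val; exact: dup.
have dp0 x : ~ K x -> 'D_v p x = 0 by move=> /(derive_p0 v)/@derive_val.
have cd : continuous (fun x => 'D_v u x * p x + u x * 'D_v p x).
  move=> x; apply: continuous_addr_for.
    exact: (continuous_cutoff_mul cdu p_continuous p0).
  exact: (continuous_cutoff_mul (fun y Oy => C1_continuous oO uC1 Oy) cdp dp0).
have r0P x : r < `|x| -> 'D_v u x * p x + u x * 'D_v p x = 0.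
  by move=> /rP nKx; rewrite p0// dp0// !mulr0 addr0.
have iT := integrable_compact_support cd r0P.
have mO : measurable (Omega : set plane) := measurable_open_plane oO.
split; first exact: integrableS iT.
rewrite -[RHS](intv _ r r0 _ (fun x => @ex_derive _ _ _ _ _ _ _ (dup x))); last 2 first.
- by move=> x /rP/p0 ->; rewrite mulr0.
- by rewrite dE.
rewrite dE Rintegral_mkcond; apply: eq_Rintegral => x _; rewrite patchE.
case: ifPn => // /negP; rewrite inE => nOx.
have nKx : ~ K x by move=> /KO.
by rewrite p0// dp0// !mulr0 addr0.
Qed.

Lemma Rintegral_d1_cutoff_mul :
  mu2.-integrable Omega (EFin \o (fun x => d1 u x * p x + u x * d1 p x)) /\
  \int[mu2]_(x in Omega) (d1 u x * p x + u x * d1 p x) = 0.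
Proof.
apply: Rintegral_derive_cutoff_mul.
- by move=> F r r0 F0 dF cF; exact: Rintegral_d1_compact_support r0 F0 dF cF.
- by move=> x /uC1[h _ _ _].
- by move=> x /uC1[_ _ h _].
- by move=> x; have [h _ _ _] := p_C1 x.
- by move=> x; have [_ _ h _] := p_C1 x.
Qed.

Lemma Rintegral_d2_cutoff_mul :
  mu2.-integrable Omega (EFin \o (fun x => d2 u x * p x + u x * d2 p x)) /\
  \int[mu2]_(x in Omega) (d2 u x * p x + u x * d2 p x) = 0.
Proof.
apply: Rintegral_derive_cutoff_mul.
- by move=> F r r0 F0 dF cF; exact: Rintegral_d2_compact_support r0 F0 dF cF.
- by move=> x /uC1[_ h _ _].
- by move=> x /uC1[_ _ _ h].
- by move=> x; have [_ h _ _] := p_C1 x.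
- by move=> x; have [_ _ _ h] := p_C1 x.
Qed.

End product.

(** As [u] is only C1, its second derivatives are avoided by writing the integrand as
    [d1 (u * d2 theta) - d2 (u * d1 theta)]; the terms with second derivatives of [theta] cancel by
    symmetry. *)
Lemma perp_gradient_weak_divergence (theta : R * R -> R) : test_function Omega theta ->
  d1 (d2 theta) = d2 (d1 theta) ->
  \int[mu2]_(x in Omega) dot2 (- d2 u x, d1 u x) (grad theta x) = 0.
Proof.
move=> [smth _ supp] d12; pose K := closure [set x | theta x != 0].
have cK : closed K by exact: closed_closure.
have oK : open (~` K) by exact: closed_openC.
have th0 (v x : R * R) : ~ K x -> 'D_v theta x = 0.
  move=> nKx; apply: derive_val; apply: (@near_eq_is_derive _ _ _ (cst 0)).
  apply: filterS (open_nbhs_nbhs (conj oK nKx)) => y nKy; apply: contrapT => y0; apply: nKy.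
  by apply: subset_closure; apply/eqP => /esym.
have [th1 th2] := Ck_closure_partial (smth 2).
have oT : open [set: R * R] by exact: openT.
have d1C1 := Ck_closure_C1 oT th1.
have d2C1 := Ck_closure_C1 oT th2.
have [i1 e1] := Rintegral_d1_cutoff_mul cK supp d2C1 (fun x => @th0 (0, 1) x).
have [i2 e2] := Rintegral_d2_cutoff_mul cK supp d1C1 (fun x => @th0 (1, 0) x).
have mO : measurable (Omega : set plane) := measurable_open_plane oO.
rewrite -[RHS](subrr 0) -{1}e1 -e2 -(RintegralB mO i1 i2).
apply: eq_Rintegral => x _; rewrite d12 /dot2 /grad /=; ring.
Qed.

End perp_gradient.

(** * Zeros with nonvanishing gradient *)

Section zero_set.
Context {R : realType}.
Local Notation mu1 := (@lebesgue_measure R).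
Local Notation mu2 := (@lebesgue2 R).
Local Notation plane := (measurableTypeR R * measurableTypeR R)%type.

(** An isolated point is the only point of [A] in some rational interval, and that interval
    determines it. *)
Lemma isolated_countable (A : set R) :
  (forall x, A x -> exists2 r, 0 < r & forall y, A y -> `|y - x| < r -> y = x) ->
  countable A.
Proof.
move=> isoA.
pose Q x := [set q : rat * rat | ratr q.1 < x < ratr q.2 /\
  forall y, A y -> ratr q.1 < y < ratr q.2 -> y = x].
have QP x : A x -> Q x (xget (0%R, 0%R) (Q x)).
  move=> Ax; have [r r0 rP] := isoA _ Ax.
  have lt1 : x - r < x by rewrite gtrBl.
  have lt2 : x < x + r by rewrite ltrDl.
  have [a /itvP aP] := rat_in_itvoo lt1.
  have [b /itvP bP] := rat_in_itvoo lt2.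
  apply: (@xgetPex _ _ (Q x)); exists (a, b); split; first by rewrite /= aP bP.
  move=> y Ay /= /andP[ay yb]; apply: rP => //; rewrite ltr_distl.
  by rewrite (lt_trans _ ay) ?aP// (lt_trans yb) ?bP.
apply/countable_injP; exists (fun x => pickle (xget (0%R, 0%R) (Q x))).
move=> x y; rewrite !inE => Ax Ay /(pcan_inj (@pickleK _)) xy.
have [_ +] := QP _ Ax; have [+ _] := QP _ Ay; rewrite xy => h /(_ _ Ay h).
by move->.
Qed.

Lemma is_derive_neq0_isolated (f : R -> R) (x d : R) : is_derive x 1 f d ->
  d != 0 -> exists2 r, 0 < r & forall y, f y = f x -> `|y - x| < r -> y = x.
Proof.
move=> fd d0; have e0 : 0 < `|d| / 2 by rewrite divr_gt0// normr_gt0.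
have [r r0 rP] := (is_derive_epsP _ _ _ _).1 fd _ e0; exists r => // y fy yr.
have := rP _ yr; rewrite /GRing.scale/= mulr1 subrK fy subrr sub0r normrN normrM mulrC.
apply: contraPeq => yx; apply/negP; rewrite -ltNge ltr_pM2r ?normr_gt0 ?subr_eq0//.
by rewrite ltr_pdivrMr// ltr_pMr ?normr_gt0// ltr1n.
Qed.

Variables (Omega : set (R * R)) (w : R * R -> R).
Hypotheses (oO : open Omega) (wC1 : C1 Omega w).

Let mO : measurable (Omega : set plane) := measurable_open_plane oO.

Let zero_slice (dw : R * R -> R) := [set x : R * R | [/\ Omega x, w x = 0 & dw x != 0]].

Let measurable_zero_slice (dw : R * R -> R) : (forall x, Omega x -> {for x, continuous dw}) ->
  measurable (zero_slice dw : set plane).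
Proof.
move=> cdw.
have mw : measurable_fun (Omega : set plane) w.
  by apply: measurable_fun_continuous => // x; exact: C1_continuous.
have mdw := measurable_fun_continuous oO cdw.
have m1 := mw mO _ (measurable_set1 0).
have m2 := mdw mO _ (measurableC (measurable_set1 0)).
rewrite (_ : zero_slice dw = (Omega `&` w @^-1` [set 0]) `&` (Omega `&` dw @^-1` (~` [set 0]))).
  exact: measurableI.
apply/seteqP; split=> x; first by move=> [Ox wx /eqP dx]; split.
by move=> [[Ox wx] [_ /= /eqP dx]]; split.
Qed.

(* On a line, the zeros where the derivative does not vanish are isolated, hence countable. *)
Lemma zero_set_grad_negligible :
  mu2.-negligible [set x | [/\ Omega x, w x = 0 & grad w x != 0]].
Proof.
have m1 := measurable_zero_slice (fun x Ox => let: And4 _ _ h _ := wC1 Ox in h).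
have m2 := measurable_zero_slice (fun x Ox => let: And4 _ _ _ h := wC1 Ox in h).
apply: (@negligibleS _ _ _ mu2 (zero_slice (d1 w) `|` zero_slice (d2 w))).
  move=> x [Ox wx]; rewrite /grad xpair_eqE negb_and => /orP[h|h]; [left|right]; split => //.
have negl A : measurable (A : set plane) -> mu2 A = 0%E -> mu2.-negligible A.
  by move=> mA A0; exists A; split.
apply: negligibleU; apply: negl => //.
- transitivity ((mu1 \x^ mu1)%E (zero_slice (d1 w))).
    apply: product_measure_unique m1 => A B mA mB; exact: product_measure2E.
  rewrite /product_measure2 (eq_integral (cst 0%E)) ?integral0// => y _ /=.
  apply: countable_lebesgue_measure0; apply: isolated_countable => x /ysectionP[Oxy wx dx].
  have [h _ _ _] := wC1 Oxy.
  have [r r0 rP] := is_derive_neq0_isolated ((is_derive_d1 w (x, y) _).1 (derivableP h)) dx.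
  by exists r => // z /ysectionP[_ wz _]; apply: rP; rewrite /= wx wz.
- rewrite /lebesgue2 /product_measure1 (eq_integral (cst 0%E)) ?integral0// => y _ /=.
  apply: countable_lebesgue_measure0; apply: isolated_countable => x /xsectionP[Oxy wx dx].
  have [_ h _ _] := wC1 Oxy.
  have [r r0 rP] := is_derive_neq0_isolated ((is_derive_d2 w (y, x) _).1 (derivableP h)) dx.
  by exists r => // z /xsectionP[_ wz _]; apply: rP; rewrite /= wx wz.
Qed.

End zero_set.

(** * Truncations of the real line *)

Section truncation.
Context {R : realType}.
Implicit Types (c d t : R).

Definition pos_part t : R := Num.max t 0.

Lemma pos_part_eq0 t : t <= 0 -> pos_part t = 0.
Proof. by move=> t0; apply/max_idPr. Qed.

Lemma pos_part_id t : 0 <= t -> pos_part t = t.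
Proof. by move=> t0; apply/max_idPl. Qed.

Lemma is_derive_sqr_pos_part t : is_derive t 1 (fun s => pos_part s ^+ 2) (2 * pos_part t).
Proof.
apply/is_derive_epsP => e e0; exists e => // h he.
rewrite /GRing.scale/= mulr1; apply: (@le_trans _ _ (`|h| * `|h|)); last by rewrite ler_wpM2r// ltW.
rewrite -normrM ler_norml ger0_norm ?sqr_ge0 -?expr2//; rewrite /pos_part !expr2.
by have [h1|h1] := leP t 0; have [h2|h2] := leP (h + t) 0; apply/andP; split; nra.
Qed.

Lemma is_derive_sqr_pos_part_affine c d t :
  is_derive t 1 (fun s => pos_part (c * s + d) ^+ 2) (c * (2 * pos_part (c * t + d))).
Proof.
have := @is_derive1_comp R (fun s => pos_part s ^+ 2) (fun s => c * s + d) t _ _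
  (is_derive_sqr_pos_part _) (is_derive_affine c d t).
by rewrite mulrC.
Qed.

Lemma is_derive_lincomb (f g : R -> R) (a b t df dg : R) :
  is_derive t 1 f df -> is_derive t 1 g dg ->
  is_derive t 1 (fun s => a * f s + b * g s) (a * df + b * dg).
Proof. by move=> h1 h2; exact: (is_deriveD (is_deriveZ a h1) (is_deriveZ b h2)). Qed.

(** Squaring makes the truncation C1. For [d >= 0] this is the square of the positive part of
    [|t| - d]; the odd variant carries the sign of [t]. *)
Definition trunc_sqr d t : R := pos_part (t - d) ^+ 2 + pos_part (- t - d) ^+ 2.

Definition trunc_sqr_odd d t : R := pos_part (t - d) ^+ 2 - pos_part (- t - d) ^+ 2.

Let is_derive_trunc a d t : is_derive t 1
  (fun s => pos_part (s - d) ^+ 2 + a * pos_part (- s - d) ^+ 2)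
  (2 * pos_part (t - d) - a * (2 * pos_part (- t - d))).
Proof.
have := is_derive_lincomb 1 a (is_derive_sqr_pos_part_affine 1 (- d) t)
  (is_derive_sqr_pos_part_affine (-1) (- d) t).
rewrite !mul1r !mulN1r mulrN.
rewrite (_ : (fun s => _) = fun s => pos_part (s - d) ^+ 2 + a * pos_part (- s - d) ^+ 2)//.
by apply/funext => s; rewrite !mul1r mulN1r.
Qed.

Lemma is_derive_trunc_sqr d t :
  is_derive t 1 (trunc_sqr d) (2 * (pos_part (t - d) - pos_part (- t - d))).
Proof.
have := is_derive_trunc 1 d t; rewrite mul1r -mulrBr.
by rewrite (_ : (fun s => _) = trunc_sqr d)//; apply/funext => s; rewrite mul1r.
Qed.

Lemma is_derive_trunc_sqr_odd d t :
  is_derive t 1 (trunc_sqr_odd d) (2 * (pos_part (t - d) + pos_part (- t - d))).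
Proof.
have := is_derive_trunc (-1) d t; rewrite mulN1r opprK -mulrDr.
by rewrite (_ : (fun s => _) = trunc_sqr_odd d)//; apply/funext => s; rewrite mulN1r.
Qed.

(** A C1 truncation of the identity: odd, zero on [[- d, d]], of slope 1 beyond [2 * d]. Its
    derivative [cutoff d] rises linearly from 0 to 1 as [|t|] goes from [d] to [2 * d]. *)
Definition ramp d t : R := (d *+ 2)^-1 * trunc_sqr_odd d t - (d *+ 2)^-1 * trunc_sqr_odd (d *+ 2) t.

Definition cutoff d t : R := (pos_part (`|t| - d) - pos_part (`|t| - d *+ 2)) / d.

Let pos_part_abs d t : 0 <= d ->
  pos_part (t - d) + pos_part (- t - d) = pos_part (`|t| - d).
Proof.
move=> d0; have [t0|t0] := ger0P t.
  by rewrite [X in _ + X]pos_part_eq0 ?addr0//; lra.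
by rewrite pos_part_eq0 ?add0r//; lra.
Qed.

Lemma is_derive_ramp d t : 0 < d -> is_derive t 1 (ramp d) (cutoff d t).
Proof.
move=> d0; have := is_derive_lincomb (d *+ 2)^-1 (- (d *+ 2)^-1)
  (is_derive_trunc_sqr_odd d t) (is_derive_trunc_sqr_odd (d *+ 2) t).
rewrite (pos_part_abs t (ltW d0)) (pos_part_abs t (mulrn_wge0 2 (ltW d0))).
rewrite (_ : (fun s => _) = ramp d); last by apply/funext => s; rewrite mulNr.
move=> /is_derive_eq; apply; rewrite /cutoff -mulr_natr; by field; rewrite gt_eqF.
Qed.

Lemma pos_part_ge0 t : 0 <= pos_part t.
Proof. by rewrite le_max lexx orbT. Qed.

Lemma cutoff_ge0 d t : 0 < d -> 0 <= cutoff d t.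
Proof.
move=> d0; rewrite divr_ge0 ?(ltW d0)// subr_ge0 ge_max !le_max lexx orbT andbT.
by apply/orP; left; rewrite lerD2l lerN2 mulr2n lerDl ltW.
Qed.

Lemma cutoff_le1 d t : 0 < d -> cutoff d t <= 1.
Proof.
move=> d0; rewrite ler_pdivrMr// mul1r /pos_part.
by have [h1|h1] := leP (`|t| - d) 0; have [h2|h2] := leP (`|t| - d *+ 2) 0; lra.
Qed.

Lemma cutoff_eq1 d t : 0 < d -> d *+ 2 <= `|t| -> cutoff d t = 1.
Proof.
move=> d0 dt; rewrite /cutoff !pos_part_id; [|lra|lra].
by rewrite mulr2n; field; rewrite gt_eqF.
Qed.

Lemma cutoff_eq0 d t : 0 < d -> `|t| <= d -> cutoff d t = 0.
Proof. by move=> d0 td; rewrite /cutoff !pos_part_eq0 ?subrr ?mul0r//; lra. Qed.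

Lemma trunc_sqrE d t : 0 <= d -> trunc_sqr d t = pos_part (`|t| - d) ^+ 2.
Proof.
move=> d0; rewrite /trunc_sqr -pos_part_abs// sqrrD.
suff -> : pos_part (t - d) * pos_part (- t - d) = 0 by rewrite mul0rn addr0.
have [t0|t0] := leP 0 t; first by rewrite [X in _ * X]pos_part_eq0 ?mulr0//; lra.
by rewrite pos_part_eq0 ?mul0r//; lra.
Qed.

Lemma trunc_derive_le d t : 0 <= d ->
  `|2 * (pos_part (t - d) - pos_part (- t - d))| <= 2 * pos_part (`|t| - d).
Proof.
move=> d0; rewrite normrM ger0_norm// ler_wpM2l// -pos_part_abs// ler_norml.
by have := pos_part_ge0 (t - d); have := pos_part_ge0 (- t - d) => h1 h2;
  apply/andP; split; lra.
Qed.

Lemma ramp_le d t : 0 < d -> `|ramp d t| <= pos_part (`|t| - d).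
Proof.
move=> d0; have d20 : 0 < d *+ 2 by rewrite pmulrn_lgt0.
rewrite /ramp -mulrBr normrM ger0_norm ?invr_ge0 ?(ltW d20)// ler_pdivrMl//.
rewrite /trunc_sqr_odd ler_norml.
have [t0|t0] := ger0P t.
  rewrite ![pos_part (- t - _)]pos_part_eq0; [|lra|lra].
  rewrite !expr0n /= !subr0 /pos_part !expr2.
  by have [h1|h1] := leP (t - d) 0; have [h2|h2] := leP (t - d *+ 2) 0; apply/andP; split; nra.
rewrite ![pos_part (t - _)]pos_part_eq0; [|lra|lra].
rewrite !expr0n /= !sub0r /pos_part !expr2.
by have [h1|h1] := leP (- t - d) 0; have [h2|h2] := leP (- t - d *+ 2) 0; apply/andP; split; nra.
Qed.

End truncation.

(** * From local to global Lipschitz bounds *)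

Section lipschitz.
Context {R : realType}.

(** Continuous induction: the supremum of the parameters at which the bound holds can be passed
    unless it is 1. *)
Lemma lip_near_segment (f : R -> R) (L : R) : 0 <= L -> (forall x, lip_near x f L) ->
  `|f 1 - f 0| <= L.
Proof.
move=> L0 fL; pose S := [set t : R | 0 <= t <= 1 /\ `|f t - f 0| <= L * t].
have S0 : S 0 by split; rewrite ?lexx ?ler01// subrr normr0 mulr0.
have hS : has_sup S by split; [exists 0|exists 1 => t [/andP[]]].
pose s := sup S.
have Ss t : S t -> t <= s by move=> St; apply: ub_le_sup => //; exact: hS.2.
have s0 : 0 <= s by exact: Ss.
have [r r0 rP] := fL s.
have r20 : 0 < r / 2 by rewrite divr_gt0.
have [t [/andP[t0 t1] tL] st] := sup_adherent r20 hS.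
have ts : t <= s by apply: Ss; rewrite /S /= t0.
pose q := Num.min 1 (s + r / 2).
have tq : t <= q by rewrite le_min t1 (le_trans ts)// lerDl ltW.
have qs : q <= s + r / 2 by rewrite ge_min lexx orbT.
have r2r : r / 2 < r by rewrite ltr_pdivrMr// ltr_pMr// ltr1n.
have dq : `|q - s| < r.
  rewrite ltr_distl (lt_le_trans _ tq)/=.
    by rewrite (le_lt_trans qs)// ltrD2l.
  by rewrite (lt_trans _ st)// ltrD2l ltrN2.
have dt : `|t - s| < r.
  rewrite ltr_distl (lt_trans _ st) ?ltrD2l ?ltrN2//=.
  by rewrite (le_lt_trans ts)// ltrDl.
have Sq : S q.
  split; first by rewrite (le_trans t0)//= /q ge_min lexx.
  rewrite -(subrKA (f t)) (le_trans (ler_normD _ _))//.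
  have := rP _ _ dq dt; rewrite [X in _ <= _ * X]ger0_norm ?subr_ge0// => h.
  by apply: le_trans (lerD h tL) _; rewrite -mulrDr subrK.
have q1 : q = 1.
  have := Ss _ Sq; rewrite /q minElt; case: ltP => // _.
  by rewrite -subr_ge0 opprD addrA subrr sub0r oppr_ge0 leNgt r20.
by have [_] := Sq; rewrite q1 mulr1.
Qed.

Lemma lip_near_lipschitz (f : R * R -> R) (L : R) : 0 <= L -> (forall x, lip_near x f L) ->
  forall x y, `|f x - f y| <= L * `|x - y|.
Proof.
move=> L0 fL x y; pose c (t : R) := y + t *: (x - y).
have := @lip_near_segment (f \o c) (L * `|x - y|).
have -> : (f \o c) 1 = f x by rewrite /= /c scale1r addrC subrK.
have -> : (f \o c) 0 = f y by rewrite /= /c scale0r addr0.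
apply; first by rewrite mulr_ge0.
move=> t; have [r r0 rP] := fL (c t).
have N0 : 0 < `|x - y| + 1 by rewrite ltr_wpDl.
exists (r / (`|x - y| + 1)); first by rewrite divr_gt0.
have cc t1 t2 : c t1 - c t2 = (t1 - t2) *: (x - y).
  by rewrite /c opprD addrACA subrr add0r scalerBl.
have close t1 : `|t1 - t| < r / (`|x - y| + 1) -> `|c t1 - c t| < r.
  rewrite ltr_pdivlMr// => h; rewrite cc normrZ; apply: le_lt_trans h.
  by rewrite ler_wpM2l// lerDl.
move=> t1 t2 /close h1 /close h2; apply: le_trans (rP _ _ h1 h2) _.
by rewrite cc normrZ mulrCA mulrC.
Qed.

Lemma is_derive_line (f : R * R -> R) (x v : R * R) (d : R) :
  is_derive x v f d <-> is_derive (0 : R) 1 (fun t => f (t *: v + x)) d.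
Proof.
have E (t : R) : t *: (1 : R) + 0 = t by rewrite addr0 /GRing.scale/= mulr1.
split=> /is_derive_epsP H; apply/is_derive_epsP => e /H[r r0 rP]; exists r => // t /rP;
  by rewrite E scale0r add0r.
Qed.

Lemma is_derive_comp_dir (f : R * R -> R) (g : R -> R) (x v : R * R) (d e : R) :
  is_derive x v f d -> is_derive (f x) 1 g e -> is_derive x v (g \o f) (e * d).
Proof.
move=> /is_derive_line fd ge; apply/is_derive_line.
apply: (@is_derive1_comp R g (fun t => f (t *: v + x))).
by rewrite scale0r add0r.
Qed.

End lipschitz.

(** * Truncated test functions *)

Section cutoff_test.
Context {R : realType}.
Local Notation mu2 := (@lebesgue2 R).
Local Notation plane := (measurableTypeR R * measurableTypeR R)%type.
Variables (Omega : set (R * R)) (w : R * R -> R) (G : R).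
Hypotheses (oO : open Omega) (bO : bounded_set Omega) (wC1 : C1 Omega w).
Hypothesis cw : {within closure Omega, continuous w}.
Hypothesis w0 : forall x, boundary Omega x -> w x = 0.
Hypothesis gradG : forall x, Omega x -> enorm (grad w x) <= G.

Let w_cvg x : closure Omega x -> forall e, 0 < e ->
  exists2 r, 0 < r & forall y, closure Omega y -> `|y - x| < r -> `|w y - w x| < e.
Proof.
move=> cx e e0; move/subspace_continuousP: cw => /(_ _ cx)/cvgrPdist_lt/(_ _ e0).
rewrite near_withinE => /near_ball[r r0 rP]; exists r => // y cy /rP/(_ cy).
by rewrite distrC.
Qed.

Let compact_closure : compact (closure Omega).
Proof.
apply: compact_closed_bounded; first exact: closed_closure.
have [N [_ NP]] := bO; have /NP {}NP : N < `|N| + 1.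
  by rewrite (le_lt_trans (ler_norm _))// ltrDl.
exists (`|N| + 2); split; first exact: num_real.
move=> s Ns x cx; change (`|x| <= s); have [|y [Oy yx]] := cx [set y | `|y - x| < 1].
  by apply/near_ball; exists 1.
have h := NP _ Oy; have h' : `|x - y| <= 1 by rewrite distrC ltW.
rewrite -(subrK y x); apply: le_trans (ler_normD _ _) _; apply: le_trans (ltW Ns).
by rewrite addrC; apply: le_trans (lerD h h') _; rewrite -addrA lerD2l.
Qed.

Lemma boundary_continuous_bounded : exists2 W : R, 0 <= W & forall x, Omega x -> `|w x| <= W.
Proof.
have [N [_ NP]] := compact_bounded (continuous_compact cw compact_closure).
exists (`|N| + 1) => [|x Ox]; first by rewrite addr_ge0.
apply: NP; first by rewrite (le_lt_trans (ler_norm _))// ltrDl.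
by exists x => //; exact: subset_closure.
Qed.

Section test.
Variables (V : R * R -> R * R) (q Dq : R * R -> R) (eta eta' : R -> R) (d : R).
Variables (Cq Mq : R).
Hypothesis cV : forall x, Omega x -> {for x, continuous V}.
Hypothesis weakV : forall theta, test_function Omega theta ->
  d1 (d2 theta) = d2 (d1 theta) ->
  \int[mu2]_(x in Omega) dot2 (V x) (grad theta x) = 0.
Hypotheses (qC : forall x, Omega x -> lip_near x q Cq) (Cq0 : 0 <= Cq).
Hypothesis (qM : forall x, Omega x -> `|q x| <= Mq).
Hypothesis dq : forall x, Omega x -> is_derive x (V x) q (Dq x).
Hypothesis deta : forall t : R, is_derive t 1 eta (eta' t).
Hypotheses (d0 : 0 < d) (eta0 : forall t, `|t| <= d -> eta t = 0).
Hypothesis eta'_bounded : forall W : R, exists N : R, forall t : R, `|t| <= W -> `|eta' t| <= N.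

Let K := [set x | Omega x /\ d <= `|w x|].

(** A limit point of [K] satisfies [|w| >= d > 0], so it is not on the boundary, where [w = 0]. *)
Let closedK : closed K.
Proof.
move=> x cx; have cOx : closure Omega x by apply: closureS cx => y [].
have dw : d <= `|w x|.
  rewrite leNgt; apply/negP => wd.
  have e0 : 0 < d - `|w x| by rewrite subr_gt0.
  have [r r0 rP] := w_cvg cOx e0.
  have [|y [[Oy dy] yx]] := cx [set y | `|y - x| < r].
    by apply/near_ball; exists r.
  have := rP _ (subset_closure Oy) yx; rewrite ltrBrDr -ltrBrDr ltNge lerBlDr.
  by rewrite (le_trans dy)// -{1}(subrK (w x) (w y)) ler_normD.
split => //; apply: interior_subset; apply: contrapT => nx.
by have := w0 (conj cOx nx) => E; move: dw; rewrite E normr0 leNgt d0.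
Qed.

Let KO : K `<=` Omega. Proof. by move=> x []. Qed.

Let compactK : compact K.
Proof. by apply: subclosed_compact closedK compact_closure _ => x [/subset_closure]. Qed.

Let psi := (fun x => eta (w x) * q x) \_ Omega.

Let psiE x : Omega x -> psi x = eta (w x) * q x.
Proof. by move=> Ox; rewrite /psi patchE mem_set. Qed.

Let psi0 x : ~ K x -> psi x = 0.
Proof.
move=> nKx; rewrite /psi patchE; case: ifPn => //; rewrite inE => Ox.
rewrite eta0 ?mul0r// leNgt; apply/negP => dw; apply: nKx; split => //; exact: ltW.
Qed.

Let near_Omega x : Omega x -> \forall y \near x, Omega y.
Proof. by move=> Ox; exact: open_nbhs_nbhs. Qed.

Let dpsi x : Omega x -> is_derive x (V x) psi
  (eta' (w x) * dot2 (V x) (grad w x) * q x + eta (w x) * Dq x).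
Proof.
move=> Ox; have h1 := is_derive_comp_dir (C1_is_derive (V x) oO wC1 Ox) (deta (w x)).
have h2 := is_deriveM h1 (dq Ox).
apply: (@near_eq_is_derive _ _ _ ((eta \o w) * q)).
  by apply: filterS (near_Omega Ox) => y /psiE ->.
by apply: is_derive_eq h2 _; rewrite /GRing.scale/= dot2C; ring.
Qed.

(** A local constant independent of [x] is enough, since [lip_near_lipschitz] makes it global. Off
    [K] the function is locally zero; on [K] the product rule for differences applies. *)
Let psi_lip : exists2 L, 0 <= L & forall x, lip_near x psi L.
Proof.
have [W W0 WP] := boundary_continuous_bounded.
have [N NP] := eta'_bounded W.
have N0 : 0 <= N by apply: le_trans (NP 0 _); rewrite ?normr0.
have eta_lip s t : `|s| <= W -> `|t| <= W -> `|eta s - eta t| <= N * `|s - t|.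
  move=> sW tW; have [c cb ->] := @segment_MVT R eta eta' t s (fun c _ => deta c).
  rewrite normrM ler_wpM2r//; apply: NP.
  move: sW tW cb; rewrite !ler_norml => /andP[s1 s2] /andP[t1 t2] /andP[c1 c2].
  by rewrite (le_trans _ c1) ?le_min ?t1// (le_trans c2)// ge_max t2.
have eta_le t : `|t| <= W -> `|eta t| <= N * W.
  move=> tW; have := @eta_lip t 0 tW; rewrite normr0 (@eta0 0) ?normr0 ?(ltW d0)// !subr0 => /(_ W0) h.
  by apply: le_trans h _; rewrite ler_wpM2l.
have NW0 : 0 <= N * W by rewrite mulr_ge0.
exists (N * (2 * `|G|) * `|Mq| + N * W * Cq) => [|x].
  by rewrite addr_ge0 ?mulr_ge0.
have [Kx|nKx] := pselect (K x); last first.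
  have oK : open (~` K) by exact: closed_openC.
  have [r r0 rP] := open_ball oK nKx.
  exists r => // y z /rP yK /rP zK; rewrite !psi0// subrr normr0.
  by rewrite mulr_ge0// addr_ge0 ?mulr_ge0.
have Ox := KO Kx.
have wlip : lip_near x w (2 * `|G|).
  apply: (partial_lip_near oO (C1_partially_derivable wC1) Ox) => y Oy.
  have h : enorm (grad w y) <= `|G| by apply: le_trans (gradG Oy) _; exact: ler_norm.
  by split; apply: le_trans h; [exact: (enorm_fst (grad w y))|exact: (enorm_snd (grad w y))].
have [r1 r10 r1P] := wlip; have [r2 r20 r2P] := qC Ox.
have [r3 r30 r3P] := open_ball oO Ox.
exists (Num.min r1 (Num.min r2 r3)); first by rewrite !lt_min r10 r20.
move=> y z; rewrite !lt_min => /and3P[y1 y2 /r3P Oy] /and3P[z1 z2 /r3P Oz].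
rewrite !psiE//.
have -> : eta (w y) * q y - eta (w z) * q z =
    (eta (w y) - eta (w z)) * q y + eta (w z) * (q y - q z) by ring.
apply: le_trans (ler_normD _ _) _; rewrite !normrM mulrDl; apply: lerD.
  rewrite mulrAC; apply: ler_pM => //; last by rewrite (le_trans (qM Oy))// ler_norm.
  apply: le_trans (eta_lip _ _ (WP _ Oy) (WP _ Oz)) _.
  by rewrite -mulrA ler_wpM2l// r1P.
rewrite -[leRHS]mulrA; apply: ler_pM; [by []|by []|exact: eta_le _ (WP _ Oz)|exact: r2P].
Qed.

(** Used with [eta = ramp d] and [q] equal to 1 or to the difference of the reciprocal
    conductivities, and with [eta = trunc_sqr d] and [q] the arc length. *)
Theorem cutoff_weak_divergence : \int[mu2]_(x in Omega)
  (eta' (w x) * dot2 (V x) (grad w x) * q x + eta (w x) * Dq x) = 0.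
Proof.
have [L L0 LP] := psi_lip.
exact: (weak_divergence_Lipschitz oO bO cV weakV L0 (lip_near_lipschitz L0 LP) compactK KO psi0 dpsi).
Qed.

End test.
End cutoff_test.

(** * Bounded measurable functions *)

Section bounded_measurable.
Context {R : realType}.
Local Notation mu2 := (@lebesgue2 R).
Local Notation plane := (measurableTypeR R * measurableTypeR R)%type.
Variable Omega : set (R * R).
Hypotheses (oO : open Omega) (bO : bounded_set Omega).
Implicit Types f g : R * R -> R.

Let mO : measurable (Omega : set plane) := measurable_open_plane oO.
Let O_fin : (mu2 Omega < +oo)%E := bounded_set_lebesgue2 mO bO.

(** On a bounded open set these form an algebra of integrable functions, so the integrability of an
    integrand follows from its shape. *)
Definition bmf f := measurable_fun (Omega : set plane) f /\
  exists C : R, forall x, Omega x -> `|f x| <= C.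

Lemma bmf_integrable f : bmf f -> mu2.-integrable Omega (EFin \o f).
Proof. by move=> [mf [C fC]]; exact: (integrable_bounded mO O_fin mf fC). Qed.

Lemma bmf_cst (c : R) : bmf (fun=> c).
Proof. by split; [exact: measurable_cst|exists `|c|]. Qed.

Lemma bmfD f g : bmf f -> bmf g -> bmf (fun x => f x + g x).
Proof.
move=> [mf [A fA]] [mg [B gB]]; split; first exact: measurable_funD.
by exists (A + B) => x Ox; apply: le_trans (ler_normD _ _) _; rewrite lerD ?fA ?gB.
Qed.

Lemma bmfM f g : bmf f -> bmf g -> bmf (fun x => f x * g x).
Proof.
move=> [mf [A fA]] [mg [B gB]]; split; first exact: measurable_funM.
by exists (A * B) => x Ox; rewrite normrM ler_pM ?fA ?gB.
Qed.

Lemma bmfN f : bmf f -> bmf (fun x => - f x).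
Proof.
move=> /(bmfM (bmf_cst (-1))); rewrite (_ : (fun x => _) = fun x => - f x)//.
by apply/funext => x; rewrite mulN1r.
Qed.

Lemma bmfB f g : bmf f -> bmf g -> bmf (fun x => f x - g x).
Proof. by move=> bf /bmfN bg; exact: bmfD. Qed.

Lemma bmf_norm f : bmf f -> bmf (fun x => `|f x|).
Proof.
move=> [mf [A fA]]; split; first exact: measurableT_comp.
by exists A => x Ox; rewrite normr_id fA.
Qed.

Lemma bmf_pos_part f : bmf f -> bmf (fun x => pos_part (f x)).
Proof.
move=> [mf [A fA]]; split; first by apply: measurable_maxr => //; exact: measurable_cst.
exists A => x Ox; apply: le_trans (fA _ Ox); rewrite ger0_norm ?pos_part_ge0//.
by rewrite ge_max ler_norm normr_ge0.
Qed.

Lemma bmf_continuous f (C : R) : (forall x, Omega x -> {for x, continuous f}) ->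
  (forall x, Omega x -> `|f x| <= C) -> bmf f.
Proof. by move=> cf fC; split; [exact: measurable_fun_continuous|exists C]. Qed.

Lemma bmf_Rintegral_cst (c : R) : \int[mu2]_(x in Omega) c = c * fine (mu2 Omega).
Proof. exact: Rintegral_cst. Qed.

Lemma bmf_sqr f : bmf f -> bmf (fun x => f x ^+ 2).
Proof. by move=> bf; exact: bmfM. Qed.

(** Integrates a pointwise bound of the shape shared by the later estimates; absent terms are filled
    with 0. *)
Lemma bmf_Rintegral_le f g1 g2 g3 (a b c : R) : bmf f -> bmf g1 -> bmf g2 -> bmf g3 ->
  (forall x, Omega x -> f x <= g1 x + a * g2 x + b * g3 x + c) ->
  \int[mu2]_(x in Omega) f x <= \int[mu2]_(x in Omega) g1 x +
    a * \int[mu2]_(x in Omega) g2 x + b * \int[mu2]_(x in Omega) g3 x + c * fine (mu2 Omega).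
Proof.
move=> bf b1 b2 b3 le.
have ba2 := bmfM (bmf_cst a) b2; have bb3 := bmfM (bmf_cst b) b3.
have b12 := bmfD b1 ba2; have b123 := bmfD b12 bb3.
rewrite -(RintegralZl a mO (bmf_integrable b2)) -(RintegralZl b mO (bmf_integrable b3)).
rewrite -(RintegralD mO (bmf_integrable b1) (bmf_integrable ba2)).
rewrite -(RintegralD mO (bmf_integrable b12) (bmf_integrable bb3)).
rewrite -bmf_Rintegral_cst.
rewrite -(RintegralD mO (bmf_integrable b123) (bmf_integrable (bmf_cst c))).
apply: le_Rintegral => //; [exact: bmf_integrable|].
by apply: bmf_integrable; exact: bmfD b123 (bmf_cst c).
Qed.

Lemma open_negligible (A : set (R * R)) : open A -> (lebesgue2 A = 0)%E -> A = set0.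
Proof.
move=> oA A0; apply/seteqP; split=> // x Ax; exfalso.
have [r r0 rP] := open_ball oA Ax.
pose I (c : R) : set R := `]c - r, c + r[%classic.
have mI c : measurable (I c) by exact: measurable_itv.
have IE c : lebesgue_measure (I c) = (r + r)%:E.
  rewrite /I lebesgue_measure_itv/= lte_fin.
  rewrite ifT; last by rewrite ltrBlDr -addrA ltrDl addr_gt0.
  by rewrite -EFinD; congr (_%:E); lra.
have SA : I x.1 `*` I x.2 `<=` A.
  move=> y [/=]; rewrite /I /= !in_itv/= => h1 h2.
  by apply: rP; rewrite norm_pair_lt /= !ltr_distl h1.
have mS : measurable (I x.1 `*` I x.2 : set plane) := measurableX (mI _) (mI _).
have : (mu2 (I x.1 `*` I x.2) <= mu2 A)%E.
  apply: le_measure; [by rewrite inE|rewrite inE|exact: SA].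
  exact: measurable_open_plane.
have -> : mu2 (I x.1 `*` I x.2) = ((r + r) * (r + r))%:E.
  transitivity (lebesgue_measure (I x.1) * lebesgue_measure (I x.2))%E.
    by apply: product_measure1E; exact: mI.
  by rewrite EFinM; congr (_ * _)%E; exact: IE.
by rewrite A0 lee_fin leNgt mulr_gt0 ?addr_gt0.
Qed.

End bounded_measurable.

(** * Differences and inverses of C1 functions *)

Section C1_algebra.
Context {R : realType}.
Variable Omega : set (R * R).
Hypothesis oO : open Omega.
Implicit Types f g : R * R -> R.

Lemma continuous_eq_on f g x : Omega x -> (forall y, Omega y -> f y = g y) ->
  {for x, continuous f} -> {for x, continuous g}.
Proof.
move=> Ox fg /continuous_plane cf; apply/continuous_plane => e /cf[r r0 rP].
have [q q0 qP] := open_ball oO Ox.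
exists (Num.min r q); first by rewrite lt_min r0.
by move=> y; rewrite lt_min => /andP[/rP + /qP Oy]; rewrite !fg.
Qed.

Lemma C1_is_deriveB f g (x v : R * R) : derivable f x v -> derivable g x v ->
  is_derive x v (fun x => f x - g x) ('D_v f x - 'D_v g x).
Proof. by move=> df dg; exact: (is_deriveB (derivableP df) (derivableP dg)). Qed.

Lemma C1_d1B f g x : C1 Omega f -> C1 Omega g -> Omega x ->
  d1 (fun x => f x - g x) x = d1 f x - d1 g x.
Proof.
move=> fC1 gC1 Ox; have [h1 _ _ _] := fC1 _ Ox; have [h2 _ _ _] := gC1 _ Ox.
by apply: derive_val; exact: C1_is_deriveB.
Qed.

Lemma C1_d2B f g x : C1 Omega f -> C1 Omega g -> Omega x ->
  d2 (fun x => f x - g x) x = d2 f x - d2 g x.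
Proof.
move=> fC1 gC1 Ox; have [_ h1 _ _] := fC1 _ Ox; have [_ h2 _ _] := gC1 _ Ox.
by apply: derive_val; exact: C1_is_deriveB.
Qed.

Lemma C1_sub f g : C1 Omega f -> C1 Omega g -> C1 Omega (fun x => f x - g x).
Proof.
move=> fC1 gC1 x Ox.
have [f1 f2 cf1 cf2] := fC1 _ Ox; have [g1 g2 cg1 cg2] := gC1 _ Ox; split.
- by apply: ex_derive; exact: C1_is_deriveB f1 g1.
- by apply: ex_derive; exact: C1_is_deriveB f2 g2.
- apply: (continuous_eq_on Ox (fun y Oy => esym (C1_d1B fC1 gC1 Oy))).
  exact: (continuous_addr_for cf1 (cvgN cg1)).
- apply: (continuous_eq_on Ox (fun y Oy => esym (C1_d2B fC1 gC1 Oy))).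
  exact: (continuous_addr_for cf2 (cvgN cg2)).
Qed.

Section inverse.
Variable f : R * R -> R.
Hypotheses (fC1 : C1 Omega f) (f0 : forall x, Omega x -> f x != 0).

Let is_derive_inv (x v : R * R) : Omega x -> derivable f x v ->
  is_derive x v (fun x => (f x)^-1) (- ((f x)^-1 * (f x)^-1) * 'D_v f x).
Proof.
move=> Ox d; have dV : is_derive (f x) 1 (fun y : R => y^-1) (- ((f x)^-1 * (f x)^-1)).
  have := is_deriveV (f0 Ox) (is_derive_id (f x) (1 : R)).
  by rewrite /GRing.scale/= mulr1 -exprVn expr2.
exact: (is_derive_comp_dir (derivableP d) dV).
Qed.

Lemma C1_d1V x : Omega x -> d1 (fun x => (f x)^-1) x = - ((f x)^-1 * (f x)^-1) * d1 f x.
Proof. by move=> Ox; have [h _ _ _] := fC1 Ox; apply: derive_val; exact: is_derive_inv. Qed.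

Lemma C1_d2V x : Omega x -> d2 (fun x => (f x)^-1) x = - ((f x)^-1 * (f x)^-1) * d2 f x.
Proof. by move=> Ox; have [_ h _ _] := fC1 Ox; apply: derive_val; exact: is_derive_inv. Qed.

Lemma C1_inv : C1 Omega (fun x => (f x)^-1).
Proof.
move=> x Ox; have [h1 h2 c1 c2] := fC1 Ox.
have cf : {for x, continuous f} := C1_continuous oO fC1 Ox.
have cV : {for x, continuous (fun x => (f x)^-1)} by exact: cvgV (f0 Ox) cf.
have cVV : {for x, continuous (fun x => - ((f x)^-1 * (f x)^-1))}.
  exact: cvgN (continuous_mulr_for cV cV).
split.
- by apply: ex_derive; exact: is_derive_inv h1.
- by apply: ex_derive; exact: is_derive_inv h2.
- apply: (continuous_eq_on Ox (fun y Oy => esym (C1_d1V Oy))).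
  exact: (continuous_mulr_for cVV c1).
- apply: (continuous_eq_on Ox (fun y Oy => esym (C1_d2V Oy))).
  exact: (continuous_mulr_for cVV c2).
Qed.

End inverse.
End C1_algebra.

(** * Pointwise inequalities between two gradients *)

Section pointwise.
Context {R : realType}.
Implicit Types (g h : R * R) (a b c e f k l m s t x y z G M N S X : R).

(* Vanishes exactly when one of [g], [h] is a nonnegative multiple of the other. *)
Definition misalignment g h := enorm g * enorm h - dot2 g h.

Lemma misalignment_ge0 g h : 0 <= misalignment g h.
Proof. by rewrite subr_ge0 dot2_le. Qed.

Lemma dot2_subr (v : R * R) g h : dot2 v (g - h) = dot2 v g - dot2 v h.
Proof. by rewrite /dot2 /=; ring. Qed.

Lemma dot2Zl s (v : R * R) g : dot2 (s *: v) g = s * dot2 v g.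
Proof. by rewrite /dot2 /= /GRing.scale/=; ring. Qed.

Lemma dot2_enorm g : dot2 g g = enorm g ^+ 2.
Proof. by rewrite sqr_enorm /dot2 !expr2. Qed.

(** From the identity [(s g - t h) . (g - h) = (s + t) misalignment + (s |g| - t |h|) (|g| - |h|)]:
    the left side integrates to 0 by the weak equations, and the last product is at most [e * b]. *)
Lemma misalignment_le g h s t (s0 : R) k e b : 0 < s0 -> s0 <= s -> s0 <= t -> 0 <= k <= 1 ->
  `|s * enorm g - t * enorm h| <= e -> `|enorm g - enorm h| <= b ->
  k * misalignment g h <= (s0 *+ 2)^-1 * (k * dot2 (s *: g) (g - h)) +
    - (s0 *+ 2)^-1 * (k * dot2 (t *: h) (g - h)) + (s0 *+ 2)^-1 * (e * b).
Proof.
move=> s00 s0s s0t /andP[k0 k1] he hb.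
have s20 : 0 < s0 *+ 2 by rewrite pmulrn_lgt0.
rewrite mulNr -mulrBr -mulrDr ler_pdivlMl//.
have T0 := misalignment_ge0 g h.
have E : k * dot2 (s *: g) (g - h) - k * dot2 (t *: h) (g - h) =
    k * ((s + t) * misalignment g h) +
    k * ((s * enorm g - t * enorm h) * (enorm g - enorm h)).
  by rewrite !dot2Zl !dot2_subr !dot2_enorm (dot2C h g) /misalignment; ring.
have kT : 0 <= k * misalignment g h by rewrite mulr_ge0.
have h1 : (s0 *+ 2) * (k * misalignment g h) <= k * ((s + t) * misalignment g h).
  by rewrite [k * (_ * _)]mulrCA ler_wpM2r// mulr2n lerD.
have h2 : - (e * b) <= k * ((s * enorm g - t * enorm h) * (enorm g - enorm h)).
  rewrite lerNl -mulrN (le_trans (ler_norm _))// normrM normrN normrM.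
  rewrite -[leRHS]mul1r ler_pM ?mulr_ge0//; first by rewrite ger0_norm.
  by rewrite ler_pM.
by rewrite E -subr_ge0; lra.
Qed.

(** Splits [|J - J'|^2] into the difference of the moduli, which is given, and the misalignment,
    which the weak equations control. *)
Lemma current_difference_sqr g h s t :
  dot2 (s *: g - t *: h) (s *: g - t *: h) =
  (s * enorm g - t * enorm h) ^+ 2 + s * t * misalignment g h *+ 2.
Proof.
transitivity (s ^+ 2 * dot2 g g + t ^+ 2 * dot2 h h - s * t * dot2 g h *+ 2).
  by rewrite /dot2 /= /GRing.scale/=; ring.
by rewrite !dot2_enorm /misalignment; ring.
Qed.

(** With [p = 1/s - 1/t] and [D = s g - t h] one has [g - h = p (s g) + D / t]. So
    [p (s g) . (g - h)] is [p^2 |s g|^2] plus a cross term, which Young's inequality splits with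
    weights [m ^ 2 / 2] and [c]; this fixes [c]. The product [x * y] stands for the other term of
    the weak identity, the ramp times the derivative of [p] along [s g]. *)
Lemma reciprocal_difference_le g h s t (s0 s1 : R) m M k x X y N e c :
  c = M ^+ 2 / (m ^+ 2 * s0 ^+ 2 *+ 2) ->
  0 < s0 -> s0 <= s -> s0 <= t -> s <= s1 -> t <= s1 -> 0 < m -> 0 <= k <= 1 ->
  m <= s * enorm g <= M -> `|x| <= X -> `|y| <= N ->
  `|s * enorm g - t * enorm h| <= e ->
  m ^+ 2 / 2 * (k * (s^-1 - t^-1) ^+ 2) <=
    k * dot2 (s *: g) (g - h) * (s^-1 - t^-1) + x * y + N * X +
    (c * (s1 ^+ 2 *+ 2)) * (k * misalignment g h) + c * e ^+ 2.
Proof.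
move=> cE s00 s0s s0t ss1 ts1 m0 /andP[k0 k1] /andP[ma aM] xX yN he.
have s_gt0 := lt_le_trans s00 s0s; have t_gt0 := lt_le_trans s00 s0t.
set p := s^-1 - t^-1; set D := s *: g - t *: h; set a := s * enorm g.
have M0 : 0 <= M by apply: le_trans aM; apply: le_trans ma; exact: ltW.
have c0 : 0 <= c by rewrite cE divr_ge0 ?sqr_ge0// mulrn_wge0// mulr_ge0// sqr_ge0.
have T0 := misalignment_ge0 g h.
have E : dot2 (s *: g) (g - h) * p = p ^+ 2 * a ^+ 2 + p * dot2 (s *: g) D / t.
  have -> : dot2 (s *: g) D = s * (s * dot2 g g - t * dot2 g h).
    by rewrite /D /dot2 /= /GRing.scale/=; ring.
  rewrite dot2Zl dot2_subr !dot2_enorm /a /p.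
  by field; rewrite !gt_eqF.
have Dsqr : enorm D ^+ 2 <= e ^+ 2 + s1 ^+ 2 *+ 2 * misalignment g h.
  rewrite -dot2_enorm current_difference_sqr lerD//.
    by rewrite -(real_normK (num_real _)) lerXn2r ?nnegrE// (le_trans _ he).
  rewrite -mulrnAl ler_wpM2r// lerMn2r/= expr2 ler_pM//; exact: ltW.
have yx : - (x * y) <= N * X.
  rewrite (le_trans (ler_norm _))// normrN normrM mulrC ler_pM//.
have pa : m ^+ 2 * p ^+ 2 <= p ^+ 2 * a ^+ 2.
  by rewrite mulrC ler_wpM2l ?sqr_ge0// lerXn2r ?nnegrE ?(ltW m0)// (le_trans (ltW m0)).
have young : - (p * dot2 (s *: g) D / t) <= m ^+ 2 / 2 * p ^+ 2 + c * enorm D ^+ 2.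
  have h1 : - (p * dot2 (s *: g) D / t) <= `|p| * (M * enorm D) / s0.
    rewrite (le_trans (ler_norm _))// normrN !normrM.
    apply: ler_pM; rewrite ?mulr_ge0//.
      apply: ler_wpM2l => //; apply: le_trans (normr_dot2_le _ _) _.
      by rewrite ler_wpM2r ?enorm_ge0// enormZ ger0_norm ?(ltW s_gt0).
    by rewrite ger0_norm ?invr_ge0 ?(ltW t_gt0)// lef_pV2 ?posrE.
  apply: le_trans h1 _; rewrite -[p ^+ 2](real_normK (num_real p)).
  have h2 : 0 <= (m * `|p| - M * enorm D / (m * s0)) ^+ 2 by exact: sqr_ge0.
  rewrite -subr_ge0; apply: le_trans (_ : _ <= (m * `|p| - M * enorm D / (m * s0)) ^+ 2 / 2) _.
    by rewrite divr_ge0.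
  rewrite le_eqVlt; apply/orP; left; apply/eqP; rewrite cE.
  by field; rewrite !gt_eqF.
have kD : k * (c * enorm D ^+ 2) <= c * (s1 ^+ 2 *+ 2) * (k * misalignment g h) + c * e ^+ 2.
  apply: (@le_trans _ _ (k * (c * (e ^+ 2 + s1 ^+ 2 *+ 2 * misalignment g h)))).
    by rewrite ler_wpM2l// ler_wpM2l.
  have : k * (c * e ^+ 2) <= c * e ^+ 2 by rewrite ler_piMl// mulr_ge0// sqr_ge0.
  by move: (e ^+ 2) (s1 ^+ 2 *+ 2) (misalignment g h) => A B C hh; nra.
have ky := ler_wpM2l k0 young; have kp := ler_wpM2l k0 pa.
rewrite -[k * _ * p]mulrA E; move: ky kp kD yx.
move: (p * _ / t) (enorm D ^+ 2) (p ^+ 2) (a ^+ 2) (x * y) (N * X) (m ^+ 2) (c * e ^+ 2) (c * (s1 ^+ 2 *+ 2) * _).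
move=> z1 z2 z3 z4 z5 z6 z7 z8 z9; nra.
Qed.

(** Lagrange's identity: the squared determinant is [(|g| |h|)^2 - (g . h)^2], which has the
    misalignment as a factor. *)
Lemma perp_dot2_sqr g h b : enorm g <= b -> enorm h <= b ->
  dot2 (- g.2, g.1) h ^+ 2 <= b ^+ 2 *+ 2 * misalignment g h.
Proof.
move=> gb hb.
have E : dot2 (- g.2, g.1) h ^+ 2 = (enorm g * enorm h + dot2 g h) * misalignment g h.
  rewrite mulrC /misalignment -subr_sqr exprMn !sqr_enorm /dot2 /=; ring.
rewrite E ler_wpM2r ?misalignment_ge0// mulr2n.
have h1 : enorm g * enorm h <= b ^+ 2 by rewrite expr2 ler_pM ?enorm_ge0.
by rewrite lerD// (le_trans (dot2_le _ _)).
Qed.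

(** The Poincare argument at one point: [x] is the truncation of [|w|], [a] the derivative of its
    square, [z] the derivative of [w] along the rotated gradient, [f] the arc length, [G] the norm
    of the gradient and [c] the misalignment. Young's inequality absorbs the term with [z] into
    [mu / 2 * x ^+ 2]; as [k = 1] where [x > 0], the misalignment may carry the cutoff. *)
Lemma transverse_cutoff_le S a x z f l (mu : R) k c G b : S ^+ 2 = 1 -> 0 <= x ->
  `|a| <= 2 * x -> (0 < x -> k = 1) -> 0 <= k -> `|f| <= l -> 0 < mu -> mu <= G ->
  0 <= c -> z ^+ 2 <= b ^+ 2 *+ 2 * c ->
  mu / 2 * x ^+ 2 <= S * (a * z * f + x ^+ 2 * (S * G)) + l ^+ 2 * b ^+ 2 *+ 4 / mu * (k * c).
Proof.
move=> S1 x0 ax k1 k0 fl mu0 muG c0 zc.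
have l0 : 0 <= l by apply: le_trans fl.
have -> : S * (a * z * f + x ^+ 2 * (S * G)) = S * (a * z * f) + x ^+ 2 * G.
  by rewrite -[X in _ = _ + X]mul1r -S1; ring.
have S1' : `|S| = 1 by apply/eqP; rewrite -sqr_norm_eq1 ?S1// real_normK ?num_real// S1.
have h : - (S * (a * z * f)) <= 2 * x * `|z| * l.
  rewrite (le_trans (ler_norm _))// normrN !normrM S1' mul1r.
  by apply: ler_pM => //; apply: ler_pM.
have d0 : 0 <= l ^+ 2 * b ^+ 2 *+ 4 / mu.
  by rewrite divr_ge0 ?(ltW mu0)// mulrn_wge0// mulr_ge0 ?sqr_ge0.
have xG : mu * x ^+ 2 <= x ^+ 2 * G by rewrite mulrC ler_wpM2l ?sqr_ge0.
have [x_gt0|x_le0] := ltP 0 x; last first.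
  have -> : x = 0 by apply/eqP; rewrite eq_le x_le0.
  have a0 : a = 0.
    by apply/eqP; rewrite -normr_le0 (le_trans ax)// mulr_ge0_le0.
  by rewrite a0 expr0n/= !mul0r mulr0 !add0r mulr0 mulr_ge0// mulr_ge0.
rewrite (k1 x_gt0) mul1r.
have young : 2 * x * `|z| * l <= mu / 2 * x ^+ 2 + l ^+ 2 *+ 2 / mu * z ^+ 2.
  rewrite -[z ^+ 2](real_normK (num_real z)) -subr_ge0.
  apply: le_trans (_ : 0 <= (mu * x - l * `|z| *+ 2) ^+ 2 / (mu *+ 2)) _.
    by rewrite divr_ge0 ?sqr_ge0// mulrn_wge0// ltW.
  by rewrite le_eqVlt; apply/orP; left; apply/eqP; field; rewrite gt_eqF.
have zc' : l ^+ 2 *+ 2 / mu * z ^+ 2 <= l ^+ 2 * b ^+ 2 *+ 4 / mu * c.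
  have e0 : 0 <= l ^+ 2 *+ 2 / mu by rewrite divr_ge0 ?(ltW mu0)// mulrn_wge0// sqr_ge0.
  apply: le_trans (ler_wpM2l e0 zc) _.
  by rewrite le_eqVlt; apply/orP; left; apply/eqP; ring.
move: h xG young zc'; move: (S * _) (l ^+ 2 * b ^+ 2 *+ 4 / mu * c) (2 * x * _ * l) (l ^+ 2 *+ 2 / mu * _).
move=> z1 z2 z3 z4; move: (x ^+ 2) => y; move: (y * G) => z5; lra.
Qed.

End pointwise.

(** * The stability estimate *)

(** Up to powers of [t], the constants [c1] to [c4] bound the integrals of the misalignment, of the
    squared truncation of [w], of the truncation itself, and of the squared difference of
    reciprocals; [c] is the Young constant of [reciprocal_difference_le]. The final summand accounts
    for the set [w = 0]. *)
Definition stability_constant {R : realType} (s0 s1 s2 m M LM area : R) : R :=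
  let b := M / s0 in
  let c1 := (s0 *+ 2)^-1 * b * area in
  let c2 := (LM + 1) ^+ 2 * b ^+ 2 *+ 8 / (m / s1) ^+ 2 * c1 in
  let c3 := (c2 + area) / 2 in
  let c := M ^+ 2 / (m ^+ 2 * s0 ^+ 2 *+ 2) in
  let c4 := ((s2 *+ 4 / s0 ^+ 2 * M) * c3 + c * (s1 ^+ 2 *+ 2) * c1 + c * area) *+ 2 / m ^+ 2 in
  s1 ^+ 2 * ((c4 + area) / 2) + s1 / m * area.

Section stability.
Context {R : realType}.
Local Notation mu2 := (@lebesgue2 R).
Local Notation plane := (measurableTypeR R * measurableTypeR R)%type.
Variables (Omega : set (R * R)) (u u' s s' : R * R -> R) (s0 s1 s2 m M LM : R).
Hypotheses (oO : open Omega) (bO : bounded_set Omega).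
Hypotheses (uC1 : C1 Omega u) (u'C1 : C1 Omega u').
Let w x := u x - u' x.
Hypothesis cw : {within closure Omega, continuous w}.
Hypothesis w0 : forall x, boundary Omega x -> w x = 0.
Hypotheses (sC1 : C1 Omega s) (s'C1 : C1 Omega s').
Hypothesis weak_u : forall theta, test_function Omega theta ->
  \int[mu2]_(x in Omega) dot2 (s x *: grad u x) (grad theta x) = 0.
Hypothesis weak_u' : forall theta, test_function Omega theta ->
  \int[mu2]_(x in Omega) dot2 (s' x *: grad u' x) (grad theta x) = 0.
Hypotheses (s0_gt0 : 0 < s0) (s1_gt0 : 0 < s1) (s2_ge0 : 0 <= s2).
Hypotheses (m_gt0 : 0 < m) (M_gt0 : 0 < M).
Hypothesis s_bounds : forall x, Omega x -> s0 <= s x <= s1.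
Hypothesis s'_bounds : forall x, Omega x -> s0 <= s' x <= s1.
Hypothesis current_bounds : forall x, Omega x -> m <= s x * enorm (grad u x) <= M.
Hypothesis current'_bounds : forall x, Omega x -> m <= s' x * enorm (grad u' x) <= M.
Hypothesis s_grad : forall x, Omega x -> `|d1 s x| <= s2 /\ `|d2 s x| <= s2.
Hypothesis s'_grad : forall x, Omega x -> `|d1 s' x| <= s2 /\ `|d2 s' x| <= s2.
Variables (phi : R * R -> R) (S Cphi : R).
Hypotheses (S1 : S ^+ 2 = 1) (Cphi0 : 0 <= Cphi).
Hypothesis phi_bounds : forall x, Omega x -> 0 <= phi x <= LM.
Hypothesis phi_lip : forall x, Omega x -> lip_near x phi Cphi.
Hypothesis dphi : forall x, Omega x -> is_derive x (tangent u x) phi S.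
(** Stands for the fourth root of the bound on the difference of the current moduli. *)
Variable t : R.
Hypotheses (t_gt0 : 0 < t) (t_le1 : t <= 1).
Hypothesis close : forall x, Omega x ->
  `|s x * enorm (grad u x) - s' x * enorm (grad u' x)| <= t ^+ 4.

Let area := fine (mu2 Omega).
Let mO : measurable (Omega : set plane) := measurable_open_plane oO.

Let area_ge0 : 0 <= area. Proof. exact: fine_ge0. Qed.

Let b := M / s0.

Let b_gt0 : 0 < b. Proof. exact: divr_gt0. Qed.

Let grad_bounds (v r : R * R -> R) : (forall x, Omega x -> s0 <= r x <= s1) ->
  (forall x, Omega x -> m <= r x * enorm (grad v x) <= M) ->
  forall x, Omega x -> m / s1 <= enorm (grad v x) <= b.
Proof.
move=> rb vb x Ox; have /andP[r0 r1] := rb _ Ox; have /andP[v0 v1] := vb _ Ox.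
have E0 := enorm_ge0 (grad v x); rewrite ler_pdivrMr// ler_pdivlMr//.
apply/andP; split; first by rewrite (le_trans v0)// mulrC ler_wpM2l.
by rewrite (le_trans _ v1)// mulrC ler_wpM2r.
Qed.

Let gu := grad_bounds s_bounds current_bounds.
Let gu' := grad_bounds s'_bounds current'_bounds.

Let wC1 : C1 Omega w. Proof. exact: C1_sub. Qed.

Let grad_w x : Omega x -> grad w x = grad u x - grad u' x.
Proof. by move=> Ox; rewrite /grad (C1_d1B uC1 u'C1 Ox) (C1_d2B uC1 u'C1 Ox). Qed.

Let enorm_grad_w x : Omega x -> enorm (grad w x) <= b *+ 4.
Proof.
move=> Ox; rewrite grad_w// (le_trans (enorm_le_norm _))//.
have /andP[_ h1] := gu Ox; have /andP[_ h2] := gu' Ox.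
have h3 := norm_le_enorm (grad u x); have h4 := norm_le_enorm (grad u' x).
have := ler_normB (grad u x) (grad u' x); lra.
Qed.

Let continuous_flux (v r : R * R -> R) x : C1 Omega v -> C1 Omega r -> Omega x ->
  {for x, continuous (fun x => r x *: grad v x)}.
Proof.
move=> vC1 rC1 Ox; have cr := C1_continuous oO rC1 Ox; have [_ _ c1 c2] := vC1 _ Ox.
by apply/continuous_fst_snd; split; [exact: (continuous_mulr_for cr c1)|exact: (continuous_mulr_for cr c2)].
Qed.

Let bmf_d (v : R * R -> R) : C1 Omega v -> (forall x, Omega x -> enorm (grad v x) <= b) ->
  bmf Omega (d1 v) /\ bmf Omega (d2 v).
Proof.
move=> vC1 vb; split; apply: (bmf_continuous oO (C := b)) => x Ox.
- by have [] := vC1 _ Ox.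
- by apply: le_trans (vb _ Ox); exact: (enorm_fst (grad v x)).
- by have [] := vC1 _ Ox.
- by apply: le_trans (vb _ Ox); exact: (enorm_snd (grad v x)).
Qed.

Let bu : bmf Omega (d1 u) /\ bmf Omega (d2 u).
Proof. by apply: bmf_d => // x /gu/andP[]. Qed.

Let bu' : bmf Omega (d1 u') /\ bmf Omega (d2 u').
Proof. by apply: bmf_d => // x /gu'/andP[]. Qed.

Let bmf_coef (r : R * R -> R) : C1 Omega r -> (forall x, Omega x -> s0 <= r x <= s1) -> bmf Omega r.
Proof.
move=> rC1 rb; apply: (bmf_continuous oO (C := s1)) => x Ox; first exact: C1_continuous rC1 Ox.
have /andP[r0 r1] := rb _ Ox; rewrite ger0_norm//; apply: le_trans r0; exact: ltW.
Qed.

Let bs : bmf Omega s := bmf_coef sC1 s_bounds.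
Let bs' : bmf Omega s' := bmf_coef s'C1 s'_bounds.

Let bw : bmf Omega w.
Proof.
have [W _ WP] := boundary_continuous_bounded bO cw.
by apply: (bmf_continuous oO _ WP) => x; exact: C1_continuous.
Qed.

Let bmf_dot2 (v1 v2 r1 r2 : R * R -> R) : bmf Omega v1 -> bmf Omega v2 ->
  bmf Omega r1 -> bmf Omega r2 -> bmf Omega (fun x => dot2 (v1 x, v2 x) (r1 x, r2 x)).
Proof. by move=> h1 h2 h3 h4; exact: bmfD (bmfM h1 h3) (bmfM h2 h4). Qed.

Let bmf_enorm (v1 v2 : R * R -> R) : bmf Omega v1 -> bmf Omega v2 ->
  bmf Omega (fun x => enorm (v1 x, v2 x)).
Proof.
move=> h1 h2; have [mv _] := bmf_dot2 h1 h2 h1 h2; have [_ [A hA]] := h1; have [_ [B hB]] := h2.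
split; first by apply: measurableT_comp mv; exact: continuous_measurable_fun (@sqrt_continuous R).
exists (2 * (A + B)) => x Ox; rewrite ger0_norm ?enorm_ge0// (le_trans (enorm_le_norm _))//.
have h3 := hA _ Ox; have h4 := hB _ Ox; apply: ler_wpM2l => //; rewrite norm_pair_le /=.
have h5 := normr_ge0 (v1 x); have h6 := normr_ge0 (v2 x); apply/andP; split.
  by rewrite (le_trans h3)// lerDl (le_trans h6).
by rewrite (le_trans h4)// lerDr (le_trans h5).
Qed.

Let T x := misalignment (grad u x) (grad u' x).

Let bT : bmf Omega T.
Proof.
have [h1 h2] := bu; have [h3 h4] := bu'.
by apply: bmfB; [apply: bmfM; exact: bmf_enorm|exact: bmf_dot2].
Qed.

Let k d x := cutoff d (w x).
Let X (d : R) x := pos_part (`|w x| - d).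

Let bX d : bmf Omega (X d).
Proof. by apply: bmf_pos_part; apply: bmfB; [exact: bmf_norm|exact: bmf_cst]. Qed.

Let bk d : bmf Omega (k d).
Proof. by apply: bmfM; [apply: bmfB; exact: bX|exact: bmf_cst]. Qed.

Let bmf_comp_trunc d : bmf Omega (fun x => trunc_sqr d (w x)) /\
  bmf Omega (fun x => trunc_sqr_odd d (w x)).
Proof.
have h1 : bmf Omega (fun x => pos_part (w x - d) ^+ 2).
  by apply: bmf_sqr; apply: bmf_pos_part; apply: bmfB => //; exact: bmf_cst.
have h2 : bmf Omega (fun x => pos_part (- w x - d) ^+ 2).
  by apply: bmf_sqr; apply: bmf_pos_part; apply: bmfB; [exact: bmfN|exact: bmf_cst].
by split; [exact: bmfD|exact: bmfB].
Qed.

Let bramp d : bmf Omega (fun x => ramp d (w x)).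
Proof.
have [_ h1] := bmf_comp_trunc d; have [_ h2] := bmf_comp_trunc (d *+ 2).
by apply: bmfB; (apply: bmfM; [exact: bmf_cst|]).
Qed.

Section cutoff_level.
Variable d : R.
Hypothesis d0 : 0 < d.

Let cutoff_bounds x : 0 <= k d x <= 1.
Proof. by rewrite cutoff_ge0// cutoff_le1. Qed.

Let ramp_eq0 (a : R) : `|a| <= d -> ramp d a = 0.
Proof.
move=> ad; apply/eqP; rewrite -normr_le0 (le_trans (ramp_le _ d0))//.
by rewrite pos_part_eq0// subr_le0.
Qed.

Let cutoff_bounded (W : R) : exists N : R, forall a : R, `|a| <= W -> `|cutoff d a| <= N.
Proof. by exists 1 => a _; rewrite ger0_norm ?cutoff_ge0// cutoff_le1. Qed.

Lemma ramp_weak_divergence (V : R * R -> R * R) (q Dq : R * R -> R) (Cq Mq : R) :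
  (forall x, Omega x -> {for x, continuous V}) ->
  (forall theta, test_function Omega theta ->
    \int[mu2]_(x in Omega) dot2 (V x) (grad theta x) = 0) ->
  (forall x, Omega x -> lip_near x q Cq) -> 0 <= Cq ->
  (forall x, Omega x -> `|q x| <= Mq) ->
  (forall x, Omega x -> is_derive x (V x) q (Dq x)) ->
  \int[mu2]_(x in Omega) (k d x * dot2 (V x) (grad w x) * q x + ramp d (w x) * Dq x) = 0.
Proof.
move=> cV wV qC Cq0 qM dq.
exact: (cutoff_weak_divergence oO bO wC1 cw w0 enorm_grad_w cV (fun th h _ => wV th h) qC Cq0
  qM dq (fun a => is_derive_ramp a d0) d0 ramp_eq0 cutoff_bounded).
Qed.

Let weak_cutoff (v r : R * R -> R) : C1 Omega v -> C1 Omega r ->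
  (forall theta, test_function Omega theta ->
    \int[mu2]_(x in Omega) dot2 (r x *: grad v x) (grad theta x) = 0) ->
  \int[mu2]_(x in Omega) (k d x * dot2 (r x *: grad v x) (grad u x - grad u' x)) = 0.
Proof.
move=> vC1 rC1 wv.
have := @ramp_weak_divergence (fun x => r x *: grad v x) (cst 1) (cst 0) 0 1
  (fun x => continuous_flux vC1 rC1) wv.
move=> <- //; [|by move=> x _; exists 1 => // y z _ _; rewrite subrr normr0 mul0r|by move=> x _; rewrite normr1].
by apply: eq_Rintegral => x; rewrite inE => Ox; rewrite mulr1 mulr0 addr0 grad_w.
Qed.

(* Subtract the equations of [u] and [u'], both tested with [ramp d (u - u')]. *)
Lemma misalignment_integral_le :
  \int[mu2]_(x in Omega) (k d x * T x) <= (s0 *+ 2)^-1 * b * area * t ^+ 4.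
Proof.
have [h1 h2] := bu; have [h3 h4] := bu'.
have bA (v1 v2 r : R * R -> R) : bmf Omega v1 -> bmf Omega v2 -> bmf Omega r ->
    bmf Omega (fun x => k d x * dot2 (r x *: (v1 x, v2 x)) (grad u x - grad u' x)).
  move=> bv1 bv2 br; apply: bmfM; first exact: bk.
  exact: (bmf_dot2 (bmfM br bv1) (bmfM br bv2) (bmfB h1 h3) (bmfB h2 h4)).
have bkT : bmf Omega (fun x => k d x * T x) by apply: bmfM; [exact: bk|exact: bT].
have gb x : Omega x -> `|enorm (grad u x) - enorm (grad u' x)| <= b.
  move=> Ox; have /andP[_ g1] := gu Ox; have /andP[_ g2] := gu' Ox.
  move: g1 g2 (enorm_ge0 (grad u x)) (enorm_ge0 (grad u' x)).
  move: (enorm _) (enorm _) => z1 z2 g1 g2 g3 g4; rewrite ler_norml lerBrDr lerBlDr.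
  by rewrite (le_trans _ g3) ?subr_le0//= ?(le_trans g1)// ?lerDl// addrC subr_le0.
have le x : Omega x -> k d x * T x <= 0 + (s0 *+ 2)^-1 * (k d x * dot2 (s x *: grad u x) (grad u x - grad u' x)) +
    - (s0 *+ 2)^-1 * (k d x * dot2 (s' x *: grad u' x) (grad u x - grad u' x)) + (s0 *+ 2)^-1 * (t ^+ 4 * b).
  move=> Ox; have /andP[r1 _] := s_bounds Ox; have /andP[r2 _] := s'_bounds Ox.
  by rewrite add0r; exact: (misalignment_le s0_gt0 r1 r2 (cutoff_bounds x) (close Ox) (gb _ Ox)).
have := bmf_Rintegral_le oO bO bkT (bmf_cst _ 0) (bA _ _ _ h1 h2 bs) (bA _ _ _ h3 h4 bs') le.
rewrite bmf_Rintegral_cst// (weak_cutoff uC1 sC1 weak_u) (weak_cutoff u'C1 s'C1 weak_u').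
rewrite mul0r !mulr0 !add0r => /le_trans; apply.
by rewrite le_eqVlt; apply/orP; left; apply/eqP; rewrite -/area; ring.
Qed.
End cutoff_level.

Let P x := (s x)^-1 - (s' x)^-1.

(* A Poincare inequality along the level curves of [u]: the field [V] below is
   divergence free, annihilates [u] and has derivative [S * enorm (grad u x)] on the
   arc length [phi], so testing it with [phi * trunc_sqr d (u - u')] leaves only the
   derivative of [u'] along [V], which the misalignment controls. *)
Lemma trunc_sqr_integral_le d : 0 < d ->
  \int[mu2]_(x in Omega) (X d x ^+ 2) <=
  (LM + 1) ^+ 2 * b ^+ 2 *+ 8 / (m / s1) ^+ 2 * ((s0 *+ 2)^-1 * b * area) * t ^+ 4.
Proof.
(* The misalignment is known to be small only under a cutoff; the one at level [d / 2] equals 1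
   wherever [|w| >= d], hence on the support of the truncation. *)
move=> d0; have d20 : 0 < d / 2 by rewrite divr_gt0.
have [h1 h2] := bu; have [h3 h4] := bu'; have [bt _] := bmf_comp_trunc d.
pose V x := (- d2 u x, d1 u x); pose mu := m / s1.
have mu0 : 0 < mu by rewrite divr_gt0.
pose eta' (a : R) := 2 * (pos_part (a - d) - pos_part (- a - d)).
pose I x := eta' (w x) * dot2 (V x) (grad w x) * phi x + trunc_sqr d (w x) * (S * enorm (grad u x)).
have cV x : Omega x -> {for x, continuous V}.
  by move=> Ox; have [_ _ c1 c2] := uC1 Ox; apply/continuous_fst_snd; split; [exact: cvgN c2|exact: c1].
have dphiV x : Omega x -> is_derive x (V x) phi (S * enorm (grad u x)).
  move=> Ox; have /andP[g1 _] := gu Ox; have g0 := lt_le_trans mu0 g1.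
  have := is_derive_dirZ (enorm (grad u x)) (dphi Ox).
  by rewrite /tangent scalerA divff ?gt_eqF// scale1r /GRing.scale/= mulrC.
have phiM x : Omega x -> `|phi x| <= LM by move=> /phi_bounds/andP[p0 p1]; rewrite ger0_norm.
have eta0 (a : R) : `|a| <= d -> trunc_sqr d a = 0.
  by move=> ad; rewrite trunc_sqrE ?(ltW d0)// pos_part_eq0 ?expr0n//= subr_le0.
have eta'W (W : R) : exists N : R, forall a : R, `|a| <= W -> `|eta' a| <= N.
  exists (2 * `|W|) => a aW; rewrite (le_trans (trunc_derive_le _ (ltW d0)))// ler_wpM2l//.
  rewrite ge_max normr_ge0 andbT lerBlDr (le_trans aW)// (le_trans (ler_norm _))// lerDl.
  exact: ltW.
have I0 : \int[mu2]_(x in Omega) I x = 0.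
  exact: (cutoff_weak_divergence oO bO wC1 cw w0 enorm_grad_w cV
    (perp_gradient_weak_divergence oO bO uC1) phi_lip Cphi0 phiM dphiV
    (is_derive_trunc_sqr d) d0 eta0 eta'W).
have bphi : bmf Omega phi.
  by apply: (bmf_continuous oO _ phiM) => x /phi_lip/lip_near_continuous.
have beta' : bmf Omega (fun x => eta' (w x)).
  apply: bmfM; first exact: bmf_cst.
  by apply: bmfB; apply: bmf_pos_part; apply: bmfB; [|exact: bmf_cst|exact: bmfN|exact: bmf_cst].
have bE : bmf Omega (fun x => enorm (grad u x)) by exact: bmf_enorm.
pose J x := eta' (w x) * dot2 (V x) (grad u x - grad u' x) * phi x + X d x ^+ 2 * (S * enorm (grad u x)).
have bJ : bmf Omega J.
  apply: bmfD; last by apply: bmfM; [exact: bmf_sqr|apply: bmfM => //; exact: bmf_cst].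
  apply: bmfM => //; apply: bmfM => //.
  exact: (bmf_dot2 (bmfN h2) h1 (bmfB h1 h3) (bmfB h2 h4)).
have J0 : \int[mu2]_(x in Omega) J x = 0.
  rewrite -I0; apply: eq_Rintegral => x; rewrite inE => Ox.
  by rewrite /J /I grad_w// trunc_sqrE ?(ltW d0).
have bkT : bmf Omega (fun x => k (d / 2) x * T x) by apply: bmfM; [exact: bk|exact: bT].
have key x : Omega x -> mu / 2 * X d x ^+ 2 <=
    S * J x + (LM + 1) ^+ 2 * b ^+ 2 *+ 4 / mu * (k (d / 2) x * T x).
  move=> Ox; have /andP[g1 g2] := gu Ox; have /andP[_ g3] := gu' Ox.
  apply: transverse_cutoff_le => //.
  - exact: pos_part_ge0.
  - exact: trunc_derive_le (ltW d0).
  - move=> X0; apply: cutoff_eq1 => //.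
    have -> : d / 2 *+ 2 = d by rewrite -[LHS]mulr_natr divfK.
    rewrite leNgt; apply/negP => wd.
    by move: X0; rewrite /X pos_part_eq0 ?ltxx// subr_le0 ltW.
  - exact: cutoff_ge0.
  - by apply: le_trans (phiM _ Ox) _; rewrite lerDl.
  - exact: misalignment_ge0.
  - have -> : dot2 (V x) (grad u x - grad u' x) = - dot2 (- (grad u x).2, (grad u x).1) (grad u' x).
      by rewrite /V /grad /dot2 /=; ring.
    by rewrite sqrrN; exact: perp_dot2_sqr.
have le x : Omega x -> X d x ^+ 2 <= 0 + (2 / mu * S) * J x +
    (2 / mu * ((LM + 1) ^+ 2 * b ^+ 2 *+ 4 / mu)) * (k (d / 2) x * T x) + 0.
  move=> /key; move: (X d x ^+ 2) (J x) (k _ x * T x) ((LM + 1) ^+ 2 * b ^+ 2 *+ 4 / mu).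
  move=> y z1 z2 c /(ler_wpM2l (ltW (divr_gt0 (ltr0n _ 2) mu0))); rewrite mulrDr.
  have -> : 2 / mu * (mu / 2 * y) = y by field; rewrite gt_eqF.
  by rewrite !mulrA add0r addr0.
have := bmf_Rintegral_le oO bO (bmf_sqr (bX d)) (bmf_cst _ 0) bJ bkT le.
rewrite bmf_Rintegral_cst// J0 !mul0r mulr0 !add0r addr0 => /le_trans; apply.
have c0 : 0 <= 2 / mu * ((LM + 1) ^+ 2 * b ^+ 2 *+ 4 / mu).
  by rewrite !mulr_ge0 ?invr_ge0 ?(ltW mu0)// mulrn_wge0// mulr_ge0// sqr_ge0.
apply: le_trans (ler_wpM2l c0 (misalignment_integral_le d20)) _.
rewrite le_eqVlt; apply/orP; left; apply/eqP; rewrite /mu.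
by field; rewrite !gt_eqF.
Qed.
Let c1 := (s0 *+ 2)^-1 * b * area.
Let c2 := (LM + 1) ^+ 2 * b ^+ 2 *+ 8 / (m / s1) ^+ 2 * c1.
Let c3 := (c2 + area) / 2.
Let c := M ^+ 2 / (m ^+ 2 * s0 ^+ 2 *+ 2).
Let N := s2 *+ 4 / s0 ^+ 2 * M.
Let c4 := (N * c3 + c * (s1 ^+ 2 *+ 2) * c1 + c * area) *+ 2 / m ^+ 2.

Let c1_ge0 : 0 <= c1.
Proof.
apply: mulr_ge0 area_ge0; apply: mulr_ge0; last exact: ltW.
by rewrite invr_ge0 mulrn_wge0// ltW.
Qed.

Let c_ge0 : 0 <= c.
Proof. by rewrite mulr_ge0 ?sqr_ge0// invr_ge0 mulrn_wge0// mulr_ge0 ?sqr_ge0. Qed.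

Let N_ge0 : 0 <= N.
Proof.
apply: mulr_ge0 (ltW M_gt0); apply: mulr_ge0; first exact: mulrn_wge0.
by rewrite invr_ge0 sqr_ge0.
Qed.

Let bmf0 : bmf Omega (fun=> 0) := bmf_cst _ 0.

(** Young's inequality with weight [t ^+ 2] balances an integral of squares of order [t ^+ 4]
    against the area. *)
Lemma trunc_integral_le d : 0 < d -> \int[mu2]_(x in Omega) X d x <= c3 * t ^+ 2.
Proof.
move=> d0.
have le x : Omega x -> X d x <= 0 + (t ^+ 2 *+ 2)^-1 * X d x ^+ 2 + 0 * 0 + t ^+ 2 / 2.
  move=> _; rewrite add0r mul0r addr0; move: (X d x) => y.
  rewrite -subr_ge0 (_ : _ - _ = (y - t ^+ 2) ^+ 2 / (t ^+ 2 *+ 2)).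
    by rewrite divr_ge0 ?sqr_ge0// mulrn_wge0// sqr_ge0.
  by field; rewrite gt_eqF.
have := bmf_Rintegral_le oO bO (bX d) bmf0 (bmf_sqr (bX d)) bmf0 le.
rewrite bmf_Rintegral_cst// mul0r !mul0r add0r addr0 => /le_trans; apply.
apply: le_trans (lerD (ler_wpM2l _ (trunc_sqr_integral_le d0)) (lexx _)) _.
  by rewrite invr_ge0 mulrn_wge0// sqr_ge0.
rewrite le_eqVlt; apply/orP; left; apply/eqP; rewrite /c3 /c2 /c1 -/area.
by field; rewrite !gt_eqF.
Qed.

Let s_gt0 x : Omega x -> 0 < s x.
Proof. by move=> /s_bounds/andP[h _]; exact: lt_le_trans h. Qed.

Let s'_gt0 x : Omega x -> 0 < s' x.
Proof. by move=> /s'_bounds/andP[h _]; exact: lt_le_trans h. Qed.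

Let inv_bounds (r : R) : s0 <= r <= s1 -> 0 <= r^-1 <= s0^-1.
Proof.
move=> /andP[r0 _]; have r_gt0 := lt_le_trans s0_gt0 r0.
by rewrite invr_ge0 (ltW r_gt0)/= lef_pV2 ?posrE.
Qed.

Let s_neq0 x : Omega x -> s x != 0.
Proof. by move=> Ox; rewrite gt_eqF// s_gt0. Qed.

Let s'_neq0 x : Omega x -> s' x != 0.
Proof. by move=> Ox; rewrite gt_eqF// s'_gt0. Qed.

Let PC1 : C1 Omega P.
Proof. exact: (C1_sub oO (C1_inv oO sC1 s_neq0) (C1_inv oO s'C1 s'_neq0)). Qed.

Let P_le x : Omega x -> `|P x| <= s0^-1.
Proof.
move=> Ox; have /andP[h1 h2] := inv_bounds (s_bounds Ox).
have /andP[h3 h4] := inv_bounds (s'_bounds Ox).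
by rewrite /P ler_norml; apply/andP; split; lra.
Qed.

Let dP_le x : Omega x -> `|d1 P x| <= s2 *+ 2 / s0 ^+ 2 /\ `|d2 P x| <= s2 *+ 2 / s0 ^+ 2.
Proof.
move=> Ox.
have iC1 := C1_inv oO sC1 s_neq0; have i'C1 := C1_inv oO s'C1 s'_neq0.
have bound (r dr : R) : s0 <= r <= s1 -> `|dr| <= s2 -> `|- (r^-1 * r^-1) * dr| <= s2 / s0 ^+ 2.
  move=> /inv_bounds/andP[r0 r1] hd; rewrite normrM normrN (ger0_norm (mulr_ge0 r0 r0)).
  by rewrite mulrC ler_pM ?mulr_ge0// expr2 invfM ler_pM.
have [a1 a2] := s_grad Ox; have [a3 a4] := s'_grad Ox.
rewrite (C1_d1B iC1 i'C1 Ox) (C1_d2B iC1 i'C1 Ox).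
rewrite (C1_d1V sC1 s_neq0 Ox) (C1_d2V sC1 s_neq0 Ox).
rewrite (C1_d1V s'C1 s'_neq0 Ox) (C1_d2V s'C1 s'_neq0 Ox).
rewrite mulrnAl mulr2n; split; apply: le_trans (ler_normB _ _) _; apply: lerD;
  apply: bound => //; [exact: s_bounds|exact: s'_bounds|exact: s_bounds|exact: s'_bounds].
Qed.

Let bP : bmf Omega P /\ bmf Omega (d1 P) /\ bmf Omega (d2 P).
Proof.
split; first by apply: (bmf_continuous oO _ P_le) => x; exact: C1_continuous.
split.
  apply: (bmf_continuous oO (C := s2 *+ 2 / s0 ^+ 2)) => x Ox; last by have [] := dP_le Ox.
  by have [] := PC1 Ox.
apply: (bmf_continuous oO (C := s2 *+ 2 / s0 ^+ 2)) => x Ox; last by have [] := dP_le Ox.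
by have [] := PC1 Ox.
Qed.

(* Test the equation of [u] with [P * ramp d (u - u')]. *)
Lemma reciprocal_integral_le d : 0 < d ->
  \int[mu2]_(x in Omega) (k d x * P x ^+ 2) <= c4 * t ^+ 2.
Proof.
move=> d0; have [h1 h2] := bu; have [h3 h4] := bu'; have [bP0 [bP1 bP2]] := bP.
pose V x := s x *: grad u x; pose DP x := dot2 (grad P x) (V x).
pose I x := k d x * dot2 (V x) (grad u x - grad u' x) * P x + ramp d (w x) * DP x.
have gP x : Omega x -> enorm (grad P x) <= s2 *+ 4 / s0 ^+ 2.
  move=> /dP_le[p1 p2]; apply: le_trans (enorm_le_norm _) _.
  have -> : s2 *+ 4 / s0 ^+ 2 = 2 * (s2 *+ 2 / s0 ^+ 2) by ring.
  by rewrite ler_wpM2l// norm_pair_le p1.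
have DPN x : Omega x -> `|DP x| <= N.
  move=> Ox; apply: le_trans (normr_dot2_le _ _) _; have /andP[_ uM] := current_bounds Ox.
  apply: ler_pM; rewrite ?enorm_ge0//; first exact: gP.
  by rewrite enormZ ger0_norm ?(ltW (s_gt0 Ox)).
have bDP : bmf Omega DP by exact: (bmf_dot2 bP1 bP2 (bmfM bs h1) (bmfM bs h2)).
have bI : bmf Omega I.
  apply: bmfD; last exact: (bmfM (bramp d) bDP).
  apply: bmfM bP0; apply: (bmfM (bk d)).
  exact: (bmf_dot2 (bmfM bs h1) (bmfM bs h2) (bmfB h1 h3) (bmfB h2 h4)).
have I0 : \int[mu2]_(x in Omega) I x = 0.
  have PL x : Omega x -> lip_near x P (2 * (s2 *+ 2 / s0 ^+ 2)).
    by move=> Ox; exact: (partial_lip_near oO (C1_partially_derivable PC1) Ox dP_le).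
  have L0 : 0 <= 2 * (s2 *+ 2 / s0 ^+ 2).
    by rewrite !mulr_ge0 ?invr_ge0 ?sqr_ge0// mulrn_wge0.
  rewrite -(ramp_weak_divergence d0 (fun x => continuous_flux uC1 sC1) weak_u PL L0 P_le
    (fun x => C1_is_derive (V x) oO PC1)).
  by apply: eq_Rintegral => x; rewrite inE => Ox; rewrite grad_w.
have bkT : bmf Omega (fun x => k d x * T x) by exact: (bmfM (bk d) bT).
have bkP : bmf Omega (fun x => k d x * P x ^+ 2) by exact: (bmfM (bk d) (bmf_sqr bP0)).
have le x : Omega x -> m ^+ 2 / 2 * (k d x * P x ^+ 2) <= I x + N * X d x +
    c * (s1 ^+ 2 *+ 2) * (k d x * T x) + c * (t ^+ 4) ^+ 2.
  move=> Ox; have /andP[r1 r2] := s_bounds Ox; have /andP[r3 r4] := s'_bounds Ox.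
  apply: (reciprocal_difference_le (erefl c) s0_gt0 r1 r3 r2 r4 m_gt0 _ (current_bounds Ox)
    (ramp_le _ d0) (DPN _ Ox) (close Ox)).
  by rewrite cutoff_ge0// cutoff_le1.
have := bmf_Rintegral_le oO bO (bmfM (bmf_cst _ (m ^+ 2 / 2)) bkP) bI (bX d) bkT le.
rewrite I0 add0r (RintegralZl _ mO (bmf_integrable oO bO bkP)) => h.
have m20 : 0 < m ^+ 2 / 2 by rewrite divr_gt0// exprn_gt0.
rewrite -(ler_pM2l m20); apply: le_trans h _.
(* The integral of the truncation of [|w|] dictates the order [t ^+ 2]; the other terms are of
   higher order and [t <= 1]. *)
have t42 : t ^+ 4 <= t ^+ 2 by rewrite ler_wiXn2l// ltW.
have t82 : (t ^+ 4) ^+ 2 <= t ^+ 2 by rewrite -exprM ler_wiXn2l// ltW.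
have cs0 : 0 <= c * (s1 ^+ 2 *+ 2) by rewrite mulr_ge0// mulrn_wge0// sqr_ge0.
have l1 := ler_wpM2l N_ge0 (trunc_integral_le d0).
have l2 := ler_wpM2l cs0 (misalignment_integral_le d0).
have l3 := ler_wpM2l (mulr_ge0 cs0 c1_ge0) t42.
have l4 := ler_wpM2r area_ge0 (ler_wpM2l c_ge0 t82).
have -> : m ^+ 2 / 2 * (c4 * t ^+ 2) = N * (c3 * t ^+ 2) +
    c * (s1 ^+ 2 *+ 2) * c1 * t ^+ 2 + c * t ^+ 2 * area.
  by rewrite /c4; field; rewrite gt_eqF.
apply: lerD l4; apply: (lerD l1); apply: le_trans l2 _; rewrite mulrA; exact: l3.
Qed.

(** Since [s - s' = - s s' P], it remains to pass from [P ^+ 2] to [|P|]: Young's inequality with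
    weight [t] turns the order [t ^+ 2] into [t]. *)
Lemma difference_integral_le d : 0 < d ->
  \int[mu2]_(x in Omega) (k d x * `|s x - s' x|) <= s1 ^+ 2 * ((c4 + area) / 2) * t.
Proof.
move=> d0; have [bP0 _] := bP.
have bkP : bmf Omega (fun x => k d x * P x ^+ 2) by exact: (bmfM (bk d) (bmf_sqr bP0)).
have bkd : bmf Omega (fun x => k d x * `|s x - s' x|).
  by apply: (bmfM (bk d)); apply: bmf_norm; exact: bmfB.
have le x : Omega x -> k d x * `|s x - s' x| <= 0 + s1 ^+ 2 * (t *+ 2)^-1 * (k d x * P x ^+ 2) +
    0 * 0 + s1 ^+ 2 * (t / 2).
  move=> Ox; rewrite add0r mul0r addr0.
  have /andP[_ r2] := s_bounds Ox; have /andP[_ r4] := s'_bounds Ox.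
  have sx := s_gt0 Ox; have s'x := s'_gt0 Ox.
  have -> : s x - s' x = - (s x * s' x * P x) by rewrite /P; field; rewrite !gt_eqF.
  rewrite normrN normrM (ger0_norm (ltW (mulr_gt0 sx s'x))).
  have ss : s x * s' x <= s1 ^+ 2 by rewrite expr2; apply: ler_pM => //; exact: ltW.
  have k0 : 0 <= k d x by exact: cutoff_ge0.
  have k1 : k d x <= 1 by exact: cutoff_le1.
  have young : `|P x| <= (t *+ 2)^-1 * P x ^+ 2 + t / 2.
    rewrite -[P x ^+ 2](real_normK (num_real _)) -subr_ge0.
    rewrite (_ : _ - _ = (`|P x| - t) ^+ 2 / (t *+ 2)).
      by rewrite divr_ge0 ?sqr_ge0// mulrn_wge0// ltW.
    by field; rewrite gt_eqF.
  apply: (@le_trans _ _ (s1 ^+ 2 * (k d x * `|P x|))).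
    by rewrite mulrCA ler_wpM2r// mulr_ge0.
  rewrite -mulrA -mulrDr ler_wpM2l ?sqr_ge0//.
  apply: le_trans (ler_wpM2l k0 young) _; rewrite mulrDr mulrCA lerD2l.
  by rewrite -[leRHS]mul1r ler_wpM2r// divr_ge0// ltW.
have := bmf_Rintegral_le oO bO bkd bmf0 bkP bmf0 le.
rewrite bmf_Rintegral_cst// !mul0r add0r addr0 => /le_trans; apply.
apply: le_trans (lerD (ler_wpM2l _ (reciprocal_integral_le d0)) (lexx _)) _.
  by rewrite mulr_ge0 ?sqr_ge0// invr_ge0 mulrn_wge0// ltW.
rewrite le_eqVlt; apply/orP; left; apply/eqP; rewrite -/area.
by field; rewrite !gt_eqF.
Qed.

(** The part of [|s - s'|] that escapes every cutoff, left over when the level tends to 0. *)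
Let h0 x := if w x == 0 then `|s x - s' x| else 0.

Let cutoff_cvg x : (1 - k n.+1%:R^-1 x) * `|s x - s' x| @[n --> \oo] --> h0 x.
Proof.
rewrite /h0; have [wx|wx] := eqVneq (w x) 0.
  rewrite (_ : (fun n => _) = cst `|s x - s' x|); first exact: cvg_cst.
  by apply/funext => n; rewrite /k wx cutoff_eq0 ?normr0 ?invr_ge0// subr0 mul1r.
have w2 : 0 < `|w x| / 2 by rewrite divr_gt0// normr_gt0.
apply: cvg_near_cst; near=> n.
have n2 : n.+1%:R^-1 *+ 2 <= `|w x|.
  rewrite -[leLHS]mulr_natr -ler_pdivlMr//; apply: ltW.
  by near: n; exact: (near_infty_natSinv_lt (PosNum w2)).
by rewrite /k cutoff_eq1 ?invr_gt0// subrr mul0r.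
Unshelve. all: by end_near. Qed.

Let zero_level_le : \int[mu2]_(x in Omega) h0 x <= s1 / m * area * t.
Proof.
have bdiff : bmf Omega (fun x => `|s x - s' x|) by apply: bmf_norm; exact: bmfB.
have [mdiff [D diffD]] := bdiff.
have bh : bmf Omega h0.
  split; last first.
    exists D => x Ox; rewrite /h0; case: ifP => _; first exact: diffD.
    by rewrite normr0; apply: le_trans (diffD _ Ox).
  apply: (measurable_fun_cvg (h := fun n x => (1 - k n.+1%:R^-1 x) * `|s x - s' x|)).
    move=> n; apply: measurable_funM => //; apply: measurable_funB; first exact: measurable_cst.
    by have [] := bk n.+1%:R^-1.
  by move=> x _; exact: cutoff_cvg.
have h0_ge0 x : 0 <= h0 x by rewrite /h0; case: ifP.
have cst0 : 0 <= s1 / m * t by rewrite mulr_ge0 ?divr_ge0// ltW.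
have [Z [mZ Z0 wZ]] := zero_set_grad_negligible oO wC1.
rewrite mulrAC -(bmf_Rintegral_cst oO) -lee_fin !EFin_Rintegral//; last 2 first.
- exact: (bmf_integrable oO bO (bmf_cst _ _)).
- exact: bmf_integrable.
apply: ae_ge0_le_integral => //.
- by move=> x _; rewrite lee_fin.
- by apply/measurable_EFinP; have [] := bh.
- exists Z; split => // x /= nx; apply: wZ; apply: contrapT => ngood; apply: nx => Ox.
  rewrite lee_fin /h0; case: eqP => // wx.
  (* Almost everywhere on [w = 0] the gradients agree, so [close] compares [s] and [s']. *)
  have gw : grad w x = 0.
    by apply/eqP; apply: contrapT => /negP gw; apply: ngood.
  move: gw; rewrite grad_w// => /subr0_eq gg.
  have := close Ox; rewrite -gg -mulrBl normrM (ger0_norm (enorm_ge0 _)).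
  have /andP[g1 _] := gu Ox; have ms0 : 0 < m / s1 by rewrite divr_gt0.
  move=> /(le_trans (ler_wpM2l (normr_ge0 _) g1)); rewrite -ler_pdivlMr// invf_div mulrC.
  move=> /le_trans; apply; rewrite ler_wpM2l ?divr_ge0 ?(ltW s1_gt0) ?(ltW m_gt0)//.
  by rewrite -[leRHS]expr1 ler_wiXn2l// ltW.
Qed.

(** The bound under the cutoff is uniform in the level, so the level may tend to 0; by dominated
    convergence the complement tends to the integral over [w = 0]. *)
Theorem stability_estimate : \int[mu2]_(x in Omega) `|s x - s' x| <=
  stability_constant s0 s1 s2 m M LM area * t.
Proof.
have bdiff : bmf Omega (fun x => `|s x - s' x|) by apply: bmf_norm; exact: bmfB.
have bk1 d : bmf Omega (fun x => (1 - k d x) * `|s x - s' x|).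
  by apply: bmfM => //; apply: bmfB; [exact: bmf_cst|exact: bk].
have cv : \int[mu2]_(x in Omega) ((1 - k n.+1%:R^-1 x) * `|s x - s' x|) @[n --> \oo] -->
    \int[mu2]_(x in Omega) h0 x.
  apply: (dominated_cvg_Rintegral mO _ _ (bmf_integrable oO bO bdiff)).
  - by move=> n; have [] := bk1 n.+1%:R^-1.
  - by move=> x _; exact: cutoff_cvg.
  - move=> n x Ox; have n0 : 0 < n.+1%:R^-1 :> R by rewrite invr_gt0.
    have k0 : 0 <= k n.+1%:R^-1 x by exact: cutoff_ge0.
    have k1 : k n.+1%:R^-1 x <= 1 by exact: cutoff_le1.
    by rewrite normrM normr_id ler_piMl// ger0_norm ?subr_ge0// gerBl.
rewrite /stability_constant -/b -/c1 -/c2 -/c3 -/c -/N -/c4 mulrDl.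
rewrite -lerBlDl; apply: le_trans zero_level_le.
apply: (cvgr_to_ge cv); apply: nearW => n; rewrite lerBlDl.
have n0 : 0 < n.+1%:R^-1 :> R by rewrite invr_gt0.
have := bmf_Rintegral_le oO bO bdiff (bmf_cst _ 0) (bmfM (bk n.+1%:R^-1) bdiff) (bk1 n.+1%:R^-1)
  (a := 1) (b := 1) (c := 0).
rewrite bmf_Rintegral_cst// !mul0r add0r !mul1r addr0.
move=> h; apply: le_trans (h _) _; last by rewrite lerD2r; exact: difference_integral_le.
by move=> x Ox; rewrite le_eqVlt; apply/orP; left; apply/eqP; ring.
Qed.

End stability.

(** * The norms of the statement *)

Section norms.
Context {R : realType}.
Local Notation mu2 := (@lebesgue2 R).
Local Notation plane := (measurableTypeR R * measurableTypeR R)%type.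
Implicit Types (Omega : set (R * R)) (g : R * R -> R).

Lemma continuous_enorm (V : R * R -> R * R) x : {for x, continuous V} ->
  {for x, continuous (fun x => enorm (V x))}.
Proof.
move=> cV; apply: (continuous_comp (f := fun x => dot2 (V x) (V x)) (g := Num.sqrt)).
  exact: continuous_dot2.
exact: sqrt_continuous.
Qed.

Lemma L1norm_Rintegral Omega g : open Omega -> bounded_set Omega -> bmf Omega g ->
  L1norm Omega g = (\int[mu2]_(x in Omega) `|g x|)%:E.
Proof.
move=> oO bO bg; have mO : measurable (Omega : set plane) := measurable_open_plane oO.
rewrite /L1norm Lnorm1 EFin_Rintegral//; last exact: (bmf_integrable oO bO (bmf_norm bg)).
rewrite [RHS]integral_mkcond; apply: eq_integral => x _ /=; rewrite !patchE.
by case: ifP; rewrite ?normr0.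
Qed.

(** By continuity, the set where [|g|] exceeds its essential supremum is open and null, hence
    empty. *)
Lemma Linftynorm_bound Omega g r : open Omega ->
  (forall x, Omega x -> {for x, continuous g}) -> Linftynorm Omega g = r%:E ->
  forall x, Omega x -> `|g x| <= r.
Proof.
move=> oO cg; rewrite /Linftynorm unlock /=.
have mO : measurable (Omega : set plane) := measurable_open_plane oO.
have mT : (0 < mu2 [set: R * R])%E.
  rewrite lt0e measure_ge0 andbT; apply/eqP => /(open_negligible openT).
  by move/seteqP => [/(_ (0, 0))] /(_ I).
rewrite mT => Er x Ox; rewrite leNgt; apply/negP => rg.
pose B := [set x | Omega x /\ r < `|g x|].
have oB : open B.
  rewrite openE => y [Oy ry]; apply: filterI; first exact: open_nbhs_nbhs.
  have cn : {for y, continuous (fun y => `|g y|)} by exact: cvg_norm (cg _ Oy).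
  exact: (cn _ (open_nbhs_nbhs (conj (@open_gt _ r) ry))).
suff B0 : B = set0 by have : B x by []; rewrite B0.
apply: open_negligible => //.
have [Z [mZ Z0 gZ]] := ess_sup_ge mu2 (abse \o (EFin \o (g \_ Omega))).
apply/eqP; rewrite eq_le measure_ge0 andbT -Z0; apply: le_measure.
- by rewrite inE; exact: measurable_open_plane.
- by rewrite inE.
- move=> y [Oy ry]; apply: gZ => /=; rewrite Er lee_fin patchE mem_set//.
  by apply/negP; rewrite -ltNge.
Qed.

Lemma le_hausdorff1 (A B : set (R * R)) : A `<=` B -> (hausdorff1 A <= hausdorff1 B)%E.
Proof.
move=> AB; apply: ge_ereal_sup => _ [d /= d0 <-].
apply: (@le_trans _ _ (hausdorff1_pre d B)); last by apply: ereal_sup_ubound; exists d.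
apply: ereal_inf_le_tmp => _ [U [BU Ud] <-]; exists U => //.
by split => //; exact: subset_trans BU.
Qed.

(** Since [Omega] has a point, all the sup norms are nonnegative, so each is at most their sum. *)
Lemma C2norm_d1_d2 Omega g r x : (C2norm Omega g <= r%:E)%E -> Omega x ->
  `|d1 g x| <= `|r| /\ `|d2 g x| <= `|r|.
Proof.
move=> gr Ox.
have le f : (`|f x|%:E <= supnorm Omega f)%E by apply: ereal_sup_ubound; exists x.
have ge0 f : (0 <= supnorm Omega f)%E by apply: le_trans (le f); rewrite lee_fin.
have rr : (r%:E <= `|r|%:E)%E by rewrite lee_fin ler_norm.
have second : (0 <= supnorm Omega (d1 (d1 g)) + supnorm Omega (d1 (d2 g)) +
    supnorm Omega (d2 (d2 g)))%E by rewrite !adde_ge0.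
have first y : (y <= supnorm Omega (d1 g) + supnorm Omega (d2 g))%E -> (y <= `|r|%:E)%E.
  move=> h; apply: le_trans rr; apply: le_trans gr; apply: le_trans h _.
  exact: le_trans (leeDr _ (ge0 g)) (leeDl _ second).
rewrite -!lee_fin; split; apply: first; apply: le_trans (le _) _.
  by rewrite leeDl.
by rewrite leeDr.
Qed.

End norms.

Theorem theorem4p6 (R : realType) (Omega : set (R * R)) (f : R * R -> R)
    (m M sigma0 sigma1 sigma2 LM : R) (sigma : R * R -> R)
    (Omega_open : open Omega) (Omega_region : connected Omega)
    (Omega_bounded : bounded_set Omega)
    (Omega_boundary : connected (boundary Omega))
    (sigma0_gt0 : 0 < sigma0) (sigma1_gt0 : 0 < sigma1)
    (m_gt0 : 0 < m) (mM : m <= M)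
    (sigma_C2 : Ck_closure 2 Omega sigma)
    (sigma_bound : (C2norm Omega sigma <= sigma2%:E)%E) :
  exists C : R, forall u u' sigma' : R * R -> R,
    admissible sigma0 sigma1 m M Omega f sigma u ->
    admissible sigma0 sigma1 m M Omega f sigma' u' ->
    Ck_closure 2 Omega sigma' ->
    (C2norm Omega sigma' <= sigma2%:E)%E ->
    ereal_sup [set hausdorff1 ([set x | u x = t] `&` Omega) | t in [set: R]]
      = LM%:E ->
    well_structured Omega u LM ->
    (L1norm Omega (fun x => (sigma x - sigma' x)%R) <=
     C%:E * (Linftynorm Omega (fun x => (enorm (current sigma u x) -
                                        enorm (current sigma' u' x))%R))
            `^ (4%:R^-1)%R)%E.
Proof.
pose mu2 := @lebesgue2 R; pose area := fine (mu2 Omega).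
have mO : measurable (Omega : set (measurableTypeR R * measurableTypeR R)) :=
  measurable_open_plane Omega_open.
have area0 : 0 <= area by rewrite fine_ge0// measure_ge0.
pose C0 := stability_constant sigma0 sigma1 `|sigma2| m M LM area.
(* [sigma1 * area] covers large differences of the currents through the crude bound
   [|sigma - sigma'| <= sigma1]. The summand 1 makes [C] positive, so the right side is infinite
   when the sup norm is. *)
pose C := `|C0| + sigma1 * area + 1.
have C_gt0 : 0 < C by rewrite ltr_wpDl// addr_ge0// mulr_ge0// ltW.
have C0C : C0 <= C.
  by rewrite /C -addrA (le_trans (ler_norm _))// lerDl addr_ge0// mulr_ge0// ltW.
have areaC : sigma1 * area <= C.
  by rewrite /C (addrC `|C0|) -addrA lerDl addr_ge0.
exists C => u u' sigma' [[uC1 ucont] scont [ueq uf] sb ub] [[u'C1 u'cont] s'cont [u'eq u'f] s'b u'b].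
move=> sigma'_C2 sigma'_bound LME wellu.
have C1u := Ck_closure_C1 Omega_open uC1; have C1u' := Ck_closure_C1 Omega_open u'C1.
have C1s := Ck_closure_C1 Omega_open sigma_C2.
have C1s' := Ck_closure_C1 Omega_open sigma'_C2.
have s_bounds (r : R * R -> R) : (forall x, Omega x -> sigma0 < r x <= sigma1) ->
    forall x, Omega x -> sigma0 <= r x <= sigma1.
  by move=> rb x /rb/andP[/ltW -> ->].
have currentE (r v : R * R -> R) x : (forall x, Omega x -> sigma0 < r x <= sigma1) -> Omega x ->
    enorm (current r v x) = r x * enorm (grad v x).
  move=> rb /rb/andP[r0 _]; rewrite /current enormN enormZ ger0_norm// ltW//.
  exact: lt_trans r0.
have c_bounds (r v : R * R -> R) : (forall x, Omega x -> sigma0 < r x <= sigma1) ->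
    (forall x, Omega x -> m <= enorm (current r v x) <= M) ->
    forall x, Omega x -> m <= r x * enorm (grad v x) <= M.
  by move=> rb vb x Ox; rewrite -currentE//; exact: vb.
have weak (r v : R * R -> R) : conductivity_equation Omega r v ->
    forall theta, test_function Omega theta ->
    \int[mu2]_(x in Omega) dot2 (r x *: grad v x) (grad theta x) = 0.
  move=> eqn theta /eqn; rewrite /Rintegral => E; rewrite -[RHS]/(fine 0%E) -E; congr fine.
  by apply: eq_integral => x _; rewrite dot2Zl.
have M_gt0 : 0 < M := lt_le_trans m_gt0 mM.
have cw : {within closure Omega, continuous (fun x => u x - u' x)}.
  by move=> x; exact: cvgB (ucont x) (u'cont x).
have w0 x : boundary Omega x -> u x - u' x = 0.
  by move=> bx; rewrite uf// u'f// subrr.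
pose g x := enorm (current sigma u x) - enorm (current sigma' u' x).
have cg x : Omega x -> {for x, continuous g}.
  move=> Ox; have cc (v r : R * R -> R) : C1 Omega v -> {for x, continuous r} ->
      {for x, continuous (fun x => enorm (current r v x))}.
    move=> vC1 cr; have [_ _ c1 c2] := vC1 _ Ox.
    rewrite (_ : (fun y => _) = fun y => enorm (r y *: grad v y)); last first.
      by apply/funext => y; rewrite enormN.
    apply: continuous_enorm; apply/continuous_fst_snd.
    by split; [exact: (continuous_mulr_for cr c1)|exact: (continuous_mulr_for cr c2)].
  exact: cvgB (cc _ _ C1u (scont _ Ox)) (cc _ _ C1u' (s'cont _ Ox)).
have [gamma [gamma' [gaP [K [K0 gaK]] [F [[B FB] _ gaF]]]]] := wellu.
have lenLM x : Omega x -> curve_length (level_curve Omega u x) <= LM.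
  move=> Ox; have [L0 _ _ _] := gaP _ Ox.
  have : (hausdorff1 (level_curve Omega u x) <= LM%:E)%E.
    rewrite -LME; apply: (@le_trans _ _ (hausdorff1 ([set y | u y = u x] `&` Omega))).
      apply: le_hausdorff1; apply: subset_trans (@connected_component_sub _ _ _) _.
      by move=> y [].
    by apply: ereal_sup_ubound; exists (u x).
  (* [fine] sends an infinite length to 0, which [0 < L] excludes. *)
  by move: L0; rewrite /curve_length; case: (hausdorff1 _) => [r| |] //=; rewrite ?ltxx// lee_fin.
have [phi [S [Cphi [S1 Cphi0 phiLM phiL dphi]]]] : exists (phi : R * R -> R) (S C : R),
    [/\ S ^+ 2 = 1, 0 <= C, forall x, Omega x -> 0 <= phi x <= LM,
     forall x, Omega x -> lip_near x phi C &
     forall x, Omega x -> is_derive x (tangent u x) phi S].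
  have ucb := c_bounds _ _ sb ub.
  have gpos x : Omega x -> 0 < enorm (grad u x).
    move=> Ox; rewrite lt0r enorm_ge0 andbT; apply/eqP => g0.
    by have /andP[+ _] := ucb _ Ox; rewrite g0 mulr0 leNgt m_gt0.
  have gM x : Omega x -> enorm (grad u x) <= M / sigma0.
    move=> Ox; rewrite ler_pdivlMr//; have /andP[_] := ucb _ Ox.
    apply: le_trans; rewrite mulrC ler_wpM2r ?enorm_ge0//.
    by have /andP[] := s_bounds _ sb _ Ox.
  have FB' x h (s : R) : Omega x -> enorm h = 1 -> s \in `[0, LM] -> enorm (F x h s) <= `|B|.
    by move=> Ox h1 sI; apply: le_trans (FB _ _ _ Ox h1 sI) (ler_norm _).
  exact: (arclength_coordinate_exists Omega_open Omega_region C1u gM gpos gaP lenLM K0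
    (normr_ge0 B) gaK FB' gaF).
have bsig (r : R * R -> R) : C1 Omega r -> (forall x, Omega x -> sigma0 < r x <= sigma1) ->
    bmf Omega r.
  move=> rC1 rb; apply: (bmf_continuous Omega_open (C := sigma1)) => x Ox.
    exact: C1_continuous rC1 Ox.
  have /andP[r0 r1] := rb _ Ox; rewrite ger0_norm// ltW// (lt_trans sigma0_gt0)//.
have bdiff : bmf Omega (fun x => sigma x - sigma' x) by apply: bmfB; exact: bsig.
rewrite (L1norm_Rintegral Omega_open Omega_bounded bdiff).
have small t : 0 < t -> t <= 1 -> (forall x, Omega x -> `|g x| <= t ^+ 4) ->
    \int[mu2]_(x in Omega) `|sigma x - sigma' x| <= C * t.
  move=> t0 t1 gt; apply: (@le_trans _ _ (C0 * t)); last by rewrite ler_wpM2r// ltW.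
  apply: (stability_estimate Omega_open Omega_bounded C1u C1u' cw w0 C1s C1s'
    (weak _ _ ueq) (weak _ _ u'eq) sigma0_gt0 sigma1_gt0 (normr_ge0 sigma2) m_gt0 M_gt0
    (s_bounds _ sb) (s_bounds _ s'b) (c_bounds _ _ sb ub) (c_bounds _ _ s'b u'b)
    (fun x => C2norm_d1_d2 sigma_bound) (fun x => C2norm_d1_d2 sigma'_bound)
    S1 Cphi0 phiLM phiL dphi t0 t1) => x Ox.
  by rewrite -(currentE _ _ _ sb Ox) -(currentE _ _ _ s'b Ox); exact: gt.
have trivial_bound : \int[mu2]_(x in Omega) `|sigma x - sigma' x| <= C.
  apply: le_trans areaC; rewrite /area -(bmf_Rintegral_cst Omega_open).
  apply: le_Rintegral => //.
  - exact: (bmf_integrable Omega_open Omega_bounded (bmf_norm bdiff)).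
  - exact: (bmf_integrable Omega_open Omega_bounded (bmf_cst _ _)).
  - move=> x Ox; have /andP[a1 a2] := sb _ Ox; have /andP[a3 a4] := s'b _ Ox.
    by rewrite ler_norml; apply/andP; split; lra.
have Einf : (0 <= Linftynorm Omega g)%E by exact: Lnorm_ge0.
case E : (Linftynorm Omega g) Einf => [r| |] // r0; last first.
  by rewrite poweRyr ?invr_eq0// gt0_muley ?lte_fin// leey.
have gr := Linftynorm_bound Omega_open cg E.
rewrite poweR_EFin -EFinM lee_fin; rewrite lee_fin in r0.
set q := r `^ _; have q0 : 0 <= q by exact: powR_ge0.
have qr : q ^+ 4 = r.
  by rewrite -powR_mulrn// -powRrM mulVf// powRr1.
(* The stability estimate assumes [t <= 1]; for [q >= 1] the crude bound suffices. *)
have [q1|q1] := leP 1 q.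
  by apply: le_trans trivial_bound _; rewrite ler_peMr// ltW.
have [q_gt0|] := ltP 0 q.
  by apply: small => //; [exact: ltW|move=> x /gr; rewrite qr].
(* When the current moduli coincide, the estimate holds for every [t] in []0, 1]], and [t] is sent
   to 0. *)
move=> qle0; have q_eq0 : q = 0 by apply/eqP; rewrite eq_le qle0.
rewrite q_eq0 mulr0; apply/ler_addgt0Pl => e e0; rewrite addr0.
pose t := Num.min 1 (e / C).
have t0 : 0 < t by rewrite lt_min ltr01 divr_gt0.
apply: le_trans (small t t0 _ _) _; first by rewrite ge_min lexx.
  by move=> x /gr; rewrite -qr q_eq0 expr0n/= => /le_trans; apply; rewrite exprn_ge0// ltW.
by rewrite mulrC -ler_pdivlMr// ge_min lexx orbT.
Qed.
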